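(* Let $d$ be a prime, and let $\zeta \neq 1$ be a $d$-th root of unity. Let $c_0\in\mathbb{C}$ be a root of $G_{d,m,n}^{\zeta}$ for some integers $m \geq 2$, $n \geq 1$. If $d = 2$, suppose further that $n \geq 3$. Set $K = \mathbb{Q}(c_0)$, and suppose that $\alpha \in K$ satisfies $v_{\mathfrak{p}}(\alpha) \geq 2$ for some prime $\mathfrak{p} \subset \mathcal{O}_K$ lying above $d$. Then $G_{\infty}(f_{d,c_0}, \alpha)$ is non-abelian.
   Context: For a prime $d$ and $c_0\in\mathbb{C}$, $f_{d,c_0}=x^d+c_0$. For a polynomial $f$, $f^n$ denotes the $n$-th iterate: $f^0=x$, $f^n=f\circ f^{n-1}$ for $n\ge 1$. Define polynomials $a_i=a_i(c)\in\mathbb{Z}[c]$ (depending on $d$) by $a_1=c$ and $a_{i+1}=a_i^d+c$ for $i\ge 1$; thus $a_i(c_0)=f_{d,c_0}^i(0)$. For a $d$-th root of unity $\zeta\neq 1$ and integers $m\ge 2$, $n\ge 1$, the monic polynomial $G_{d,m,n}^{\zeta}(c)\in\mathbb{Z}[\zeta][c]$ is defined by $$G_{d,m,n}^{\zeta}(c) := \prod_{k \mid n} \big( a_{m+k-1} - \zeta a_{m-1} \big)^{\mu(n/k)}\cdot \begin{cases}\prod_{k \mid n} \big( a_k \big)^{-\mu(n/k)} & \text{if } n \mid (m-1),\\ 1 & \text{if } n \nmid (m-1),\end{cases}$$ where $\mu$ is the Möbius function. (Its roots are the Misiurewicz parameters of type $(m,n)$ for $\zeta$.) For a number field $K$, $f\in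 K[x]$ of degree at least $2$ and $\alpha\in K$, $G_n(f,\alpha)$ is the Galois group of (the splitting field of) $f^n-\alpha$ over $K$, and $G_\infty(f,\alpha)=\varprojlim G_n(f,\alpha)$, the inverse limit with respect to restriction maps (equivalently, the Galois group over $K$ of the field generated by all roots of all $f^n-\alpha$, $n\ge 1$). $\mathcal{O}_K$ is the ring of integers of $K$, and $v_{\mathfrak{p}}$ is the normalized $\mathfrak{p}$-adic valuation on $K$, with $v_{\mathfrak p}(0)=\infty$. *)

(* Defs.v *)
From HB Require Import structures.
From mathcomp Require Import all_boot all_order all_algebra.
From mathcomp Require Import complex.
From mathcomp Require Import boolp classical_sets functions reals constructive_ereal.

Set Implicit Arguments.
Unset Strict Implicit.
Unset Printing Implicit Defensive.

Import Order.TTheory GRing.Theory Num.Theory.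

Local Open Scope classical_set_scope.
Local Open Scope ring_scope.

(* n is squarefree iff every prime divisor has multiplicity 1 (for n > 0). *)
Definition mobius (n : nat) : int :=
  if all (fun p => logn p n == 1%N) (primes n) then (-1) ^+ size (primes n)
  else 0.

(* Subfields, ideals and Galois groups live inside an ambient field C as sets
   of elements of C; in the theorem C is the field of complex numbers. *)
Section Definitions.
Variable C : fieldType.
Implicit Types (K E F S I J P : set C) (f : {poly C}).

Definition unicritical (d : nat) (c : C) : {poly C} := 'X^d + c%:P.

Definition iter_poly (n : nat) f : {poly C} := iter n (fun g => f \Po g) 'X.

(* The variable 'X is the parameter c.  The recursion is started one step
   earlier, at a_0 = 0; then a_1 = 'X whenever d > 0. *)
Definition crit_orbit (d i : nat) : {poly C} :=
  iter i (fun a => a ^+ d + 'X) 0.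

Definition misiurewicz_frac (d m n : nat) (zeta : C) : {fraction {poly C}} :=
  \prod_(k <- divisors n)
     FracField.tofrac
       (crit_orbit d (m + k - 1) - zeta *: crit_orbit d (m - 1))
       ^ mobius (n %/ k)
  * (if (n %| m - 1)%N then
       \prod_(k <- divisors n)
          FracField.tofrac (crit_orbit d k) ^ (- mobius (n %/ k))
     else 1).

(* The product above is a rational function by construction; the polynomial G
   is the one, necessarily unique, that represents it. *)
Definition is_misiurewicz_poly (d m n : nat) (zeta : C) (G : {poly C}) : Prop :=
  FracField.tofrac G = misiurewicz_frac d m n zeta.

Definition subfield (F : set C) : Prop := divring_closed (mem F).

Definition field_gen S : set C := smallest subfield S.

Definition simple_ext (c : C) : set C := field_gen [set c].

Definition integers_of K : set C :=
  [set x | K x /\ integralOver (intr : int -> C) x].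

Definition ideal_of K I : Prop :=
  [/\ I `<=` integers_of K,
      I 0,
      (forall x y, I x -> I y -> I (x + y))
    & (forall a x, integers_of K a -> I x -> I (a * x))].

Definition prime_ideal_of K P : Prop :=
  [/\ ideal_of K P,
      ~ P 1
    & (forall x y, integers_of K x -> integers_of K y ->
         P (x * y) -> P x \/ P y)].

Definition lies_above P (p : nat) : Prop :=
  forall z : int, P z%:~R <-> (p%:Z %| z)%Z.

Definition ideal_mul I J : set C :=
  [set x | exists (k : nat) (u v : 'I_k -> C),
     [/\ (forall i, I (u i)), (forall i, J (v i)) & x = \sum_i u i * v i]].

Definition ideal_pow K P (n : nat) : set C :=
  iter n (ideal_mul P) (integers_of K).

(* For x a nonzero element of O_K: the largest n such that x is in P^n. *)
Definition ord_at K P (x : C) : nat :=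
  xget 0%N [set n | ideal_pow K P n x /\ ~ ideal_pow K P n.+1 x].

(* The normalized P-adic valuation on K = Frac(O_K), with values in Z and +oo:
   v_P(a / b) = ord_P(a) - ord_P(b), whichever a, b represent the element. *)
Definition val_at K P (x : C) : \bar int :=
  if x == 0 then +oo%E
  else (xget 0 [set z : int | exists a b,
          [/\ integers_of K a, integers_of K b, b != 0, x = a / b
            & z = (ord_at K P a)%:Z - (ord_at K P b)%:Z]])%:E.

(* The subfield of C generated over K by the roots of f^n - alpha; when C is
   algebraically closed this is the splitting field of f^n - alpha over K. *)
Definition preimage_field K f (alpha : C) (n : nat) : set C :=
  field_gen (K `|` [set x | root (iter_poly n f - alpha%:P) x]).

(* Gal(E / F).  An automorphism of E is represented by any map C -> C that
   restricts to it: two maps agreeing on E stand for the same element. *)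
Definition gal F E : set (C -> C) :=
  [set s | [/\ set_bij E E s,
               (forall x y, E x -> E y -> s (x + y) = s x + s y),
               (forall x y, E x -> E y -> s (x * y) = s x * s y)
             & (forall x, F x -> s x = x)]].

(* G_n(f, alpha) *)
Definition arboreal_gal K f (alpha : C) (n : nat) : set (C -> C) :=
  gal K (preimage_field K f alpha n).

(* G_oo(f, alpha): families (s_n) in the product of the G_n such that s_{n+1}
   restricts to s_n, with componentwise composition. *)
Definition arboreal_gal_lim K f (alpha : C) : set (nat -> C -> C) :=
  [set s | (forall n, arboreal_gal K f alpha n (s n)) /\
           (forall n x, preimage_field K f alpha n x -> s n.+1 x = s n x)].

Definition arboreal_gal_lim_abelian K f (alpha : C) : Prop :=
  forall s t, arboreal_gal_lim K f alpha s -> arboreal_gal_lim K f alpha t ->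
  forall n x, preimage_field K f alpha n x -> s n (t n x) = t n (s n x).

End Definitions.

(* Main.v *)
Require Import Defs.
From HB Require Import structures.
From mathcomp Require Import all_boot all_order all_algebra.
From mathcomp Require Import complex.
From mathcomp Require Import boolp classical_sets functions reals constructive_ereal.
From mathcomp Require Import ring zify.

(** Write [a_j] for the [j]-th point of the orbit of 0 under [f = X^d + c], and let
[P] be a prime of [K = Q(c)] above [d].

Counting orders of vanishing in the product that defines [G] shows that [c] has
exact type [(m, n)]: [a_(m-1)] is nonzero, [a_(m+n-1) = zeta * a_(m-1)], and the
tail of the orbit has exact period [n] ([misiurewicz_not_periodic],
[misiurewicz_exact], [misiurewicz_period]). Modulo [P] the map [f] is Frobenius
followed by a translation, hence injective, and it contracts the residue disc of
0; so 0 is periodic modulo [P] of exact period [n] ([orb_mod_prime]).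

The localization [O] of [Z[c]] at [P] is a discrete valuation ring with
uniformizer [pi = a_n], and [1 - zeta] has positive order [Q] in it
([localization_dvr]). Hence [O] is the full local ring of [K] at [P], and the
hypothesis on [alpha] says that [pi ^+ 2] divides [alpha] ([val_at_ge_ord]).
Modulo [d] the iterate [f^r (X + c)] is [X^(d^r) + a_(r+1)], and [a_(r+1)] has
order 1 when [n] divides [r + 1]; so [f^r (X + c) - alpha] is an Eisenstein
polynomial. For a root [b], the ring [O[b]] is a discrete valuation ring
with uniformizer [b], in which [1 - zeta] has order [E = d^r * Q], and
[f^r - alpha] is irreducible over [K] ([eisenstein_dvr], [eisenstein_free]).

Put [u = b + c], so that [f^r(u) = alpha] and the preimages of [u] are the [d]-th
roots of [b]. As [r > 0], the conjugates of [u] include [zeta^i * u]. If the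
Galois group is abelian, then by Kummer theory each quotient
[(zeta^i * u - c) / (u - c)] is a [d]-th power in [M = K(u)] ([abelian_kummer]).
However, [1 + w] is not a [d]-th power in [M] when the order of [w] is less than
[d * E] and not divisible by [d] ([not_pow]). For [n >= 2] the quotient with
[i = 1] is of this form, with [w] of order [E - 1]. For [n = 1] and [d >= 3] one
takes the square of the first quotient divided by the second.

Automorphisms are built as maximal graphs of homomorphisms, so that a homomorphism
defined on a subfield extends to all algebraic numbers at once ([hom_extension])
and defines a point of the inverse limit. *)

Import Order.TTheory GRing.Theory Num.Theory.

Local Open Scope classical_set_scope.
Local Open Scope ring_scope.

Set Implicit Arguments.
Unset Strict Implicit.
Unset Printing Implicit Defensive.

(** * The maps y -> y ^ d + c and their orbits *)

Section Unicritical.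
Variables (R : comNzRingType) (d : nat).

Definition unic (c y : R) : R := y ^+ d + c.
Definition orb (c : R) (j : nat) : R := iter j (unic c) 0.

Lemma orbS c j : orb c j.+1 = orb c j ^+ d + c.
Proof. by []. Qed.

Lemma orbD c i j : orb c (i + j) = iter i (unic c) (orb c j).
Proof. by rewrite /orb iterD. Qed.

Lemma orb1 c : (0 < d)%N -> orb c 1 = c.
Proof. by move=> d0; rewrite orbS /= expr0n; case: d d0 => //= k _; rewrite add0r. Qed.

Lemma iter_unic_closed (S : subringClosed R) c y j :
  c \in S -> y \in S -> iter j (unic c) y \in S.
Proof. by move=> hc hy; elim: j => //= j IH; rewrite rpredD ?rpredX. Qed.

Lemma orb_closed (S : subringClosed R) c j : c \in S -> orb c j \in S.
Proof. by move=> hc; rewrite iter_unic_closed ?rpred0. Qed.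

Lemma iter_unic_root c z y j : z ^+ d = 1 -> (0 < j)%N ->
  iter j (unic c) (z * y) = iter j (unic c) y.
Proof. by case: j => // j hz _; rewrite !iterSr {2}/unic exprMn hz mul1r. Qed.

Hypothesis d_prime : prime d.

(** The middle binomial coefficients are divisible by [d]. *)
Lemma prime_exprD (S : subringClosed R) (s t : R) : s \in S -> t \in S ->
  exists2 w, w \in S & (s + t) ^+ d = s ^+ d + t ^+ d + d%:R * (s * t * w).
Proof.
move=> hs ht.
have d2 := prime_gt1 d_prime.
exists (\sum_(i < d.-1) s ^+ (d.-2 - i) * t ^+ i *+ ('C(d, i.+1) %/ d)).
  by apply: rpred_sum => i _; rewrite rpredMn // rpredM ?rpredX.
rewrite exprDn.
case: d d2 d_prime => // -[//|k] _ pk.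
rewrite big_ord_recl big_ord_recr /= bin0 subn0 expr0 mulr1 mulr1n.
rewrite /bump /= !add1n binn subnn expr0 mul1r mulr1n -addrA; congr (_ + _).
rewrite [RHS]addrC; congr (_ + _).
rewrite !mulr_sumr; apply: eq_bigr => i _.
rewrite /bump /= add1n subSS.
have hi : (i < k.+1)%N by [].
have dv : (k.+2 %| 'C(k.+2, i.+1))%N by apply: prime_dvd_bin => //; rewrite ltnS.
move: dv; set N := binomial _ _ => /divnK <-; rewrite mulnK //.
rewrite (_ : (k.+1 - i)%N = (k - i).+1) ?subSn // !exprS.
by rewrite mulrnA -[_ *+ k.+2]mulr_natl mulrnAr !mulrA [s * t * _]mulrAC.
Qed.

(** Modulo [d] the map [y => y ^+ d + c] is Frobenius followed by a
translation. The factor [x] in the error term makes the iterate, expanded at a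
point [y], an Eisenstein polynomial up to its constant coefficient. *)
Lemma iter_unicD (S : subringClosed R) c x y j :
  c \in S -> x \in S -> y \in S -> exists2 z, z \in S &
    iter j (unic c) (x + y) = x ^+ (d ^ j) + iter j (unic c) y + d%:R * (x * z).
Proof.
move=> hc hx hy; elim: j => [|j [z hz IH]].
  by exists 0; rewrite ?rpred0 //= expn0 expr1 !mulr0 addr0.
set t := iter j (unic c) y in IH *.
have ht : t \in S by apply: iter_unic_closed.
have dj0 : (0 < d ^ j)%N by rewrite expn_gt0 prime_gt0.
pose x' := x ^+ (d ^ j).-1 + d%:R * z.
have hx' : x' \in S by rewrite rpredD ?rpredX ?rpredM ?rpred_nat.
have E : iter j (unic c) (x + y) = x * x' + t.
  by rewrite IH /x' mulrDr -exprS prednK //; ring.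
have [w hw Ew] := prime_exprD (rpredM hx hx') ht.
have [w' hw' Ew'] := prime_exprD (rpredX (d ^ j) hx) (rpredM (rpred_nat S d) (rpredM hx hz)).
exists (x ^+ (d ^ j) * (d%:R * z) * w' + d%:R ^+ d.-1 * x ^+ d.-1 * z ^+ d + x' * t * w).
  by rewrite !rpredD ?rpredM ?rpredX ?rpred_nat.
rewrite !iterS E {1}/unic Ew -/t.
rewrite (_ : x * x' = x ^+ (d ^ j) + d%:R * (x * z)); last first.
  by rewrite /x' mulrDr -exprS prednK //; ring.
rewrite Ew' expnSr exprM /unic /x'.
rewrite !exprMn; move: Ew => _.
have dE (r : R) : r ^+ d = r * r ^+ d.-1 by rewrite -exprS prednK ?prime_gt0.
have dj : x ^+ (d ^ j) = x * x ^+ (d ^ j).-1 by rewrite -exprS prednK.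
rewrite !(dE (d%:R)) !(dE x) !dj.
move: (x ^+ _) (d%:R ^+ _) (z ^+ d) (_ ^+ d) (x ^+ _) => a1 a2 a3 a4 a5; ring.
Qed.

(** The linear term is missing because 0 is a critical point, so the error is
divisible by [x ^+ d] and not only by [x]. *)
Lemma iter_unic0 (S : subringClosed R) c x j : (0 < j)%N ->
  c \in S -> x \in S -> exists2 z, z \in S &
    iter j (unic c) x = x ^+ (d ^ j) + orb c j + d%:R * (x ^+ d * z).
Proof.
case: j => // j _ hc hx.
have [z hz E] := iter_unicD j hc (rpredX d hx) hc.
exists z => //; rewrite iterSr {2}/unic E -exprM -expnS.
by rewrite /orb iterSr /unic expr0n; case: d d_prime => //= k _; rewrite add0r.
Qed.

Lemma iter_unic_sub (S : subringClosed R) c x y j :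
  c \in S -> x \in S -> y \in S -> exists2 L, L \in S &
    iter j (unic c) x - iter j (unic c) y = (x - y) * L.
Proof.
move=> hc hx hy; elim: j => [|j [L hL IH]] /=; first by exists 1; rewrite ?rpred1 ?mulr1.
rewrite /unic opprD addrACA subrr addr0 subrXX IH.
exists (L * \sum_(i < d) iter j (unic c) x ^+ (d.-1 - i) * iter j (unic c) y ^+ i).
  rewrite rpredM // rpred_sum // => i _.
  by rewrite rpredM // rpredX // iter_unic_closed.
by rewrite mulrA.
Qed.

End Unicritical.

Lemma rmorph_iter_unic (R S : comNzRingType) (f : {rmorphism R -> S}) d c y j :
  f (iter j (unic d c) y) = iter j (unic d (f c)) (f y).
Proof. by elim: j => //= j IH; rewrite /unic rmorphD rmorphXn IH. Qed.

Lemma rmorph_orb (R S : comNzRingType) (f : {rmorphism R -> S}) d c j :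
  f (orb d c j) = orb d (f c) j.
Proof. by rewrite /orb rmorph_iter_unic rmorph0. Qed.

Lemma size_iter_unic (R : idomainType) d (c y : {poly R}) e j :
  (1 < d)%N -> (size c <= 2)%N -> y \is monic -> size y = e.+1 -> (0 < e)%N ->
  iter j (unic d c) y \is monic /\ size (iter j (unic d c) y) = (e * d ^ j).+1.
Proof.
move=> d2 sc my sy e0; elim: j => [|j [mj sj]]; first by rewrite muln1.
have mX : iter j (unic d c) y ^+ d \is monic by apply: monic_exp.
have sX : size (iter j (unic d c) y ^+ d) = (e * d ^ j.+1).+1.
  by rewrite -[LHS]prednK ?size_poly_gt0 ?monic_neq0 // size_exp sj expnSr mulnA.
have lt : (size c < size (iter j (unic d c) y ^+ d))%N.
  rewrite sX ltnS (leq_trans sc) // (leq_trans d2) // expnS mulnCA leq_pmulr //.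
  by rewrite muln_gt0 e0 expn_gt0 ltnW.
by rewrite iterS /unic size_polyDl // monicE lead_coefDl // -monicE.
Qed.

Definition adjoin (R : comNzRingType) (S : {pred R}) (u : R) : {pred R} :=
  [pred x | `[< exists2 p : {poly R}, p \is a polyOver S & x = p.[u] >]].

Lemma adjoin_subring (R : comNzRingType) (S : subringClosed R) u :
  subring_closed (adjoin S u).
Proof.
split.
- by apply/asboolP; exists 1; rewrite ?rpred1 ?hornerC.
- move=> _ _ /asboolP [p hp ->] /asboolP [q hq ->].
  by apply/asboolP; exists (p - q); rewrite ?rpredB // hornerD hornerN.
- move=> _ _ /asboolP [p hp ->] /asboolP [q hq ->].
  by apply/asboolP; exists (p * q); rewrite ?rpredM // hornerM.
Qed.
HB.instance Definition _ (R : comNzRingType) (S : subringClosed R) u :=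
  GRing.isSubringClosed.Build R (adjoin S u) (@adjoin_subring R S u).

Section Adjoin.
Variables (R : comNzRingType) (S : subringClosed R).

Lemma adjoinP u x :
  reflect (exists2 p : {poly R}, p \is a polyOver S & x = p.[u]) (x \in adjoin S u).
Proof. exact: asboolP. Qed.

Lemma mem_adjoin u x : x \in S -> x \in adjoin S u.
Proof. by move=> hx; apply/adjoinP; exists x%:P; rewrite ?polyOverC ?hornerC. Qed.

Lemma adjoin_gen u : u \in adjoin S u.
Proof. by apply/adjoinP; exists 'X; rewrite ?polyOverX ?hornerX. Qed.

Lemma adjoin_sub (T : subringClosed R) u :
  {subset S <= T} -> u \in T -> {subset adjoin S u <= T}.
Proof.
move=> ST uT _ /adjoinP [p hp ->]; apply: rpred_horner => //.
by apply/polyOverP => i; apply/ST/(polyOverP hp).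
Qed.

Lemma polyOver_split (p : {poly R}) : p \is a polyOver S ->
  exists2 q, q \is a polyOver S & p = q * 'X + (p`_0)%:P.
Proof.
move=> hp; exists (\poly_(i < (size p).-1) p`_i.+1).
  by apply/polyOverP => i; rewrite coef_poly; case: ifP => _; rewrite ?rpred0 ?(polyOverP hp).
apply/polyP => i; rewrite coefD coefMX coefC coef_poly.
case: i => [|i] /=; first by rewrite add0r.
rewrite addr0; case: ifP => // h; rewrite nth_default //.
by move: h; case: (size p) => //= k; lia.
Qed.

End Adjoin.

(** After division by a power of ['X] the relation has a nonzero constant
coefficient, and this coefficient is the required multiple of [x]. The lemma
plays the part of the norm. *)
Lemma root_const (F : fieldType) (S : subringClosed F) (p : {poly F}) x :
  p \is a polyOver S -> p != 0 -> root p x -> x != 0 ->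
  exists2 y, y \in adjoin S x & (x * y \in S) && (x * y != 0).
Proof.
move=> + + + x0; have [k] := ubnP (size p); elim: k p => // k IH p hk hp p0 rp.
have [q hq E] := polyOver_split hp.
have [c0|c0] := eqVneq p`_0 0.
  rewrite c0 addr0 in E.
  have q0 : q != 0 by apply: contraNneq p0 => q0; rewrite E q0 mul0r.
  apply: (IH q) => //.
    by move: hk; rewrite E size_mulX.
  by move: rp; rewrite E rootM; case/orP => //; rewrite rootX (negPf x0).
exists (- q.[x]); first by rewrite rpredN; apply/adjoinP; exists q.
have -> : x * - q.[x] = p`_0.
  move: rp; rewrite {1}E rootE hornerD hornerMX hornerC => /eqP/(canRL (addKr _)) ->.
  by rewrite addr0 mulrN mulrC.
by rewrite c0 (polyOverP hp).
Qed.

(** * Discrete valuation rings *)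

Section Valuation.
Variable C : fieldType.
Implicit Types (O : {pred C}) (p x y v w : C).

Definition ounit O v := [&& v != 0, v \in O & v^-1 \in O].

(** The valuation ring is a set of elements of a large field, so that rings with
different fields of fractions can be compared by inclusion; [p] is a
uniformizer. *)
Definition dvr O p := [/\ p \in O, p^-1 \notin O &
  forall x, x \in O -> x != 0 -> exists k, ounit O (x / p ^+ k)].

(** The order is a relation and not a function, so that no value at 0 has to be
chosen. *)
Definition has_ord O p (k : nat) x := ounit O (x / p ^+ k).
Definition ge_ord O p (k : nat) x := x / p ^+ k \in O.

(** In a discrete valuation ring, inverting [p] gives the field of fractions. *)
Definition frac O p : {pred C} := [pred x | `[< exists k, x * p ^+ k \in O >]].

Lemma fracP O p x : reflect (exists k, x * p ^+ k \in O) (x \in frac O p).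
Proof. exact: asboolP. Qed.

End Valuation.

Section ValuationTheory.
Variables (C : fieldType) (O : subringClosed C) (p : C).
Hypothesis dvrO : dvr O p.
Implicit Types x y v w : C.

Lemma dvr_mem : p \in O. Proof. by case: dvrO. Qed.

Lemma dvr_neq0 : p != 0.
Proof. by case: dvrO => _ + _; apply: contraNneq => ->; rewrite invr0 rpred0. Qed.

Let p0 := dvr_neq0.
Let pX0 k : p ^+ k != 0. Proof. exact: expf_neq0. Qed.

Lemma ounit1 : ounit O 1.
Proof. by rewrite /ounit oner_eq0 invr1 rpred1. Qed.

Lemma ounitM v w : ounit O v -> ounit O w -> ounit O (v * w).
Proof.
case/and3P=> v0 v1 v2 /and3P [w0 w1 w2].
by rewrite /ounit mulf_neq0 // invfM !rpredM.
Qed.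

Lemma ounitV v : ounit O v -> ounit O v^-1.
Proof. by case/and3P=> v0 v1 v2; rewrite /ounit invr_eq0 v0 invrK v1 v2. Qed.

Lemma ounitX v k : ounit O v -> ounit O (v ^+ k).
Proof. by move=> hv; elim: k => [|k IH]; rewrite ?expr0 ?ounit1 // exprS ounitM. Qed.

Lemma ge_ord0 x : ge_ord O p 0 x = (x \in O).
Proof. by rewrite /ge_ord expr0 divr1. Qed.

Lemma has_ord0 x : has_ord O p 0 x = ounit O x.
Proof. by rewrite /has_ord expr0 divr1. Qed.

Lemma has_ord_ge k x : has_ord O p k x -> ge_ord O p k x.
Proof. by case/and3P. Qed.

Lemma has_ord_neq0 k x : has_ord O p k x -> x != 0.
Proof. by case/and3P=> + _ _; apply: contraNneq => ->; rewrite mul0r. Qed.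

Lemma ge_ordW j k x : (j <= k)%N -> ge_ord O p k x -> ge_ord O p j x.
Proof.
rewrite /ge_ord => jk hx.
have -> : x / p ^+ j = (x / p ^+ k) * p ^+ (k - j).
  by rewrite -(subnK jk) addnK exprD invfM; field; rewrite !pX0.
by rewrite rpredM // rpredX // dvr_mem.
Qed.

Lemma ge_ord_mem k x : ge_ord O p k x -> x \in O.
Proof. by move/(ge_ordW (leq0n k)); rewrite ge_ord0. Qed.

Lemma ge_ordX k : ge_ord O p k (p ^+ k).
Proof. by rewrite /ge_ord divff ?rpred1 ?pX0. Qed.

Lemma has_ordX k : has_ord O p k (p ^+ k).
Proof. by rewrite /has_ord divff ?ounit1 ?pX0. Qed.

Lemma ge_ordD k x y : ge_ord O p k x -> ge_ord O p k y -> ge_ord O p k (x + y).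
Proof. by rewrite /ge_ord mulrDl => *; rewrite rpredD. Qed.

Lemma ge_ordN k x : ge_ord O p k (- x) = ge_ord O p k x.
Proof. by rewrite /ge_ord mulNr rpredN. Qed.

Lemma ge_ordM j k x y : ge_ord O p j x -> ge_ord O p k y -> ge_ord O p (j + k) (x * y).
Proof. by rewrite /ge_ord exprD invfM mulrACA => *; rewrite rpredM. Qed.

Lemma has_ordM j k x y : has_ord O p j x -> has_ord O p k y -> has_ord O p (j + k) (x * y).
Proof. by rewrite /has_ord exprD invfM mulrACA => *; rewrite ounitM. Qed.

Lemma has_ordXn k j x : has_ord O p k x -> has_ord O p (k * j) (x ^+ j).
Proof. by rewrite /has_ord exprM -expr_div_n => *; rewrite ounitX. Qed.

Lemma has_ordN k x : has_ord O p k (- x) = has_ord O p k x.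
Proof. by rewrite /has_ord /ounit mulNr oppr_eq0 invrN !rpredN. Qed.

Lemma has_ord_le j k x : has_ord O p k x -> ge_ord O p j x -> (j <= k)%N.
Proof.
move=> hk hj; rewrite leqNgt; apply/negP => kj.
move: (hk) => /and3P [h0 _ h2]; case: dvrO => _ /negP + _; apply.
have := ge_ordW kj hj; rewrite /ge_ord exprSr invfM mulrA => h.
rewrite -(mulKf h0 p^-1) rpredM //.
Qed.

Lemma has_ord_inj j k x : has_ord O p j x -> has_ord O p k x -> j = k.
Proof.
move=> hj hk; apply/eqP; rewrite eqn_leq.
by rewrite (has_ord_le hk (has_ord_ge hj)) (has_ord_le hj (has_ord_ge hk)).
Qed.

Lemma has_ord_exists x : x \in O -> x != 0 -> exists k, has_ord O p k x.
Proof. by case: dvrO => _ _; exact. Qed.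

(** If [1 + p * y] had positive order, [p] would divide 1. *)
Lemma ounit_add1 y : y \in O -> ounit O (1 + p * y).
Proof.
move=> hy.
have hp : forall z, z \in O -> p * z != 1.
  move=> z hz; case: dvrO => _ /negP + _; apply: contra_notN => /eqP h.
  by rewrite -(mulr1 p^-1) -h mulKf.
have h0 : 1 + p * y != 0.
  rewrite addr_eq0; apply: contraTneq isT => h; have := hp (- y).
  by rewrite rpredN mulrN -h eqxx => /(_ hy).
have hO : 1 + p * y \in O by rewrite rpredD ?rpred1 // rpredM // dvr_mem.
have [[|k] hk] := has_ord_exists hO h0; first by rewrite -has_ord0.
have /(ge_ordW (ltn0Sn k)) := has_ord_ge hk; rewrite /ge_ord expr1 => h.
have := hp ((1 + p * y) / p - y); rewrite rpredB // => /(_ isT) /eqP [].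
by field.
Qed.

(** The term of strictly smaller order decides the order of a sum. *)
Lemma has_ordD k x y : has_ord O p k x -> ge_ord O p k.+1 y -> has_ord O p k (x + y).
Proof.
rewrite /has_ord /ge_ord => hx; rewrite exprS invfM => hy.
case/and3P: (hx) => h0 h1 h2.
have -> : (x + y) / p ^+ k = (x / p ^+ k) * (1 + p * (y * (p^-1 * (p ^+ k)^-1) * (x / p ^+ k)^-1)).
  have x0 : x != 0 by apply: contraNneq h0 => ->; rewrite mul0r.
  by field; rewrite ?x0 ?p0 ?pX0.
by rewrite ounitM // ounit_add1 // rpredM.
Qed.

Lemma has_ordB k x y : has_ord O p k x -> ge_ord O p k.+1 y -> has_ord O p k (x - y).
Proof. by move=> hx hy; rewrite has_ordD ?ge_ordN. Qed.

Lemma has_ord_div j k x y : (k <= j)%N ->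
  has_ord O p j x -> has_ord O p k y -> has_ord O p (j - k) (x / y).
Proof.
move=> kj; rewrite /has_ord => hx hy.
have y0 := has_ord_neq0 hy.
have -> : x / y / p ^+ (j - k) = (x / p ^+ j) * (y / p ^+ k)^-1.
  rewrite -{2}(subnK kj) exprD; by field; rewrite ?pX0 ?y0.
by rewrite ounitM // ounitV.
Qed.

Lemma frac_mem x : x \in O -> x \in frac O p.
Proof. by move=> hx; apply/fracP; exists 0%N; rewrite mulr1. Qed.

Lemma frac_ord x : x \in frac O p -> x != 0 ->
  exists k, exists2 j, has_ord O p j (x * p ^+ k) & (x \notin O -> (j < k)%N).
Proof.
move=> /fracP [k hk] x0; have [j hj] := has_ord_exists hk (mulf_neq0 x0 (pX0 k)).
exists k, j => //; apply: contraNT; rewrite -leqNgt => kj.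
case/and3P: hj => _ + _; rewrite -{1}(subnK kj) exprD invfM.
have -> : x * p ^+ k * ((p ^+ (j - k))^-1 * (p ^+ k)^-1) = x / p ^+ (j - k).
  by field; rewrite ?pX0.
by move=> h; rewrite -(divfK (pX0 (j - k)) x) rpredM // rpredX // dvr_mem.
Qed.

Lemma frac_divring : divring_closed (frac O p).
Proof.
split; first by rewrite frac_mem ?rpred1.
- move=> x y /fracP [j hj] /fracP [k hk]; apply/fracP; exists (j + k)%N.
  have -> : (x - y) * p ^+ (j + k) = x * p ^+ j * p ^+ k - y * p ^+ k * p ^+ j.
    by rewrite exprD; ring.
  by rewrite rpredB // rpredM // rpredX // dvr_mem.
move=> x y hx hy; have [->|y0] := eqVneq y 0; first by rewrite invr0 mulr0 frac_mem ?rpred0.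
have [k [j hj _]] := frac_ord hy y0; case/fracP: hx => i hi.
apply/fracP; exists (i + j)%N.
case/and3P: hj => _ _ h.
have -> : x / y * p ^+ (i + j) = (x * p ^+ i) * (y * p ^+ k / p ^+ j)^-1 * p ^+ k.
  by rewrite exprD; field; rewrite ?pX0 ?y0.
by rewrite rpredM ?rpredX ?dvr_mem // rpredM.
Qed.

(** Discrete valuation rings are integrally closed: for [x] of negative order,
dividing the equation of degree [N] by [x ^+ N] gives [1 + p * z = 0], which
contradicts [ounit_add1]. *)
Lemma frac_integral (S : subringClosed C) x (q : {poly C}) :
  {subset S <= O} -> x \in frac O p -> q \is monic -> q \is a polyOver S -> root q x -> x \in O.
Proof.
move=> SO hx mq hq rq; apply/negPn/negP => xO.
have x0 : x != 0 by apply: contraNneq xO => ->; rewrite rpred0.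
have [k [j hj /(_ xO) jk]] := frac_ord hx x0.
case/and3P: hj => h0 h1 h2; set v := _ / _ in h0 h1 h2.
have hxV : x^-1 = p * (p ^+ (k - j).-1 * v^-1).
  rewrite mulrA -exprS prednK ?subn_gt0 // /v -{2}(subnK (ltnW jk)) exprD.
  by field; rewrite ?pX0.
set y := _ * v^-1 in hxV.
have yO : y \in O by rewrite rpredM // rpredX // dvr_mem.
have [q' hq' E] : exists2 q', q' \is a polyOver O & q = 'X^((size q).-1) + q' /\ (size q' < size q)%N.
  exists (q - 'X^((size q).-1)).
    by rewrite rpredB ?polyOverXn //; apply/polyOverP => i; apply/SO/(polyOverP hq).
  split; first by rewrite addrC subrK.
  have s0 : (0 < size q)%N by rewrite size_poly_gt0 monic_neq0.
  rewrite -(prednK s0) ltnS; apply/leq_sizeP => i hi.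
  rewrite coefB coefXn; case: eqP => [->|ne].
    by rewrite -lead_coefE (monicP mq) subrr.
  rewrite nth_default ?subrr // -(prednK s0) ltn_neqAle hi andbT eq_sym; exact/eqP.
case: E => E sq.
set N := (size q).-1 in E.
have [z zO Ez] : exists2 z, z \in O & q'.[x] / x ^+ N = p * z.
  exists (\sum_(i < size q') q'`_i * (p ^+ (N - i).-1 * y ^+ (N - i))).
    by apply: rpred_sum => i _; rewrite !rpredM ?(polyOverP hq') // rpredX // dvr_mem.
  rewrite horner_coef mulr_suml mulr_sumr; apply: eq_bigr => i _.
  have iN : (i < N)%N.
    by rewrite (leq_trans (ltn_ord i)) // -ltnS prednK // (leq_ltn_trans _ sq).
  have -> : q'`_i * x ^+ i / x ^+ N = q'`_i * (p * y) ^+ (N - i).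
    rewrite -hxV exprVn -mulrA; congr (_ * _).
    by rewrite -{1}(subnK (ltnW iN)) exprD invfM mulrC mulfVK ?expf_neq0.
  have -> : (p * y) ^+ (N - i) = p * (p ^+ (N - i).-1 * y ^+ (N - i)).
    by rewrite mulrA -exprS prednK ?subn_gt0 // exprMn.
  by rewrite mulrCA.
move: rq; rewrite rootE {1}E hornerD hornerXn => /eqP h.
have : 1 + p * z = 0.
  by rewrite -Ez -(divff (expf_neq0 N x0)) -mulrDl h mul0r.
by move=> h'; have /and3P [] := ounit_add1 zO; rewrite h' eqxx.
Qed.

End ValuationTheory.

Section DvrIntro.
Variables (C : fieldType) (O : subringClosed C) (p : C).

(** A local ring with principal maximal ideal is a discrete valuation ring as soon
as no nonzero element is infinitely divisible by [p]; the last hypothesis ensures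
this, since every nonzero element divides some power of [p]. *)
Lemma dvr_intro : p \in O -> p^-1 \notin O ->
  (forall x, x \in O -> ounit O x \/ exists2 y, y \in O & x = p * y) ->
  (forall x, x \in O -> x != 0 -> exists2 y, y \in O & exists k, ounit O (x * y / p ^+ k)) ->
  dvr O p.
Proof.
move=> pO pV loc fin; split => // x xO x0.
have p0 : p != 0 by apply: contraNneq pV => ->; rewrite invr0 rpred0.
have [y yO [k hk]] := fin x xO x0.
elim: k x xO x0 y yO hk => [|k IH] x xO x0 y yO hk; have [ux|[z zO E]] := loc x xO;
  try (by exists 0%N; rewrite expr0 divr1).
  case/negP: pV; case/and3P: hk => h0 _; rewrite expr0 divr1 E.
  move=> h; rewrite -(mulr1 p^-1) -(divff h0) expr0 divr1 E.
  by rewrite -!mulrA mulKf // mulrA rpredM // ?rpredM // !mulrA.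
have z0 : z != 0 by apply: contraNneq x0 => z0; rewrite E z0 mulr0.
have [|j hj] := IH z zO z0 y yO.
  by move: hk; rewrite E exprS invfM; congr (ounit _ _); field; rewrite p0 expf_neq0.
exists j.+1; move: hj; rewrite E exprS invfM; congr (ounit _ _).
by field; rewrite p0 expf_neq0.
Qed.

End DvrIntro.

(** * Eisenstein polynomials *)

(** A subring as a type, which gives access to polynomials with coefficients in it
and to the theory of integral elements. *)
Record subring_type (R : comNzRingType) (S : subringClosed R) :=
  SubringElt { subring_val : R; _ : subring_val \in S }.
HB.instance Definition _ (R : comNzRingType) (S : subringClosed R) :=
  [isSub for @subring_val R S].
HB.instance Definition _ (R : comNzRingType) (S : subringClosed R) :=
  [Choice of subring_type S by <:].
HB.instance Definition _ (R : comNzRingType) (S : subringClosed R) :=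
  [SubChoice_isSubComNzRing of subring_type S by <:].

Section Eisenstein.
Variables (C : fieldType) (O : subringClosed C).

Lemma adjoin_integral (h : {poly C}) u x :
  h \is monic -> h \is a polyOver O -> root h u -> x \in adjoin O u ->
  exists q : {poly C}, [/\ q \is monic, q \is a polyOver O & root q x].
Proof.
move=> mh hO rh /adjoinP [q hq ->].
pose f : {rmorphism subring_type O -> C} := val.
have inO (r : {poly C}) : r \is a polyOver O -> {in r : seq C, integralRange f}.
  move=> hr y hy; have yO : y \in O by move/allP: hr; apply.
  exact: (@integral_id _ _ f (SubringElt yO)).
have [p mp rp] := integral_horner_root mh rh (inO _ hO) (inO _ hq).
exists (map_poly f p); split => //; first exact: monic_map.
by apply/polyOverP => i; rewrite coef_map; exact: valP.
Qed.

Variables (p : C).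
Hypothesis dvrO : dvr O p.
Variables (h : {poly C}) (b : C).
Hypotheses (mh : h \is monic) (hO : h \is a polyOver O) (rh : root h b).
Let D := (size h).-1.
Hypothesis D_gt0 : (0 < D)%N.
Hypothesis h_low : forall i, (i < D)%N -> ge_ord O p 1 h`_i.
Hypothesis h_const : has_ord O p 1 h`_0.

Let B : subringClosed C := adjoin O b.
Let OB : {subset O <= B}. Proof. by move=> x; apply: mem_adjoin. Qed.
Let bB : b \in B. Proof. exact: adjoin_gen. Qed.
Let ounitB v : ounit O v -> ounit B v.
Proof. by case/and3P => v0 v1 v2; rewrite /ounit v0 !OB. Qed.
Let p0 := dvr_neq0 dvrO.

(** As [r] is integral over [O], the element [1 + p * r] is the root of a monic
polynomial over [O] whose constant coefficient is congruent to 1 modulo [p] up to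
sign; so it divides a unit. This makes [O[b]] local. *)
Let ounitB_add1 r : r \in B -> ounit B (1 + p * r).
Proof.
move=> rB; have [q [mq hq rq]] := adjoin_integral mh hO rh rB.
have s0 : (0 < size q)%N by rewrite size_poly_gt0 monic_neq0.
set k := (size q).-1.
pose t := \sum_(i < k) q`_i * (- p) ^+ (k - i).-1.
have tO : t \in O.
  by apply: rpred_sum => i _; rewrite rpredM ?(polyOverP hq) // rpredX // rpredN (dvr_mem dvrO).
pose z := 1 + p * r.
(* the equation of [r] multiplied by [(- p) ^+ k], with [- p * r = 1 - z] *)
have E : \sum_(i < k.+1) q`_i * (- p) ^+ (k - i) * (1 - z) ^+ i = 0.
  transitivity ((- p) ^+ k * q.[r]); last by rewrite (eqP rq) mulr0.
  rewrite horner_coef mulr_sumr /k prednK //; apply: eq_bigr => i _.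
  have ik : (i <= (size q).-1)%N by rewrite -ltnS prednK.
  rewrite (_ : 1 - z = - p * r) /z; last by ring.
  by rewrite exprMn -{2}(subnK ik) exprD; ring.
have [s sB Es] : exists2 s, s \in B &
    \sum_(i < k.+1) q`_i * (- p) ^+ (k - i) * (1 - z) ^+ i = 1 - p * t + z * s.
  have zB : z \in B by rewrite rpredD ?rpred1 // rpredM // OB // (dvr_mem dvrO).
  exists (\sum_(i < k.+1) q`_i * (- p) ^+ (k - i) * - \sum_(j < i) (1 - z) ^+ j).
    apply: rpred_sum => i _; rewrite rpredM ?rpredN ?rpred_sum //; last first.
      by move=> j _; rewrite rpredX // rpredB // rpred1.
    by rewrite rpredM ?rpredX ?rpredN ?OB ?(polyOverP hq) // (dvr_mem dvrO).
  have -> : 1 - p * t = \sum_(i < k.+1) q`_i * (- p) ^+ (k - i).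
    rewrite big_ord_recr /= subnn expr0 mulr1 -lead_coefE (monicP mq) addrC; congr (_ + _).
    rewrite /t mulr_sumr -sumrN; apply: eq_bigr => i _.
    have ik : (0 < k - i)%N by rewrite subn_gt0.
    by rewrite -{2}(prednK ik) exprS; ring.
  rewrite mulr_sumr -big_split /=; apply: eq_bigr => i _.
  rewrite -[in LHS](subrK 1 ((1 - z) ^+ i)) subrX1; ring.
have ut : ounit B (1 + p * - t) by apply/ounitB/(ounit_add1 dvrO); rewrite rpredN.
have Ez : z * - s = 1 + p * - t.
  by apply/eqP; rewrite -subr_eq0 mulrN [p * - t]mulrN -opprD oppr_eq0 addrC -Es E.
case/and3P: ut => t0 t1 t2.
have z0 : z != 0 by apply: contraNneq t0 => z0; rewrite -Ez z0 mul0r.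
rewrite -/z /ounit z0 rpredD ?rpred1 ?rpredM ?(OB (dvr_mem dvrO)) //=.
have -> : z^-1 = - s * (1 + p * - t)^-1.
  by rewrite -Ez invfM mulrCA mulfV ?mulr1 //; apply: contraNneq t0 => sz; rewrite -Ez sz mulr0.
by rewrite rpredM ?rpredN.
Qed.

Let bD : exists2 t, t \in B & b ^+ D = p * t.
Proof.
exists (- \sum_(i < D) h`_i / p * b ^+ i).
  rewrite rpredN rpred_sum // => i _; rewrite rpredM ?rpredX // OB //.
  by have := h_low (ltn_ord i); rewrite /ge_ord expr1.
have s0 : (0 < size h)%N by rewrite size_poly_gt0 monic_neq0.
move: rh; rewrite rootE horner_coef -(prednK s0) big_ord_recr /= -lead_coefE (monicP mh) mul1r.
rewrite addrC addr_eq0 => /eqP ->; rewrite mulrN mulr_sumr; congr (- _).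
by apply: eq_bigr => i _; rewrite mulrA mulrC [p * _]mulrC divfK // mulrC.
Qed.

(** [b ^+ D] is divisible by [p], so [e + b * r] divides [e ^+ D] plus a multiple of
[p]. *)
Let ounitB_addb e r : ounit O e -> r \in B -> ounit B (e + b * r).
Proof.
move=> ue rB; have [t tB Et] := bD.
have [s sB Es] : exists2 s, s \in B & e ^+ D - (- (b * r)) ^+ D = (e + b * r) * s.
  exists (\sum_(i < D) e ^+ (D.-1 - i) * (- (b * r)) ^+ i); last by rewrite subrXX opprK.
  case/and3P: ue => _ eO _.
  apply: rpred_sum => i _; apply: rpredM; apply: rpredX; first exact: OB.
  by rewrite rpredN rpredM.
have uD := ounitX D ue.
have [e0 e1 e2] := and3P uD.
have : ounit B (e ^+ D - (- (b * r)) ^+ D).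
  have -> : e ^+ D - (- (b * r)) ^+ D = e ^+ D * (1 + p * (- ((-1) ^+ D * t * r ^+ D / e ^+ D))).
    by rewrite [(- (b * r)) ^+ D]exprNn exprMn Et; field.
  apply: ounitM; first exact: ounitB.
  apply: ounitB_add1; rewrite rpredN; apply: rpredM; last exact: OB.
  by apply: rpredM; [apply: rpredM | ]; rewrite ?rpredX // rpredN rpred1.
rewrite Es => /and3P [n0 n1 n2].
have x0 : e + b * r != 0 by apply: contraNneq n0 => ->; rewrite mul0r.
have xB : e + b * r \in B by apply: rpredD; [apply: OB; case/and3P: ue | exact: rpredM].
rewrite /ounit x0 xB /=.
have -> : (e + b * r)^-1 = s * ((e + b * r) * s)^-1.
  rewrite invfM mulrCA mulfV ?mulr1 //; apply: contraNneq n0 => ->; by rewrite mulr0.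
by rewrite rpredM.
Qed.

Let bD_unit : ounit B (p / b ^+ D).
Proof.
have s0 : (0 < size h)%N by rewrite size_poly_gt0 monic_neq0.
have [q hq E] : exists2 q, q \in B & b ^+ D = - p * (h`_0 / p + b * q).
  exists (\sum_(i < D.-1) h`_i.+1 / p * b ^+ i).
    apply: rpred_sum => i _; rewrite rpredM ?rpredX // OB //.
    have iD : (i.+1 < D)%N by rewrite -ltn_predRL.
    by have := h_low iD; rewrite /ge_ord expr1.
  move: rh; rewrite rootE horner_coef -(prednK s0) big_ord_recr /= -lead_coefE (monicP mh) mul1r.
  rewrite addrC addr_eq0 => /eqP ->; rewrite mulNr; congr (- _); rewrite -/D.
  rewrite -(prednK D_gt0) big_ord_recl /= expr0 mulr1 mulrDr; congr (_ + _).
    by rewrite mulrC divfK.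
  rewrite !mulr_sumr; apply: eq_bigr => i _; rewrite /bump /= add1n exprS.
  by field.
have : ounit B (h`_0 / p + b * q).
  by apply: ounitB_addb => //; move: h_const; rewrite /has_ord expr1.
move=> u; have u0 : h`_0 / p + b * q != 0 by case/and3P: u.
have -> : p / b ^+ D = (- (h`_0 / p + b * q))^-1.
  rewrite E; move: (h`_0 / p + b * q) u0 => w w0; by field; rewrite ?oppr_eq0 ?w0 ?p0.
apply: ounitV; case/and3P: u => _ w1 w2.
by rewrite /ounit oppr_eq0 u0 invrN !rpredN w1.
Qed.

(** Adjoining a root of an Eisenstein polynomial gives a totally ramified
extension: the root is a uniformizer, and the old uniformizer is its [D]-th
power up to a unit. *)
Lemma eisenstein_dvr : dvr B b.
Proof.
have b0 : b != 0.
  apply/eqP => b0; move: bD_unit; rewrite b0 expr0n; case: D D_gt0 => // k _ /=.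
  by rewrite /ounit invr0 mulr0 eqxx.
have eb : exists2 e, e \in B & p = b * e.
  exists (b ^+ D.-1 * (p / b ^+ D)); first by rewrite rpredM ?rpredX //; case/and3P: bD_unit.
  by rewrite mulrA -exprS prednK // mulrC divfK ?expf_neq0.
apply: dvr_intro => //.
- apply/negP => bV.
  have u1 : ounit O 1 by apply: ounit1.
  have := @ounitB_addb 1 (- b^-1) u1; rewrite rpredN => /(_ bV).
  by rewrite mulrN mulfV // subrr /ounit eqxx.
- move=> _ /adjoinP [q hq ->].
  have [q' hq' ->] := polyOver_split hq; rewrite hornerD hornerMX hornerC.
  have qB : q'.[b] \in B by apply/adjoinP; exists q'.
  have q0O : q`_0 \in O by rewrite (polyOverP hq).
  have [q00|q00] := eqVneq q`_0 0.
    by right; exists q'.[b]; rewrite ?q00 ?addr0 // mulrC.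
  have [[|k] hk] := has_ord_exists dvrO q0O q00.
    by left; rewrite addrC mulrC; apply: ounitB_addb; rewrite // -(has_ord0 O p).
  right; case: eb => e eB Ep; exists (q'.[b] + e * (q`_0 / p)).
    rewrite rpredD // rpredM // OB //.
    by have := ge_ordW dvrO (ltn0Sn k) (has_ord_ge hk); rewrite /ge_ord expr1.
  by rewrite mulrDr mulrA -Ep [p * _]mulrC divfK // mulrC.
move=> x xB x0.
have [q [mq hq rq]] := adjoin_integral mh hO rh xB.
have [y yB /andP [xyO xy0]] := root_const hq (monic_neq0 mq) rq x0.
exists y.
  by move: yB; apply: adjoin_sub.
have [k hk] := has_ord_exists dvrO xyO xy0.
exists (D * k)%N.
have -> : x * y / b ^+ (D * k) = (x * y / p ^+ k) * (p / b ^+ D) ^+ k.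
  by rewrite exprM expr_div_n; field; rewrite !expf_neq0.
by apply: ounitM; [exact: ounitB | exact: ounitX].
Qed.

Lemma eisenstein_ord k x : has_ord O p k x -> has_ord B b (D * k) x.
Proof.
rewrite /has_ord => hk.
have -> : x / b ^+ (D * k) = (x / p ^+ k) * (p / b ^+ D) ^+ k.
  have b0 := dvr_neq0 eisenstein_dvr.
  by rewrite exprM expr_div_n; field; rewrite !expf_neq0.
by apply: ounitM; [exact: ounitB | exact: ounitX].
Qed.

Lemma eisenstein_ge_ord k x : ge_ord O p k x -> ge_ord B b (D * k) x.
Proof.
rewrite /ge_ord => hk.
have -> : x / b ^+ (D * k) = (x / p ^+ k) * (p / b ^+ D) ^+ k.
  have b0 := dvr_neq0 eisenstein_dvr.
  by rewrite exprM expr_div_n; field; rewrite !expf_neq0.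
by apply: rpredM; [exact: OB | apply: rpredX; case/and3P: bD_unit].
Qed.

(** If some coefficient were a unit, the first such term [q`_i * b ^+ i] would have
order exactly [i], while all the other terms have order greater than [i]. *)
Let free_step (q : {poly C}) : q \is a polyOver O -> (size q <= D)%N -> root q b ->
  forall i, ge_ord O p 1 q`_i.
Proof.
move=> hq sq rq; have dB := eisenstein_dvr.
elim/ltn_ind => i IH; apply/negPn/negP => hi.
have qi0 : q`_i != 0.
  by apply: contraNneq hi => ->; rewrite /ge_ord mul0r rpred0.
have iD : (i < D)%N.
  by rewrite (leq_trans _ sq) // ltnNge; apply: contra qi0 => hs; rewrite nth_default.
have u : has_ord O p 0 q`_i.
  have [[|k] hk] // := has_ord_exists dvrO (polyOverP hq i) qi0.
  by rewrite (ge_ordW dvrO (ltn0Sn k) (has_ord_ge hk)) in hi.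
have hX : has_ord B b i (q`_i * b ^+ i).
  rewrite -[i in has_ord _ _ i _]add0n; apply: has_ordM (has_ordX dB i) => //.
  by have := eisenstein_ord u; rewrite muln0.
have rest j : j != i -> ge_ord B b i.+1 (q`_j * b ^+ j).
  move=> ne; have [ji|ij] := ltnP j i.
    apply: (ge_ordW dB iD); rewrite -[D]addn0; apply: ge_ordM; last by rewrite ge_ord0 rpredX.
    by have := eisenstein_ge_ord (IH _ ji); rewrite muln1.
  have {}ij : (i < j)%N by rewrite ltn_neqAle eq_sym ne.
  apply: (ge_ordW dB ij); rewrite -[j in ge_ord _ _ j _]add0n; apply: ge_ordM (ge_ordX dB j).
  by rewrite ge_ord0 OB // (polyOverP hq).
move: rq; rewrite rootE (@horner_coef_wide _ D) //.
rewrite (bigD1 (Ordinal iD)) //= addr_eq0 => /eqP E.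
suff /(has_ord_le dB hX) : ge_ord B b i.+1 (q`_i * b ^+ i) by rewrite ltnn.
rewrite E ge_ordN.
elim/big_ind: _ => [|x y|j ne]; first by rewrite /ge_ord mul0r rpred0.
  exact: ge_ordD.
by apply: rest; apply: contra ne.
Qed.

Let free (q : {poly C}) : q \is a polyOver O -> (size q <= D)%N -> root q b -> q = 0.
Proof.
move=> hq sq rq; apply/eqP/negPn/negP => q0.
have lq0 : q`_(size q).-1 != 0 by rewrite -lead_coefE lead_coef_eq0.
have [k hk] := has_ord_exists dvrO (polyOverP hq (size q).-1) lq0.
clear lq0.
elim: k q hq sq rq q0 hk => [|k IH] q hq sq rq q0 hk.
  by have := has_ord_le dvrO hk (free_step hq sq rq _).
have hq1 : p^-1 *: q \is a polyOver O.
  apply/polyOverP => i; rewrite coefZ mulrC.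
  by have := free_step hq sq rq i; rewrite /ge_ord expr1.
have pV0 : p^-1 != 0 by rewrite invr_eq0.
apply: (IH (p^-1 *: q)) => //; rewrite ?size_scale //.
- by rewrite rootE hornerZ (eqP rq) mulr0.
- by rewrite scaler_eq0 negb_or pV0.
move: hk; rewrite coefZ /has_ord exprS invfM; congr (ounit _ _).
by rewrite mulrCA mulrA.
Qed.

(** The powers of the root below the degree are independent over the field of
fractions, because their multiples have pairwise distinct orders. *)
Lemma eisenstein_free (q : {poly C}) : (forall i, q`_i \in frac O p) ->
  (size q <= D)%N -> root q b -> q = 0.
Proof.
move=> hq sq rq.
have [k hk] : exists k, p ^+ k *: q \is a polyOver O.
  have [k hk] : exists k, forall i, (i < size q)%N -> q`_i * p ^+ k \in O.
    elim: (size q) => [|n [k hk]]; first by exists 0%N.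
    have /fracP [j hj] := hq n; exists (k + j)%N => i.
    rewrite ltnS leq_eqVlt => /orP [/eqP ->|/hk h'].
      by rewrite addnC exprD mulrA rpredM // rpredX // (dvr_mem dvrO).
    by rewrite exprD mulrA rpredM // rpredX // (dvr_mem dvrO).
  exists k; apply/polyOverP => i; rewrite coefZ mulrC.
  by have [/hk//|h'] := ltnP i (size q); rewrite nth_default // mul0r rpred0.
have pk0 : p ^+ k != 0 by rewrite expf_neq0.
have /eqP : p ^+ k *: q = 0.
  by apply: free; rewrite ?size_scale // rootE hornerZ (eqP rq) mulr0.
by rewrite scaler_eq0 (negPf pk0) => /eqP.
Qed.

End Eisenstein.

(** * Elements that are not d-th powers *)

(** The only orders below [d * E] that [y ^+ d - 1] can have are the multiples
of [d], [E] being the order of [1 - zeta] for a primitive [d]-th root of unity: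
either [y - 1] has order less than [E] and its [d]-th power dominates, or every
term of the binomial expansion has order at least [d * E]. *)
Lemma not_pow (C : fieldType) (B : subringClosed C) (b : C) d E l w y :
  dvr B b -> prime d -> has_ord B b (d.-1 * E) d%:R -> (l < d * E)%N -> ~~ (d %| l)%N ->
  has_ord B b l w -> y \in frac B b -> y ^+ d != 1 + w.
Proof.
move=> dB pd hd lE dl hw hy; apply/eqP => Ey.
have d1 := prime_gt1 pd; have d0 := prime_gt0 pd.
have wB : w \in B by apply: (ge_ord_mem dB (has_ord_ge hw)).
have yB : y \in B.
  apply: (@frac_integral _ B b dB B y ('X^d - (1 + w)%:P)) => //.
  - by rewrite monicXnsubC.
  - by rewrite rpredB ?polyOverXn // polyOverC rpredD // rpred1.
  - by rewrite rootE !hornerE Ey subrr.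
pose z := y - 1; have zB : z \in B by rewrite rpredB // rpred1.
have [s sB Es] := prime_exprD pd zB (rpred1 B).
have {Es} Ew : w = z ^+ d + d%:R * (z * s).
  move: Es; rewrite /z subrK Ey expr1n mulr1 [z ^+ d + 1]addrC -addrA => /addrI ->.
  by [].
have z0 : z != 0.
  by apply: contraNneq (has_ord_neq0 hw) => z0; rewrite Ew z0 mul0r mulr0 addr0 expr0n eqn0Ngt d0.
have [j hj] := has_ord_exists dB zB z0.
have hz := has_ordXn d hj.
have hzs : ge_ord B b (d.-1 * E + j) (d%:R * (z * s)).
  by rewrite -[j]addn0 ge_ordM ?(has_ord_ge hd) // ge_ordM ?ge_ord0 // (has_ord_ge hj).
have [Ej|jE] := leqP E j.
  suff /(has_ord_le dB hw) : ge_ord B b (d * E) w by rewrite leqNgt lE.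
  rewrite Ew ge_ordD //.
    by apply: (ge_ordW dB) (has_ord_ge hz); rewrite mulnC leq_mul2r Ej orbT.
  by apply: (ge_ordW dB) hzs; rewrite -{1}(prednK d0) mulSn addnC leq_add2l.
suff /(has_ord_inj dB hw) El : has_ord B b (j * d) w by rewrite El dvdn_mull in dl.
rewrite Ew; apply: has_ordD => //; apply: (ge_ordW dB) hzs.
rewrite -{1}(prednK d0) mulnS addnC -addSn leq_add2r.
rewrite mulnC (@leq_trans (d.-1 * j.+1)) ?leq_mul2l ?jE ?orbT //.
by rewrite mulnS -add1n leq_add2r ltn_predRL.
Qed.

(** * Reduction of integer polynomials modulo d *)
Definition zring (C : comNzRingType) : {pred C} :=
  [pred x | `[< exists z : int, x = z%:~R >]].
Lemma zring_subring (C : comNzRingType) : subring_closed (@zring C).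
Proof.
split; first by apply/asboolP; exists 1.
- by move=> _ _ /asboolP [x ->] /asboolP [y ->]; apply/asboolP; exists (x - y); rewrite rmorphB.
- by move=> _ _ /asboolP [x ->] /asboolP [y ->]; apply/asboolP; exists (x * y); rewrite rmorphM.
Qed.
HB.instance Definition _ (C : comNzRingType) := GRing.isSubringClosed.Build C (@zring C) (@zring_subring C).

Definition zeval (C : comNzRingType) (c : C) (q : {poly int}) : C := (map_poly intr q).[c].

Section Zeval.
Variables (C : comNzRingType) (c : C).
Lemma zevalD p q : zeval c (p + q) = zeval c p + zeval c q.
Proof. by rewrite /zeval rmorphD hornerD. Qed.
Lemma zevalB p q : zeval c (p - q) = zeval c p - zeval c q.
Proof. by rewrite /zeval rmorphB hornerD hornerN. Qed.
Lemma zevalM p q : zeval c (p * q) = zeval c p * zeval c q.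
Proof. by rewrite /zeval rmorphM hornerM. Qed.
Lemma zeval_int z : zeval c z%:P = z%:~R.
Proof. by rewrite /zeval map_polyC hornerC. Qed.
Lemma zeval_nat k : zeval c k%:R = k%:R.
Proof. by rewrite /zeval rmorph_nat -[in LHS]polyC_natr hornerC. Qed.
Lemma zeval_orb d j : zeval c (orb d 'X j) = orb d c j.
Proof.
rewrite /zeval (rmorph_orb (map_poly intr)) /= map_polyX.
by elim: j => [|j IH]; rewrite ?horner0 // !orbS hornerD horner_exp IH hornerX.
Qed.

Definition zadj : {pred C} := [pred x | `[< exists q, x = zeval c q >]].
Lemma zadjP x : reflect (exists q, x = zeval c q) (x \in zadj).
Proof. exact: asboolP. Qed.
Lemma zadj_subring : subring_closed zadj.
Proof.
split; first by apply/zadjP; exists 1%:P; rewrite zeval_int.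
- by move=> _ _ /zadjP [x ->] /zadjP [y ->]; apply/zadjP; exists (x - y); rewrite zevalB.
- by move=> _ _ /zadjP [x ->] /zadjP [y ->]; apply/zadjP; exists (x * y); rewrite zevalM.
Qed.
End Zeval.
HB.instance Definition _ (C : comNzRingType) c := GRing.isSubringClosed.Build C (@zadj C c) (@zadj_subring C c).

Lemma zadj_gen (C : comNzRingType) (c : C) : c \in zadj c.
Proof. by apply/zadjP; exists 'X; rewrite /zeval map_polyX hornerX. Qed.

Section ModPrime.
Variable d : nat.
Hypothesis d_prime : prime d.

Definition redp (q : {poly int}) : {poly 'F_d} := map_poly intr q.
Lemma redpD p q : redp (p + q) = redp p + redp q.
Proof. exact: rmorphD. Qed.
Lemma redpM p q : redp (p * q) = redp p * redp q.
Proof. exact: rmorphM. Qed.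
Lemma redp_lift (r : {poly 'F_d}) : exists q, redp q = r.
Proof.
exists (map_poly (fun x : 'F_d => (x : nat)%:Z) r).
rewrite /redp -map_poly_comp_id0 //; apply: map_poly_id => x _ /=.
exact: natr_Zp.
Qed.

Lemma redp_eq (p q : {poly int}) : redp p = redp q -> exists s, p = q + d%:R * s.
Proof.
move=> E0; have E : redp (p - q) = 0.
  by rewrite /redp rmorphB; apply/eqP; rewrite subr_eq0; apply/eqP.
exists (map_poly (fun z : int => (z %/ d)%Z) (p - q)).
suff <- : p - q = d%:R * map_poly (fun z : int => (z %/ d)%Z) (p - q) by rewrite addrC subrK.
apply/polyP => i; rewrite -polyC_natr coefCM coef_map_id0 ?div0z //.
have : (redp (p - q))`_i = 0 by rewrite E coef0.
rewrite coef_map /= => /eqP.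
set z := (p - q)`_i => hz.
have : (d %| z)%Z by rewrite (dvdz_pcharf (pchar_Fp d_prime)).
by move/divzK; rewrite mulrC natz => ->.
Qed.

(** In characteristic [d] a [d]-th power has derivative 0. *)
Lemma deriv_orb_redp j : (orb d ('X : {poly 'F_d}) j.+1)^`() = 1.
Proof.
rewrite orbS derivD derivX deriv_exp -mulr_natr -polyC_natr.
by rewrite (pcharf0 (pchar_Fp d_prime)) mulr0 add0r.
Qed.
End ModPrime.

(** * The local ring at a prime above d *)

Lemma prime_unity_prim (C : fieldType) d (z : C) :
  prime d -> z ^+ d = 1 -> z != 1 -> d.-primitive_root z.
Proof.
move=> pd zd z1; have [k hk kd] := prim_order_exists (prime_gt0 pd) zd.
case/primeP: pd => _ /(_ k kd) /orP [] /eqP E; last by rewrite -E.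
by move: (prim_expr_order hk); rewrite E expr1 => /eqP; rewrite (negPf z1).
Qed.

(** Evaluate [1 + X + ... + X^(d-1) = \prod_i (X - z^i)] at 1 and take the factor
[1 - z] out of each [1 - z^i]. *)
Lemma prime_prod_unity (C : fieldType) d (z : C) : prime d -> z ^+ d = 1 -> z != 1 ->
  d%:R = (1 - z) ^+ d.-1 * \prod_(1 <= i < d) \sum_(j < i) z ^+ j.
Proof.
move=> pd zd z1; have d0 := prime_gt0 pd.
have /factor_Xn_sub_1 E := prime_unity_prim pd zd z1.
have : \prod_(1 <= i < d) ('X - (z ^+ i)%:P) = \sum_(i < d) 'X^i :> {poly C}.
  apply: (@mulfI _ ('X - 1%:P)); first by rewrite polyXsubC_eq0.
  by move: E; rewrite big_ltn // expr0 => ->; rewrite -subrX1.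
move/(congr1 (fun p : {poly C} => p.[1])).
rewrite horner_prod horner_sum; under [X in _ = X]eq_bigr => i _ do rewrite hornerXn expr1n.
rewrite sumr_const card_ord => <-.
rewrite -subn1 -prodr_const_nat -big_split /=.
by apply: eq_bigr => i _; rewrite !hornerE -[RHS]opprK -mulNr opprB -subrX1 opprB.
Qed.

Section PrimeIdeal.
Variables (C : numFieldType) (A : subringClosed C) (P : C -> Prop).
Hypotheses (P0 : P 0) (P1 : ~ P 1).
Hypothesis PD : forall x y, P x -> P y -> P (x + y).
Hypothesis PM : forall x y, x \in A -> P y -> P (x * y).
Hypothesis Pprime : forall x y, x \in A -> y \in A -> P (x * y) -> P x \/ P y.

Lemma localization_exists : exists O : subringClosed C,
  forall x, (x \in O) <-> exists a s, [/\ a \in A, s \in A, ~ P s & x * s = a].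
Proof.
pose L : {pred C} := [pred x | `[< exists a s, [/\ a \in A, s \in A, ~ P s & x * s = a] >]].
have hL : subring_closed L.
  split.
  - by apply/asboolP; exists 1, 1; rewrite rpred1 mulr1.
  - move=> x y /asboolP [a [s [aA sA sP E]]] /asboolP [b [t [bA tA tP F]]].
    apply/asboolP; exists (a * t - b * s), (s * t); split.
    + by rewrite rpredB // rpredM.
    + by rewrite rpredM.
    + by case/(Pprime sA tA).
    + by rewrite -E -F; ring.
  - move=> x y /asboolP [a [s [aA sA sP E]]] /asboolP [b [t [bA tA tP F]]].
    apply/asboolP; exists (a * b), (s * t); split; rewrite ?rpredM //.
    + by case/(Pprime sA tA).
    + by rewrite -E -F; ring.
exists (HB.pack L (GRing.isSubringClosed.Build C L hL) : subringClosed C) => x.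
by split => [/asboolP//|h]; apply/asboolP.
Qed.

Variable O : subringClosed C.
Hypothesis locE : forall x, (x \in O) <-> exists a s, [/\ a \in A, s \in A, ~ P s & x * s = a].

(** The maximal ideal of the localization. *)
Definition loc_max x := exists a s, [/\ a \in A, P a, s \in A, ~ P s & x * s = a].

Let notP0 s : ~ P s -> s != 0.
Proof. by move=> h; apply: contra_notN h => /eqP ->. Qed.

Lemma mem_loc x : x \in A -> x \in O.
Proof. by move=> hx; apply/locE; exists x, 1; rewrite mulr1 rpred1. Qed.

Lemma loc_max_mem x : x \in A -> P x -> loc_max x.
Proof. by move=> hx Px; exists x, 1; rewrite mulr1 rpred1. Qed.

Lemma loc_maxD x y : loc_max x -> loc_max y -> loc_max (x + y).
Proof.
move=> [a [s [aA Pa sA sP E]]] [b [t [bA Pb tA tP F]]].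
exists (t * a + s * b), (s * t); split.
- by rewrite rpredD // rpredM.
- by apply: PD; apply: PM.
- by rewrite rpredM.
- by case/(Pprime sA tA).
- by rewrite -E -F; ring.
Qed.

Lemma loc_maxM x y : x \in O -> loc_max y -> loc_max (x * y).
Proof.
move=> /locE [a [s [aA sA sP E]]] [b [t [bA Pb tA tP F]]].
exists (a * b), (s * t); split; rewrite ?rpredM //; first exact: PM.
- by case/(Pprime sA tA).
- by rewrite -E -F; ring.
Qed.

Lemma loc_max1 : ~ loc_max 1.
Proof. by case=> [a [s [_ Pa _ Ps]]]; rewrite mul1r => E; apply: Ps; rewrite E. Qed.

Lemma loc_unit x : x \in A -> ~ P x -> ounit O x.
Proof.
move=> xA xP; rewrite /ounit notP0 // mem_loc //=; apply/locE.
by exists 1, x; rewrite rpred1 mulVf // notP0.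
Qed.

Lemma loc_unit_or_max x : x \in O -> ounit O x \/ loc_max x.
Proof.
case/locE => [a [s [aA sA sP E]]]; have [Pa|Pa] := EM (P a).
  by right; exists a, s.
left; rewrite (_ : x = a * s^-1); last by rewrite -E mulfK // notP0.
by rewrite ounitM ?ounitV ?loc_unit.
Qed.

Lemma ounit_not_max x : ounit O x -> ~ loc_max x.
Proof.
case/and3P => x0 _ xV hx; apply: loc_max1.
by rewrite -(mulVf x0); apply: loc_maxM.
Qed.

Lemma ounitD_max x y : ounit O x -> y \in O -> loc_max y -> ounit O (x + y).
Proof.
move=> ux yO hy; have xO : x \in O by case/and3P: ux.
have [//|h] := loc_unit_or_max (rpredD xO yO).
case: (ounit_not_max ux); rewrite -(addrK y x) -mulN1r; apply: loc_maxD => //.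
by apply: loc_maxM => //; rewrite rpredN rpred1.
Qed.

End PrimeIdeal.

Section BaseRing.
Variables (C : numFieldType) (d m n : nat) (c zeta : C) (P : C -> Prop).
Let A : subringClosed C := zadj c.
Let a := orb d c.
Hypotheses (d_prime : prime d) (m2 : (2 <= m)%N) (n1 : (1 <= n)%N).
Hypotheses (zeta_d : zeta ^+ d = 1) (zeta1 : zeta != 1).
Hypothesis c_int : exists2 q : {poly int}, q \is monic & root (map_poly intr q) c.
Hypotheses (P0 : P 0) (P1 : ~ P 1).
Hypothesis PD : forall x y, P x -> P y -> P (x + y).
Hypothesis PM : forall x y, x \in A -> P y -> P (x * y).
Hypothesis Pprime : forall x y, x \in A -> y \in A -> P (x * y) -> P x \/ P y.
Hypothesis Pd : P d%:R.
Hypothesis Pa : forall j, P (a j) <-> (n %| j)%N.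
Hypothesis am0 : a (m - 1) != 0.
Hypothesis rel : a (m + n - 1) = zeta * a (m - 1).

Lemma notP_int (z : int) : ~~ (d %| z)%Z -> ~ P z%:~R.
Proof.
move=> hz Pz; have : coprimez d z.
  by rewrite coprimezE prime_coprime //; move: hz; rewrite dvdzE.
case/coprimezP => -[u v] /= /(congr1 (fun t : int => t%:~R : C)).
rewrite rmorphD !rmorphM /= => E; apply: P1; rewrite -[1]/(1%:~R) -E.
by apply: PD; apply: PM => //; rewrite rpred_int.
Qed.

Let cA : c \in A. Proof. exact: zadj_gen. Qed.
Let aA j : a j \in A. Proof. exact: orb_closed. Qed.

Section Local.
Variable O : subringClosed C.
Hypothesis locE : forall x, (x \in O) <-> exists a s, [/\ a \in A, s \in A, ~ P s & x * s = a].
Let M := loc_max A P.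
Let AO x : x \in A -> x \in O. Proof. exact: (mem_loc P1 locE). Qed.
Let pi := a n.
Let piA : pi \in A. Proof. exact: aA. Qed.
Let Ppi : P pi. Proof. by apply/Pa. Qed.
Let Mpi : M pi. Proof. exact: loc_max_mem. Qed.
Let uadd x y : ounit O x -> y \in O -> M y -> ounit O (x + y).
Proof. exact: (ounitD_max P0 P1 PD PM Pprime locE). Qed.
Let Mmul x y : x \in O -> M y -> M (x * y).
Proof. exact: (loc_maxM PM Pprime locE). Qed.

(** The maximal ideal is generated by [d] and [pi]: modulo [d] the orbit
polynomial [a_n] has derivative 1, so the minimal polynomial of [c] divides it
exactly once and can be recovered from it up to a unit. *)
Lemma max_gen x : M x -> exists y1 y2, [/\ y1 \in O, y2 \in O & x = pi * y1 + d%:R * y2].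
Proof.
case=> [x' [s [/zadjP [q ->] Pq sA sP E]]].
suff [y1 [y2 [h1 h2 E2]]] : exists y1 y2,
    [/\ y1 \in O, y2 \in O & zeval c q = pi * y1 + d%:R * y2].
  case/and3P: (loc_unit P0 P1 locE sA sP) => s0 _ sV.
  exists (y1 / s), (y2 / s); split; rewrite ?rpredM //.
  by apply: (mulIf s0); rewrite E E2; field.
pose an : {poly int} := orb d 'X n.
have Pe (p : {poly int}) : zeval c p \in A by apply/zadjP; exists p.
have Pdm p : P (d%:R * zeval c p) by rewrite mulrC; apply: PM.
have [[u v] Eg] := Bezoutp (redp d q) (redp d an).
pose g := u * redp d q + v * redp d an.
have gq : g %| redp d q by rewrite (eqp_dvdl _ Eg) dvdp_gcdl.
have ga : g %| redp d an by rewrite (eqp_dvdl _ Eg) dvdp_gcdr.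
have [u' Eu] := redp_lift u; have [v' Ev] := redp_lift v.
have [w Ew] := redp_lift (redp d q %/ g); have [h Eh] := redp_lift (redp d an %/ g).
pose g' := u' * q + v' * an.
have Eg' : redp d g' = g by rewrite redpD !redpM Eu Ev.
have [s1 E1] : exists s, q = w * g' + d%:R * s.
  apply: redp_eq => //; rewrite redpM Ew Eg'.
  by rewrite divpK.
have [s2 E2] : exists s, an = h * g' + d%:R * s.
  apply: redp_eq => //; rewrite redpM Eh Eg'.
  by rewrite divpK.
have Ean : zeval c an = pi by rewrite zeval_orb.
have Pg : P (zeval c g').
  by rewrite zevalD !zevalM Ean; apply: PD; apply: PM.
have hP : ~ P (zeval c h).
  move=> Ph.
  have [t Et] : exists s, 1 = (h^`() * g' + h * g'^`()) + d%:R * s.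
    apply: redp_eq => //; rewrite -derivM.
    have -> : redp d (h * g')^`() = (redp d an)^`().
      by rewrite {1}/redp -deriv_map -/(redp d (h * g')) redpM Eh Eg' divpK.
    rewrite /redp rmorph1 /an (rmorph_orb (map_poly intr)) /= map_polyX.
    by case: (n) n1 => // k _; rewrite deriv_orb_redp.
  apply: P1; have -> : (1 : C) = zeval c 1%:P by rewrite zeval_int.
  rewrite -[1%:P]/(1 : {poly int}) Et !zevalD !zevalM zeval_nat; apply: PD => //; apply: PD; first exact: PM.
  by rewrite mulrC; apply: PM.
case/and3P: (loc_unit P0 P1 locE (Pe h) hP) => h0 _ hV.
exists (zeval c w / zeval c h), (zeval c s1 - zeval c s2 * zeval c w / zeval c h); split.
- by rewrite rpredM // AO.
- by rewrite rpredB ?rpredM // AO.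
have -> : pi = zeval c h * zeval c g' + d%:R * zeval c s2.
  by rewrite -Ean {1}E2 zevalD !zevalM zeval_nat.
by rewrite {1}E1 zevalD !zevalM zeval_nat; field.
Qed.

Let e : nat := (n %| m - 1)%N.

(** The point [a_(n j)] is near 0 and 0 is critical, so applying the [n]-th iterate
to it gives [a_n] up to an error of higher order. *)
Let orb_mult j : exists2 y, y \in A & a (n * j.+1) = pi * (1 + pi * y).
Proof.
have d2 := prime_gt1 d_prime.
elim: j => [|j [y yA IH]]; first by exists 0; rewrite ?rpred0 // muln1 mulr0 addr0 mulr1.
rewrite mulnS /a orbD -/a.
have [z zA ->] := iter_unic0 d_prime n1 cA (aA (n * j.+1)).
set x := a _ in IH *; rewrite -/(a n) -/pi.
have dn : (2 <= d ^ n)%N by rewrite (leq_trans d2) // -{1}(expn1 d) leq_exp2l.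
exists ((1 + pi * y) ^+ 2 * (x ^+ (d ^ n - 2) + d%:R * (x ^+ (d - 2) * z))).
  by rewrite !(rpredD, rpredM, rpredX) ?rpred1 ?rpred_nat ?aA.
have xE k : (2 <= k)%N -> x ^+ k = x ^+ 2 * x ^+ (k - 2) by move=> k2; rewrite -exprD subnKC.
rewrite (xE _ dn) (xE _ d2); move: (x ^+ (_ - 2)) (x ^+ (_ - 2)) => x1 x2.
by rewrite IH; ring.
Qed.

(** Both sides of [rel] have the same order, which makes [zeta] an element of [O]. *)
Let orb_ord : exists v v', [/\ ounit O v, ounit O v', a (m - 1) = pi ^+ e * v &
  a (m + n - 1) = pi ^+ e * v'].
Proof.
rewrite /e; case: (boolP (n %| m - 1)%N) => hn.
  have [j Ej] := dvdnP hn.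
  have j0 : (0 < j)%N by case: j Ej => // E; move: m2; rewrite -subn_gt0 -(subnKC m2); lia.
  have u y : y \in A -> ounit O (1 + pi * y).
    move=> yA; apply: uadd; first exact: ounit1.
      by rewrite AO // rpredM.
    by rewrite mulrC; apply: Mmul => //; apply: AO.
  have [y yA Ey] := orb_mult j.-1; have [y' yA' Ey'] := orb_mult j.
  exists (1 + pi * y), (1 + pi * y'); split; rewrite ?u //= expr1.
    by rewrite -Ey prednK // Ej mulnC.
  by rewrite -Ey' mulnS mulnC -Ej; congr (a _); lia.
have u k : ~~ (n %| k)%N -> ounit O (a k).
  by move=> hk; apply: (loc_unit P0 P1 locE) => //; move/Pa; rewrite (negPf hk).
exists (a (m - 1)), (a (m + n - 1)); rewrite !expr0 !mul1r; split => //; apply: u => //.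
by rewrite -addnBAC 1?ltnW // dvdn_addl.
Qed.

Let zetaO : zeta \in O.
Proof.
have [v [v' [uv uv' E E']]] := orb_ord.
have p0 : pi ^+ e != 0 by apply: contraNneq am0 => p0; rewrite E p0 mul0r.
have -> : zeta = v' / v; last by rewrite rpredM //; [case/and3P: uv'|case/and3P: uv].
case/and3P: uv => v0 _ _; apply: (mulIf v0); rewrite divfK //.
by apply: (mulfI p0); rewrite mulrCA -E -rel E'.
Qed.

Let Q := (d ^ (m - 1))%N.
Let eQ : (e < Q)%N.
Proof.
have d2 := prime_gt1 d_prime.
have h : (2 <= Q)%N.
  by rewrite (leq_trans d2) // -{1}(expn1 d) leq_exp2l // subn_gt0.
by apply: leq_trans h; rewrite /e; case: (n %| m - 1)%N.
Qed.

(** The relation [a_(m+n-1) = zeta * a_(m-1)], expanded at [pi], determines the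
order of [1 - zeta] exactly: [d] is a multiple of [1 - zeta], so the error term
of [iter_unic0] is absorbed on the left hand side. *)
Let ord_zeta : exists2 v, ounit O v & (1 - zeta) * v = - pi ^+ (Q - e).
Proof.
have d2 := prime_gt1 d_prime; have d0 := prime_gt0 d_prime.
have [v [v' [uv uv' E E']]] := orb_ord.
have p0 : pi ^+ e != 0 by apply: contraNneq am0 => p0; rewrite E p0 mul0r.
have m1 : (0 < m - 1)%N by rewrite subn_gt0.
have [z zA Ez] := iter_unic0 d_prime m1 cA piA.
have {}Ez : a (m + n - 1) = pi ^+ Q + a (m - 1) + d%:R * (pi ^+ d * z).
  by rewrite -Ez -addnBAC 1?ltnW // /a orbD.
pose k := (1 - zeta) ^+ d.-2 * \prod_(1 <= i < d) \sum_(j < i) zeta ^+ j.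
have kO : k \in O.
  rewrite rpredM ?rpredX ?rpredB ?rpred1 //; apply: rpred_prod => i _.
  by apply: rpred_sum => j _; rewrite rpredX.
have Ed : d%:R = (1 - zeta) * k.
  rewrite (prime_prod_unity d_prime zeta_d zeta1) /k mulrA -exprS.
  by congr (_ ^+ _ * _); rewrite prednK // ltn_predRL.
have ed : (e < d)%N by apply: leq_trans d2; rewrite /e; case: (n %| m - 1)%N.
pose x := k * pi ^+ (d - e).-1 * z.
have piO := AO piA.
have xO : x \in O by rewrite rpredM ?(AO zA) // rpredM // rpredX.
exists (v + x * pi).
  apply: uadd => //; last exact: Mmul.
  by rewrite rpredM.
apply: (mulfI p0).
have pd : pi ^+ d = pi ^+ e * (pi ^+ (d - e).-1 * pi).
  by rewrite -exprSr prednK ?subn_gt0 // -exprD subnKC // ltnW.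
have pQ : pi ^+ Q = pi ^+ e * pi ^+ (Q - e) by rewrite -exprD subnKC // ltnW.
move: Ez; rewrite rel E Ed pd pQ /x => /eqP; rewrite -subr_eq0 => /eqP h.
apply/eqP; rewrite -subr_eq0 -oppr_eq0 -h; apply/eqP; ring.
Qed.

Let pi0 : pi != 0.
Proof.
have [v uv E] := ord_zeta; apply: contraNneq zeta1 => p0.
move: E; rewrite p0 expr0n subn_eq0 leqNgt eQ oppr0 => /eqP.
by rewrite mulf_eq0 subr_eq0 eq_sym; case/and3P: uv => /negPf -> _ _; rewrite orbF.
Qed.

Let ord_zeta' : has_ord O pi (Q - e) (1 - zeta).
Proof.
have [v uv E] := ord_zeta; rewrite /has_ord.
case/and3P: (uv) => v0 _ _.
have -> : (1 - zeta) / pi ^+ (Q - e) = - v^-1.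
  by apply: (mulIf v0); rewrite mulrAC E mulNr divff ?expf_neq0 // mulNr mulVf.
by case/and3P: uv => _ vO vV; rewrite /ounit oppr_eq0 invr_eq0 v0 invrN invrK !rpredN vO vV.
Qed.

Let Mz : M (1 - zeta).
Proof.
have -> : 1 - zeta = (1 - zeta) / pi ^+ (Q - e) * pi ^+ (Q - e).-1 * pi.
  by rewrite -mulrA -exprSr prednK ?subn_gt0 // divfK ?expf_neq0.
have piO := AO piA; apply: Mmul => //; rewrite rpredM ?rpredX //.
by case/and3P: ord_zeta'.
Qed.

Let ord_d : has_ord O pi (d.-1 * (Q - e)) d%:R.
Proof.
rewrite (prime_prod_unity d_prime zeta_d zeta1) /has_ord mulnC exprM mulrAC -expr_div_n.
apply: ounitM; first exact: ounitX ord_zeta'.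
rewrite big_seq_cond; elim/big_ind: _ => [|x y|i]; [exact: ounit1|exact: ounitM|].
rewrite andbT mem_index_iota => /andP [i1 id].
have -> : \sum_(j < i) zeta ^+ j = i%:R + \sum_(j < i) - (\sum_(l < j) zeta ^+ l) * (1 - zeta).
  rewrite -[i in i%:R]card_ord -sumr_const -big_split; apply: eq_bigr => j _ /=.
  have := subrX1 zeta j; move: (\sum_(l < j) _) (zeta ^+ j) => S w Ew.
  have -> : w = (zeta - 1) * S + 1 by rewrite -Ew subrK.
  by ring.
have xO j : - (\sum_(l < j) zeta ^+ l) \in O by rewrite rpredN rpred_sum // => l _; rewrite rpredX.
apply: uadd.
- apply: (loc_unit P0 P1 locE); rewrite ?rpred_nat // -[i%:R]/((Posz i)%:~R).
  by apply: notP_int; rewrite dvdzE /= gtnNdvd.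
- by apply: rpred_sum => j _; rewrite rpredM // rpredB ?rpred1.
elim/big_ind: _ => [|x y|j _]; last exact: Mmul.
- by apply: loc_max_mem; rewrite ?rpred0.
- exact: (loc_maxD PD PM Pprime).
Qed.

Lemma localization_orb_ord : dvr O pi -> forall j, has_ord O pi 1 (a (n * j.+1)).
Proof.
move=> dO j; have [y yA ->] := orb_mult j.
by rewrite -[1%N]addn0 -{2}[pi]expr1; apply: has_ordM (has_ordX dO 1) _; rewrite has_ord0 (ounit_add1 dO) ?AO.
Qed.

(** The maximal ideal is generated by [pi], because [d] is a unit times a power of
[1 - zeta], hence of [pi]. Every nonzero element divides a nonzero integer, and
integers are a power of [d] times a unit, so [dvr_intro] applies. *)
Lemma localization_dvr : [/\ dvr O pi, zeta \in O, (0 < Q - e)%N,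
  has_ord O pi (Q - e) (1 - zeta) & has_ord O pi (d.-1 * (Q - e)) d%:R].
Proof.
split => //; last by rewrite subn_gt0.
apply: dvr_intro; first exact: AO.
- apply/negP => pV; apply: (loc_max1 (A := A) (P := P)); rewrite -(mulVf pi0).
  exact: Mmul.
- move=> x /(loc_unit_or_max P0 P1 locE) [|/max_gen [y1 [y2 [h1 h2 ->]]]]; first by left.
  right; exists (y1 + d%:R / pi * y2); last by rewrite mulrDr mulrA [pi * (_ / _)]mulrC divfK.
  rewrite rpredD // rpredM //.
  have dQ : (0 < d.-1 * (Q - e))%N.
    by rewrite muln_gt0 subn_gt0 eQ -ltnS prednK ?prime_gt1 ?prime_gt0.
  rewrite (_ : d%:R / pi = d%:R / pi ^+ (d.-1 * (Q - e)) * pi ^+ (d.-1 * (Q - e)).-1).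
    by rewrite rpredM ?rpredX ?(AO piA) //; case/and3P: ord_d.
  by rewrite -{1}(prednK dQ) exprSr; field; rewrite pi0 expf_neq0.
move=> x /locE [a' [s [/zadjP [q Ea'] sA sP E]]] x0.
have s0 : s != 0 by apply: contra_notN sP => /eqP ->.
have aA' : a' \in A by apply/zadjP; exists q.
have a0 : a' != 0 by rewrite -E mulf_neq0.
have [g mg rg] := c_int.
have zpoly (r : {poly int}) : map_poly intr r \is a polyOver (@zring C).
  by apply/polyOverP => i; rewrite coef_map; apply/asboolP; exists r`_i.
have a'Z : a' \in adjoin (@zring C) c by apply/adjoinP; exists (map_poly intr q).
have [r [mr hr rr]] := adjoin_integral (monic_map _ mg) (zpoly g) rg a'Z.
have [y yZ /andP [/asboolP [z Ez] z0]] := root_const hr (monic_neq0 mr) rr a0.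
have yA : y \in A.
  apply: adjoin_sub yZ => // _ /asboolP [t ->]; exact: rpred_int.
exists (s * y); first by rewrite rpredM // AO.
rewrite mulrA E Ez; rewrite Ez in z0.
have z0'' : z != 0 by apply: contraNneq z0 => ->.
have z0' : (0 < `|z|)%N by rewrite absz_gt0.
have [k kd Ek] := pfactor_coprime d_prime z0'.
set l := logn d _ in Ek.
have zE : z = sgz z * k%:Z * d%:Z ^+ l.
  have pX j : (d ^ j)%:Z = d%:Z ^+ j by elim: j => // j IH; rewrite expnS PoszM IH exprS.
  by rewrite {1}[z]intEsg Ek PoszM mulrA pX.
exists (d.-1 * (Q - e) * l)%N.
have -> : z%:~R = d%:R ^+ l * (sgz z * k)%:~R :> C.
  by rewrite {1}zE rmorphM rmorphXn /= mulrC.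
rewrite -[X in pi ^+ X]addn0 -/(has_ord O pi _ _); apply: has_ordM; first exact: has_ordXn.
rewrite has_ord0; apply: (loc_unit P0 P1 locE); first exact: rpred_int.
apply: notP_int; rewrite dvdzE abszM absz_sg z0'' mul1n.
by rewrite -prime_coprime.
Qed.

End Local.
End BaseRing.

(** * The period of the critical orbit modulo a prime *)

Section PeriodModPrime.
Variables (C : numFieldType) (d m n : nat) (c : C) (P : C -> Prop).
Let A : subringClosed C := zadj c.
Let a := orb d c.
Hypotheses (d_prime : prime d) (n1 : (1 <= n)%N).
Hypotheses (P0 : P 0) (P1 : ~ P 1).
Hypothesis PD : forall x y, P x -> P y -> P (x + y).
Hypothesis PM : forall x y, x \in A -> P y -> P (x * y).
Hypothesis Pprime : forall x y, x \in A -> y \in A -> P (x * y) -> P x \/ P y.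
Hypothesis Pd : P d%:R.
Hypothesis per : a (m + n) = a m.
Hypothesis exact_per : forall k, (0 < k < n)%N -> a (m + k) <> a m.

Let cA : c \in A. Proof. exact: zadj_gen. Qed.
Let aA j : a j \in A. Proof. exact: orb_closed. Qed.

Let PX x k : x \in A -> P (x ^+ k) -> P x.
Proof.
move=> xA; elim: k => [|k IH]; first by rewrite expr0.
by rewrite exprS => /Pprime [] //; rewrite rpredX.
Qed.

Let PN x : P x -> P (- x).
Proof. by move=> Px; rewrite -mulN1r; apply: PM; rewrite ?rpredN ?rpred1. Qed.

(** Modulo [d] the map is Frobenius followed by a translation, hence injective. *)
Let unic_inj x y : x \in A -> y \in A -> P (unic d c x - unic d c y) -> P (x - y).
Proof.
move=> xA yA; rewrite /unic opprD addrACA subrr addr0 => h.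
have xyA : x - y \in A by rewrite rpredB.
have [w wA] := prime_exprD d_prime xyA yA; rewrite subrK => E.
apply: (PX (k := d)) => //.
have -> : (x - y) ^+ d = (x ^+ d - y ^+ d) + - ((x - y) * y * w) * d%:R by rewrite E; ring.
by apply: PD => //; apply: PM => //; rewrite rpredN !rpredM.
Qed.

Let orb_cancel i j : P (a (i + j) - a i) -> P (a j).
Proof.
elim: i => [|i IH]; first by rewrite /a /orb /= subr0.
by rewrite addSn => h; apply/IH/unic_inj.
Qed.

Let Pn : P (a n).
Proof. by apply: (@orb_cancel m); rewrite per subrr. Qed.

Let orb_shift k j : P (a k) -> P (a (j + k)) <-> P (a j).
Proof.
move=> Pk; have : P (a (j + k) - a j).
  rewrite /a orbD -/a {2}/a /orb.
  have [L LA ->] := iter_unic_sub d j cA (aA k) (rpred0 A).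
  by rewrite subr0 mulrC; apply: PM.
move=> h; split => h'.
  by rewrite -(subKr (a (j + k)) (a j)); apply: PD => //; apply: PN.
by rewrite -(subrK (a j) (a (j + k))); apply: PD.
Qed.

(** Both [x] and [y] are fixed by the [n]-th iterate, which contracts the ideal
[P] because the derivative of [y ^+ d + c] vanishes at 0 modulo [P]. *)
Let contraction x y : x \in A -> y \in A -> P x -> P y ->
  iter n (unic d c) x = x -> iter n (unic d c) y = y -> x = y.
Proof.
move=> xA yA Px Py Ex Ey; have d2 := prime_gt1 d_prime.
have [z [zA Pz E]] : exists z, [/\ z \in A, P z & x - y = (x - y) * z].
  rewrite -{1}Ex -{1}Ey -(prednK n1) !iterSr.
  have uA t : t \in A -> unic d c t \in A by move=> tA; rewrite rpredD ?rpredX.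
  have [L LA ->] := iter_unic_sub d n.-1 cA (uA x xA) (uA y yA).
  pose S := \sum_(i < d) x ^+ (d.-1 - i) * y ^+ i.
  have SA : S \in A by apply: rpred_sum => i _; rewrite rpredM ?rpredX.
  exists (S * L); split; first exact: rpredM.
    rewrite mulrC; apply: PM => //.
    rewrite /S; elim/big_ind: _ => // i _; case: (posnP i) => [->|i0].
      rewrite subn0 mulrC -(ltn_predK (_ : 0 < d.-1)%N) ?exprSr ?mulrA.
        by apply: PM => //; rewrite rpredM ?rpredX.
      by rewrite ltn_predRL.
    by rewrite -(prednK i0) exprSr mulrA; apply: PM => //; rewrite rpredM ?rpredX.
  by rewrite mulrA -subrXX /unic opprD addrACA subrr addr0.
have : (x - y) * (1 - z) = 0 by rewrite mulrBr mulr1 -E subrr.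
move/eqP; rewrite mulf_eq0 !subr_eq0 => /orP [/eqP //|/eqP z1].
by case: P1; rewrite z1.
Qed.

(** The period [k] modulo [P] divides [n] by injectivity. Conversely [a_(mn)] and
[a_(mn+k)] are periodic points in [P], which coincide by contraction, so the
tail of the orbit already has period [k] before reduction. *)
Lemma orb_mod_prime j : P (a j) <-> (n %| j)%N.
Proof.
have ex : exists k, (0 < k)%N && `[< P (a k) >] by exists n; rewrite n1; apply/asboolP.
have [k /andP [k0 /asboolP Pk] kmin] := ex_minnP ex.
have Pq q r : P (a (r + q * k)) <-> P (a r).
  elim: q => [|q IH]; first by rewrite mul0n addn0.
  by rewrite mulSnr addnA; split => [/(orb_shift _ Pk)/IH//|/IH h]; apply/orb_shift.
have Pdiv i : P (a i) <-> (k %| i)%N.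
  split=> [h|/dvdnP [q ->]]; last by rewrite -[(q * k)%N]add0n; apply/Pq.
  rewrite /dvdn; have h' : P (a (i %% k)) by apply/(Pq (i %/ k)%N (i %% k)%N); rewrite addnC -divn_eq.
  rewrite -leqn0 leqNgt; apply/negP => r0.
  have : (k <= i %% k)%N by apply: kmin; rewrite r0; apply/asboolP.
  by rewrite leqNgt ltn_mod k0.
have tail i : (m <= i)%N -> a (n + i) = a i.
  by move=> mi; rewrite -(subnK mi) addnA [(n + _)%N]addnC -addnA [(n + m)%N]addnC /a !(orbD _ _ (i - m)) -/a per.
have tail' q i : (m <= i)%N -> a (q * n + i) = a i.
  move=> mi; elim: q => [|q IH]; first by rewrite mul0n.
  by rewrite mulSn -addnA tail // (leq_trans mi) ?leq_addl.
suff -> : n = k by [].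
have kn : (k %| n)%N by apply/Pdiv.
have kn' : (k <= n)%N by apply: dvdn_leq.
apply/eqP; rewrite eqn_leq kn' andbT leqNgt; apply/negP => lt_kn.
have mn : (m <= m * n)%N by rewrite leq_pmulr.
have Pmn : P (a (m * n)) by apply/Pdiv; rewrite dvdn_mull.
have Pmnk : P (a (m * n + k)) by apply/Pdiv; rewrite dvdn_addr // dvdn_mull.
have E : a (m * n + k) = a (m * n).
  apply: contraction => //; rewrite -orbD -/a tail //.
  by rewrite (leq_trans mn) ?leq_addr.
case: (@exact_per k); first by rewrite k0.
rewrite -(tail' m m) // -(tail' m (m + k)%N) ?leq_addr //.
have -> : (m * n + (m + k) = m + (m * n + k))%N by rewrite addnCA addnA.
by rewrite [(m * n + m)%N]addnC /a !(orbD _ _ m) -/a E.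
Qed.

End PeriodModPrime.

(** * Sums of the Moebius function *)

Lemma mobius_sq p n : prime p -> (0 < n)%N -> (p ^ 2 %| n)%N -> mobius n = 0.
Proof.
move=> pp n0 hn; rewrite /mobius; case: allP => // /(_ p).
rewrite mem_primes pp n0 (dvdn_trans _ hn) ?dvdn_exp // => /(_ isT) /eqP h.
by move: hn; rewrite pfactor_dvdn // h.
Qed.

Lemma mobius_prime_mul p n : prime p -> (0 < n)%N -> ~~ (p %| n)%N ->
  mobius (p * n) = - mobius n.
Proof.
move=> pp n0 hn; have p0 := prime_gt0 pp.
have pn : perm_eq (primes (p * n)) (p :: primes n).
  apply: uniq_perm; rewrite /= ?primes_uniq ?andbT // ?mem_primes ?(negPf hn) ?andbF //.
  by move=> q; rewrite primesM // inE (primes_prime pp) inE.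
rewrite /mobius (perm_all _ pn) (perm_size pn) /= exprS mulN1r.
have -> : logn p (p * n) == 1%N.
  by rewrite lognM // lognE pp p0 dvdnn divnn p0 logn1 (_ : logn p n = 0%N) //; apply/eqP; rewrite -leqn0 leqNgt logn_gt0 mem_primes pp n0.
rewrite /=; have -> : all (fun q => logn q (p * n) == 1%N) (primes n) =
    all (fun q => logn q n == 1%N) (primes n).
  apply: eq_in_all => q; rewrite mem_primes => /and3P [pq _ qn].
  by rewrite lognM // (logn_prime _ pp) // (_ : q == p = false) //; apply: contraNF hn => /eqP <-.
by case: ifP; rewrite ?oppr0.
Qed.

(** For a prime divisor [p] of [n], the divisors [k] prime to [p] and their multiples
[p * k] cancel in pairs; the remaining divisors are divisible by [p ^ 2]. *)
Lemma sum_mobius n : (0 < n)%N -> \sum_(k <- divisors n) mobius k = (n == 1%N)%:Z.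
Proof.
move=> n0; have [->|n1] := eqVneq n 1%N; first by rewrite (_ : divisors 1 = [:: 1%N]) ?big_seq1.
have {}n1 : (1 < n)%N by rewrite ltn_neqAle eq_sym n1.
pose p := pdiv n; have pp : prime p by apply: pdiv_prime.
have p0 := prime_gt0 pp.
have [N pN En] := pfactor_coprime pp n0.
have N0 : (0 < N)%N by move: n0; rewrite En muln_gt0 => /andP [].
have l0 : (0 < logn p n)%N by rewrite logn_gt0 mem_primes pp n0 pdiv_dvd.
have hN k : (k %| N)%N -> ~~ (p %| k)%N.
  by move=> kN; rewrite -prime_coprime //; apply: coprime_dvdr pN.
have kn k : (k \in divisors n) && ~~ (p %| k)%N = (k \in divisors N).
  rewrite -!dvdn_divisors //; apply/andP/idP => [[kn pk]|kN].
    by move: kn; rewrite En Gauss_dvdl // coprime_sym coprimeXl // prime_coprime.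
  by rewrite hN // En dvdn_mulr.
rewrite (bigID (fun k => p %| k)%N) /= [X in _ + X = _](_ : _ = \sum_(k <- divisors N) mobius k); last first.
  rewrite -big_filter; apply: perm_big; apply: uniq_perm; rewrite ?filter_uniq ?divisors_uniq //.
  by move=> k; rewrite mem_filter andbC kn.
rewrite (bigID (fun k => p ^ 2 %| k)%N) /= [X in X + _ + _]big_seq_cond big1 ?add0r; last first.
  move=> k /and3P [kn' h1 h2]; apply: (mobius_sq pp) => //; by apply: (dvdn_gt0 n0); rewrite dvdn_divisors.
rewrite -big_filter (perm_big (map (muln p) (divisors N))) /=; last first.
  apply: uniq_perm; rewrite ?filter_uniq ?divisors_uniq //.
    by rewrite map_inj_uniq ?divisors_uniq // => x y /eqP; rewrite eqn_pmul2l // => /eqP.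
  move=> k; rewrite mem_filter; apply/idP/mapP => [/andP [/andP [pk ppk]]|[j jN ->]].
    rewrite -dvdn_divisors // => kn'; have [j Ej] := dvdnP pk; exists j; last by rewrite mulnC.
    rewrite -kn -dvdn_divisors // (dvdn_trans _ kn') ?Ej ?dvdn_mulr //=.
    by move: ppk; rewrite Ej mulnC expnS expn1 dvdn_pmul2l.
  move: jN; rewrite -dvdn_divisors // => jN.
  rewrite dvdn_mulr //= expnS expn1 dvdn_pmul2l // hN //= -dvdn_divisors //.
  by rewrite En mulnC dvdn_mul // -{1}(expn1 p) dvdn_exp2l.
rewrite big_map big_seq [X in _ + X]big_seq -big_split big1 //= => j.
rewrite -dvdn_divisors // => jN; rewrite mobius_prime_mul ?addNr // ?hN //.
exact: dvdn_gt0 N0 jN.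
Qed.

(** Replacing [j] by [n / j] turns this into the sum over the divisors of [n / k]. *)
Lemma sum_mobius_mult n k : (0 < n)%N -> (0 < k)%N ->
  \sum_(j <- divisors n) mobius (n %/ j) * (k %| j)%N%:Z = (k == n)%:Z.
Proof.
move=> n0 k0.
have pe : perm_eq (divisors n) (map (fun j => n %/ j)%N (divisors n)).
  have inv j : (j %| n)%N -> (n %/ (n %/ j) = j)%N.
    by move=> jn; rewrite -{1}(divnK jn) mulKn // divn_gt0 ?(dvdn_gt0 n0) // dvdn_leq.
  apply: uniq_perm; rewrite ?divisors_uniq //.
    rewrite map_inj_in_uniq ?divisors_uniq // => x y; rewrite -!dvdn_divisors // => xn yn E.
    by rewrite -(inv _ xn) E inv.
  move=> j; apply/idP/mapP => [|[t + ->]]; rewrite -!dvdn_divisors //.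
    move=> jn; exists (n %/ j)%N; rewrite ?inv // -dvdn_divisors //.
    by rewrite -{2}(divnK jn) dvdn_mulr.
  by move=> tn; rewrite -{2}(divnK tn) dvdn_mulr.
rewrite (perm_big _ pe) big_map /=.
have inv j : (j %| n)%N -> (n %/ (n %/ j) = j)%N.
  by move=> jn; rewrite -{1}(divnK jn) mulKn // divn_gt0 ?(dvdn_gt0 n0) // dvdn_leq.
rewrite big_seq (eq_bigr (fun j => mobius j * (k %| n %/ j)%N%:Z)); last first.
  by move=> j hj; rewrite inv // dvdn_divisors.
rewrite -big_seq.
have [kn|kn] := boolP (k %| n)%N; last first.
  have -> : (k == n) = false by apply: contraNF kn => /eqP ->.
  rewrite big_seq big1 // => j; rewrite -dvdn_divisors // => jn; case: (boolP (k %| n %/ j)%N) => h; last by rewrite mulr0.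
  by case/negP: kn; apply: dvdn_trans h _; rewrite -{2}(divnK jn) dvdn_mulr.
have Nn := divnK kn; set N := (n %/ k)%N in Nn.
have N0 : (0 < N)%N by move: n0; rewrite -Nn muln_gt0 => /andP [].
rewrite (eq_bigr (fun j => if (k %| n %/ j)%N then mobius j else 0)); last first.
  by move=> j _; case: ifP; rewrite ?mulr1 ?mulr0.
rewrite -big_mkcond -big_filter (perm_big (divisors N)) /=; last first.
  apply: uniq_perm; rewrite ?filter_uniq ?divisors_uniq // => j.
  rewrite mem_filter -!dvdn_divisors //; apply/andP/idP => [[h jn]|jN].
    by rewrite -(@dvdn_pmul2r k) // Nn -(divnK jn) mulnC dvdn_pmul2r // (dvdn_gt0 n0).
  have jn : (j %| n)%N by rewrite -Nn dvdn_mulr.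
  split => //; rewrite -(@dvdn_pmul2r j) ?(dvdn_gt0 n0) // divnK // -Nn mulnC dvdn_pmul2r //.
rewrite sum_mobius // -Nn -[X in X == (_ * _)%N]mul1n eqn_pmul2r //.
by rewrite eq_sym.
Qed.

(** * The type of a root of the Misiurewicz polynomial *)

Section FractionOrder.
Variables (C : fieldType) (c : C).
Local Notation tofrac := (@FracField.tofrac {poly C}).

(** [ord_frac z F]: the rational function [F] has order of vanishing [z] at [c]. *)
Definition ord_frac (z : int) (F : {fraction {poly C}}) : Prop :=
  exists p q : {poly C}, [/\ p.[c] != 0, q.[c] != 0 &
    F = tofrac ('X - c%:P) ^ z * (tofrac p / tofrac q)].

Let X0 : tofrac ('X - c%:P) != 0.
Proof. by rewrite tofrac_eq0 polyXsubC_eq0. Qed.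

Lemma ord_frac1 : ord_frac 0 1.
Proof. by exists 1, 1; rewrite hornerC oner_eq0 rmorph1 divr1 mulr1 expr0z. Qed.

Lemma ord_fracM y z F H : ord_frac y F -> ord_frac z H -> ord_frac (y + z) (F * H).
Proof.
move=> [p [q [p0 q0 ->]]] [r [s [r0 s0 ->]]]; exists (p * r), (q * s).
by rewrite !hornerM !mulf_neq0 // expfzDr // !rmorphM /= invfM; split => //; ring.
Qed.

Lemma ord_fracX z F (k : nat) : ord_frac z F -> ord_frac (z * k%:Z) (F ^+ k).
Proof.
move=> h; elim: k => [|k IH]; first by rewrite mulr0; apply: ord_frac1.
by rewrite exprS intS mulrDr mulr1; apply: ord_fracM.
Qed.

Lemma ord_fracV z F : ord_frac z F -> ord_frac (- z) F^-1.
Proof.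
move=> [p [q [p0 q0 ->]]]; exists q, p; split => //.
by rewrite !invfM invrK invr_expz [tofrac q * _]mulrC.
Qed.

Lemma ord_fracXz z F (k : int) : ord_frac z F -> ord_frac (k * z) (F ^ k).
Proof.
move=> h; rewrite mulrC; case: k => k; first exact: ord_fracX.
by rewrite NegzE mulrN -invr_expz; apply/ord_fracV/ord_fracX.
Qed.

Lemma ord_frac_prod (I : eqType) (s : seq I) (z : I -> int) (F : I -> {fraction {poly C}}) :
  {in s, forall i, ord_frac (z i) (F i)} ->
  ord_frac (\sum_(i <- s) z i) (\prod_(i <- s) F i).
Proof.
elim: s => [|i s IH] h; first by rewrite !big_nil; apply: ord_frac1.
rewrite !big_cons; apply: ord_fracM; first by apply: h; rewrite mem_head.
by apply: IH => j js; apply: h; rewrite inE js orbT.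
Qed.

Lemma ord_frac_unit p : p.[c] != 0 -> ord_frac 0 (tofrac p).
Proof.
by move=> p0; exists p, 1; rewrite hornerC oner_eq0 rmorph1 divr1 expr0z mul1r.
Qed.

Lemma ord_frac_poly p : p != 0 -> exists z, ord_frac z (tofrac p).
Proof.
move=> p0; have [k [q + E]] := multiplicity_XsubC p c; rewrite p0 /= => q0.
exists k%:Z, q, 1; split; rewrite ?hornerC ?oner_eq0 //.
by rewrite E rmorph1 divr1 rmorphM rmorphXn mulrC.
Qed.

Lemma ord_frac_root p : ord_frac 0 (tofrac p) -> ~~ root p c.
Proof.
move=> [r [s [r0 s0 ]]]; rewrite expr0z mul1r => E; rewrite rootE.
have s0' : tofrac s != 0 by rewrite tofrac_eq0; apply: contraNneq s0 => ->; rewrite horner0.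
have /eqP : p * s = r.
  by apply/eqP; rewrite -tofrac_eq rmorphM /= E divfK.
by apply: contraL => /eqP p0; apply: contraNneq r0 => <-; rewrite hornerM p0 mul0r.
Qed.

End FractionOrder.

Section Misiurewicz.
Variables (C : numFieldType) (d : nat).
Hypothesis d_prime : prime d.

Lemma size_orbX (R : idomainType) j :
  orb d ('X : {poly R}) j.+1 \is monic /\ size (orb d ('X : {poly R}) j.+1) = (d ^ j).+1.
Proof.
have -> : orb d ('X : {poly R}) j.+1 = iter j (unic d 'X) 'X.
  by rewrite /orb iterSr -[unic _ _ 0]/(orb d 'X 1) orb1 ?prime_gt0.
have := @size_iter_unic R d 'X 'X 1 j (prime_gt1 d_prime); rewrite mul1n size_polyX.
by apply; rewrite ?monicX.
Qed.

(** Orbit polynomials of different indices have different degrees, so their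
difference is monic up to sign. *)
Lemma zint_orb (c : C) i j : (i != j)%N -> orb d c i.+1 = orb d c j.+1 ->
  exists2 q : {poly int}, q \is monic & root (map_poly intr q) c.
Proof.
wlog ij : i j / (i < j)%N.
  by move=> H; rewrite neq_ltn => /orP [] ij E; [apply: (H i j)|apply: (H j i)]; rewrite // neq_ltn ij ?orbT.
move=> _ E; have [mj sj] := size_orbX int j; have [_ si] := size_orbX int i.
exists (orb d 'X j.+1 - orb d 'X i.+1).
  rewrite monicE lead_coefDl -?monicE // size_polyN si sj ltnS ltn_exp2l //.
  exact: prime_gt1.
by rewrite rootE -/(zeval c _) zevalB !zeval_orb E subrr.
Qed.

Lemma horner_orbX (c : C) j : (orb d 'X j).[c] = orb d c j.
Proof. by elim: j => [|j IH]; rewrite ?horner0 // !orbS hornerD horner_exp IH hornerX. Qed.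

(** The difference quotient of an iterate, taken along two families of points that
meet at the parameter [c], has as value there the derivative of the iterate. The
chain rule provides the factor [d * x ^+ d.-1]. *)
Lemma horner_unic_diff (c : C) (x y : {poly C}) j : (0 < j)%N -> x.[c] = y.[c] ->
  x.[c] \in zadj c -> exists L w, [/\ w \in zadj c, L.[c] = d%:R * (x.[c] ^+ d.-1 * w) &
    iter j (unic d 'X) x - iter j (unic d 'X) y = (x - y) * L].
Proof.
case: j => // j _ Exy xS; pose S : subringClosed C := zadj c.
have cS : c \in S := zadj_gen c.
have hu (t : {poly C}) : t.[c] \in S -> (unic d 'X t).[c] \in S.
  by move=> tS; rewrite hornerD horner_exp hornerX rpredD // rpredX.
elim: j x y Exy xS => [|j IH] x y Exy xS.
  exists (\sum_(i < d) x ^+ (d.-1 - i) * y ^+ i), 1; split; first exact: rpred1.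
    rewrite horner_sum (eq_bigr (fun _ => x.[c] ^+ d.-1)) => [|i _]; last first.
      rewrite hornerM !horner_exp -Exy -exprD subnK //.
      by rewrite -ltnS prednK ?prime_gt0.
    by rewrite sumr_const card_ord mulr1 mulr_natl.
  by rewrite /= /unic opprD addrACA subrr addr0 subrXX.
have Eu : (unic d 'X x).[c] = (unic d 'X y).[c] by rewrite !hornerD !horner_exp Exy.
have [L1 [w1 [w1S EL1 E1]]] := IH _ _ Eu (hu _ xS).
have [L [w [wS EL E]]] := IH _ _ Exy xS.
exists (L * \sum_(i < d) iter j.+1 (unic d 'X) x ^+ (d.-1 - i) * iter j.+1 (unic d 'X) y ^+ i).
have hs k (t : {poly C}) : t.[c] \in S -> (iter k (unic d 'X) t).[c] \in S.
  by move=> tS; elim: k => //= k hk; apply: hu.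
exists (w * (\sum_(i < d) iter j.+1 (unic d 'X) x ^+ (d.-1 - i) * iter j.+1 (unic d 'X) y ^+ i).[c]).
split; last by rewrite mulrA -E iterS [in X in _ - X]iterS {1 3}/unic opprD addrACA subrr addr0 subrXX.
  rewrite rpredM // horner_sum rpred_sum // => i _.
  by rewrite hornerM !horner_exp rpredM // rpredX // hs // -?Exy.
by rewrite hornerM EL; ring.
Qed.

Variables (m n : nat) (zeta c : C) (G : {poly C}).
Hypotheses (zeta_d : zeta ^+ d = 1) (zeta1 : zeta != 1).
Hypotheses (m2 : (2 <= m)%N) (n1 : (1 <= n)%N).
Hypothesis d_nonunit : (exists2 q : {poly int}, q \is monic & root (map_poly intr q) c) ->
  forall s, s \in zadj c -> 1 + d%:R * s != 0.
Hypotheses (hG : is_misiurewicz_poly d m n zeta G) (hc : root G c).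

Let a := orb d c.
Let aX := orb d ('X : {poly C}).
Let b k := aX (m + k - 1) - zeta *: aX (m - 1).
Local Notation tofrac := (@FracField.tofrac {poly C}).

Let bc k : (b k).[c] = a (m + k - 1) - zeta * a (m - 1).
Proof. by rewrite hornerD hornerN hornerZ !horner_orbX. Qed.

Let cA : c \in zadj c := zadj_gen c.
Let aA j : a j \in zadj c. Proof. exact: orb_closed. Qed.

(** If the factors vanish to order [r] or [s] exactly when [k] divides their index,
the Moebius sum leaves only the contribution of [k = n]. *)
Let ord_G (k : nat) (r s : int) : (0 < k)%N ->
  (forall j, (0 < j)%N -> ord_frac c (r * (k %| j)%N%:Z) (tofrac (b j))) ->
  ((n %| m - 1)%N -> forall j, (0 < j)%N -> (j %| n)%N ->
     ord_frac c (s * (k %| j)%N%:Z) (tofrac (aX j))) ->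
  ord_frac c ((k == n)%:Z * (r - (n %| m - 1)%N%:Z * s)) (tofrac G).
Proof.
move=> k0 hb ha; rewrite hG /misiurewicz_frac.
have red t : \sum_(j <- divisors n) mobius (n %/ j) * (t * (k %| j)%N%:Z) = (k == n)%:Z * t.
  by rewrite -sum_mobius_mult // mulr_suml; apply: eq_bigr => j _; ring.
have -> : (k == n)%:Z * (r - (n %| m - 1)%N%:Z * s) =
    (k == n)%:Z * r + (k == n)%:Z * (- (n %| m - 1)%N%:Z * s) by ring.
have pos j : j \in divisors n -> (0 < j)%N by rewrite -dvdn_divisors // => /(dvdn_gt0 n1).
apply: ord_fracM.
  rewrite -red; apply: ord_frac_prod => j hj; apply: ord_fracXz; exact/hb/pos.
case: (boolP (n %| m - 1)%N) ha => [_ /(_ isT) ha|_ _]; last first.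
  by rewrite oppr0 mul0r mulr0; apply: ord_frac1.
rewrite -red; apply: ord_frac_prod => j hj.
rewrite mulN1r mulNr mulrN -mulNr; apply: ord_fracXz; apply: ha; first exact: pos.
by rewrite dvdn_divisors.
Qed.

Let not_ord0 : ~ ord_frac c 0 (tofrac G).
Proof. by move=> /ord_frac_root; rewrite hc. Qed.

Let m1 : (0 < m - 1)%N. Proof. by rewrite subn_gt0. Qed.

Let orbX_neq0 j : (0 < j)%N -> aX j != 0.
Proof. by case: j => // j _; rewrite monic_neq0 //; case: (size_orbX C j). Qed.

(** If 0 is periodic of exact period [k], then [k] divides [m - 1], and all the
[a_j] and [b_j] with [k] dividing [j] vanish to the same order. For [k <> n] the
Moebius sums are zero; for [k = n] the two products cancel. *)
Lemma misiurewicz_not_periodic : a (m - 1) != 0.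
Proof.
apply/eqP => am; have d2 := prime_gt1 d_prime.
have ex : exists k, (0 < k)%N && (a k == 0) by exists (m - 1)%N; rewrite m1 am eqxx.
have [k /andP [k0 /eqP ak] kmin] := ex_minnP ex.
have aq q r : a (r + q * k) = a r.
  elim: q => [|q IH]; first by rewrite mul0n addn0.
  by rewrite mulSnr addnA /a orbD [orb d c k]ak; exact: IH.
have a0 i : (a i == 0) = (k %| i)%N.
  apply/idP/idP => [|/dvdnP [q ->]]; last by rewrite -[(q * k)%N]add0n aq.
  rewrite {1}(divn_eq i k) addnC aq /dvdn => h.
  rewrite -leqn0 leqNgt; apply/negP => r0.
  have : (k <= i %% k)%N by apply: kmin; rewrite r0 h.
  by rewrite leqNgt ltn_mod k0.
have V q : exists2 V : {poly C}, V.[c] = 1 & aX (k * q.+1) = aX k * V.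
  elim: q => [|q [V Vc IH]]; first by exists 1; rewrite ?hornerC // muln1 mulr1.
  have xc : (aX (k * q.+1)).[c] = 0 by rewrite IH hornerM horner_orbX -/a ak mul0r.
  have [||L [w [_ Lc E]]] := @horner_unic_diff c (aX (k * q.+1)) 0 k k0.
  - by rewrite xc horner0.
  - by rewrite xc rpred0.
  exists (1 + V * L); last first.
    move: E; rewrite subr0 => /(canRL (subrK _)) E.
    by rewrite mulnS /aX orbD [LHS]E -[iter _ _ 0]/(aX k) -/(aX _) IH; ring.
  by rewrite hornerD hornerM hornerC Lc xc expr0n eqn0Ngt ltn_predRL d2 mul0r !mulr0 addr0.
have [r hr] := ord_frac_poly c (orbX_neq0 k0).
have hV (V' : {poly C}) : V'.[c] != 0 -> ord_frac c (r * true%:Z) (tofrac (aX k * V')).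
  move=> V0; rewrite mulr1 rmorphM -[r]addr0; apply: ord_fracM => //.
  exact: ord_frac_unit.
have km : (k %| m - 1)%N by rewrite -a0 am.
have mul j : (0 < j)%N -> (k %| j)%N -> exists q, (j = k * q.+1)%N.
  by move=> j0 /dvdnP [[|q] E]; [rewrite E in j0|exists q; rewrite mulnC].
apply: not_ord0; have -> : 0 = (k == n)%:Z * (r - (n %| m - 1)%N%:Z * r).
  by case: eqVneq => [<-|_]; rewrite ?mul0r // km !mul1r subrr.
apply: ord_G => // [j j0|_ j j0 _]; last first.
  case: (boolP (k %| j)%N) => kj; last first.
    by rewrite mulr0; apply: ord_frac_unit; rewrite horner_orbX -/a a0.
  have [q ->] := mul j j0 kj; have [V1 V1c E1] := V q.
  by rewrite E1; apply: hV; rewrite ?V1c ?oner_eq0.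
case: (boolP (k %| j)%N) => kj; last first.
  rewrite mulr0; apply: ord_frac_unit; rewrite bc am mulr0 subr0 a0 -addnBAC ?dvdn_addr //.
  exact: ltnW.
have kmj : (k %| m + j - 1)%N by rewrite -addnBAC ?dvdn_addr // ltnW.
have mj0 : (0 < m + j - 1)%N by rewrite -addnBAC ?addn_gt0 ?m1 // ltnW.
have [q Eq] := mul _ mj0 kmj; have [V1 V1c E1] := V q.
have [q' Eq'] := mul _ m1 km; have [V2 V2c E2] := V q'.
have -> : b j = aX k * (V1 - zeta *: V2) by rewrite /b Eq E1 Eq' E2 mulrBr -scalerAr.
apply: hV.
by rewrite hornerD hornerN hornerZ V1c V2c mulr1 subr_eq0 eq_sym.
Qed.

(** At a strictly preperiodic parameter every [b_(k q)] is [b_k] times a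
polynomial that takes a value congruent to 1 modulo [d] there, so the [b_j] that
vanish do so to the same order, and the exponents cancel unless [k = n]. *)
Lemma misiurewicz_exact : a (m + n - 1) = zeta * a (m - 1) /\
  forall k, (0 < k < n)%N -> a (m + k - 1) != zeta * a (m - 1).
Proof.
have am := misiurewicz_not_periodic.
have [ex|nex] := EM (exists k, (0 < k)%N && ((b k).[c] == 0)); last first.
  have b0 j : (0 < j)%N -> (b j).[c] != 0.
    by move=> j0; apply/negP => h; apply: nex; exists j; rewrite j0.
  case: not_ord0; have -> : 0 = (1%N == n)%:Z * (0 - (n %| m - 1)%N%:Z * 0) by rewrite !(mulr0, subr0).
  apply: ord_G => // [j j0|nm j j0 jn]; rewrite mul0r; apply: ord_frac_unit.
    exact: b0.
  rewrite horner_orbX; apply: contraNneq am => aj.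
  have /dvdnP [q ->] := dvdn_trans jn nm.
  elim: q => [|q /eqP IH]; first by rewrite mul0n.
  by rewrite mulSnr /a orbD [orb d c j]aj; apply/eqP.
have [k /andP [k0 /eqP bk] kmin] := ex_minnP ex.
have Ek : a (m + k - 1) = zeta * a (m - 1) by apply/eqP; rewrite -subr_eq0 -bc bk.
have mS i : (m + i - 1 = i + (m - 1))%N by rewrite addnC addnBA // ltnW.
have per i : a (i + (m + k)) = a (i + m).
  have -> : (i + (m + k) = i.+1 + (m + k - 1))%N by rewrite addSnnS subn1 prednK // addn_gt0 k0 orbT.
  have -> : (i + m = i.+1 + (m - 1))%N by rewrite addSnnS subn1 prednK // ltnW.
  by rewrite /a !(orbD _ _ i.+1) -/a Ek iter_unic_root.
have per' q i : a (i + m + q * k) = a (i + m).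
  elim: q => [|q IH]; first by rewrite mul0n addn0.
  by rewrite -[RHS]IH mulSnr; rewrite [in RHS]addnAC -[in RHS]per; congr (a _); lia.
have c_int : exists2 q : {poly int}, q \is monic & root (map_poly intr q) c.
  apply: (@zint_orb c (m + k).-1 m.-1); first by lia.
  by rewrite !prednK ?addn_gt0 ?k0 ?orbT // 1?ltnW //; apply: (per 0).
have V q : exists V s, [/\ s \in zadj c, V.[c] = 1 + d%:R * s &
    aX (m - 1 + k * q.+1) - zeta *: aX (m - 1) = b k * V].
  elim: q => [|q [V [s [sA Vc IH]]]].
    exists 1, 0; rewrite rpred0 hornerC mulr0 addr0 mulr1 muln1; split => //.
    by rewrite /b mS addnC.
  have xc : (aX (m - 1 + k * q.+1)).[c] = (zeta%:P * aX (m - 1)).[c].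
    move/(congr1 (fun p : {poly C} => p.[c])): IH.
    rewrite hornerM bk mul0r hornerD hornerN hornerZ hornerM hornerC.
    by move/eqP; rewrite subr_eq0 => /eqP.
  have xA : (aX (m - 1 + k * q.+1)).[c] \in zadj c by rewrite horner_orbX aA.
  have [L [w [wA Lc E]]] := horner_unic_diff k0 xc xA.
  rewrite iter_unic_root // -?polyCM in E; last by rewrite -polyC_exp zeta_d.
  set t := (aX _).[c] in xA Lc; exists (1 + V * L), ((1 + d%:R * s) * (t ^+ d.-1 * w)); split.
  - by rewrite !(rpredM, rpredD, rpredX) ?rpred1 ?rpred_nat.
  - by rewrite hornerD hornerM hornerC Lc Vc; ring.
  rewrite (_ : m - 1 + k * q.+2 = k + (m - 1 + k * q.+1))%N; last by rewrite mulnS; lia.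
  move: E; rewrite mul_polyC IH => /(canRL (subrK _)) E.
  rewrite [aX (k + _)]orbD [X in X - _]E.
  have <- : aX (m + k - 1) = iter k (unic d 'X) (aX (m - 1)) by rewrite mS [LHS]orbD.
  rewrite -addrA -/(b k); ring.
have bN0 : b k != 0.
  have mk0 : (0 < m + k - 1)%N by rewrite mS addn_gt0 k0.
  rewrite /b -(prednK mk0) -(prednK m1).
  have [_ s1] := size_orbX C (m + k - 1).-1; have [_ s2] := size_orbX C (m - 1).-1.
  rewrite subr_eq0; apply/eqP => /(congr1 (fun p : {poly C} => size p)).
  rewrite s1 => E; have := size_scale_leq zeta (aX (m - 1).-1.+1).
  rewrite -E s2 ltnS leq_exp2l ?prime_gt1 //; lia.
have [r hr] := ord_frac_poly c bN0.
have mul j : (0 < j)%N -> (k %| j)%N -> exists q, (j = k * q.+1)%N.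
  by move=> j0 /dvdnP [[|q] E]; [rewrite E in j0|exists q; rewrite mulnC].
have oG : ord_frac c ((k == n)%:Z * (r - (n %| m - 1)%N%:Z * 0)) (tofrac G).
  apply: ord_G => // [j j0|nm j j0 jn]; last first.
    rewrite mul0r; apply: ord_frac_unit; rewrite horner_orbX; apply: contraNneq am => aj.
    have /dvdnP [q ->] := dvdn_trans jn nm.
    elim: q => [|q /eqP IH]; first by rewrite mul0n.
    by rewrite mulSnr /a orbD [orb d c j]aj; apply/eqP.
  case: (boolP (k %| j)%N) => kj.
    have [q Eq] := mul j j0 kj; have [V1 [s [sA V1c E1]]] := V q.
    have -> : b j = b k * V1 by rewrite -E1 Eq /b mS addnC.
    rewrite mulr1 rmorphM -[r]addr0; apply: ord_fracM => //; apply: ord_frac_unit.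
    by rewrite V1c d_nonunit.
  rewrite mulr0; apply: ord_frac_unit; apply/eqP => bj.
  have r0 : (0 < j %% k)%N by rewrite lt0n.
  have : (k <= j %% k)%N.
    apply: kmin; rewrite r0 /= -bj !bc; apply/eqP; congr (_ - _).
    rewrite [in RHS](divn_eq j k).
    have -> : (m + j %% k - 1 = (j %% k).-1 + m)%N by lia.
    have -> : (m + (j %/ k * k + j %% k) - 1 = (j %% k).-1 + m + j %/ k * k)%N by lia.
    by rewrite per'.
  by rewrite leqNgt ltn_mod k0.
case: (eqVneq k n) oG => [<- _|_]; last by rewrite mul0r.
split=> // i /andP [i0 ik]; apply: contraL ik => /eqP Ei; rewrite -leqNgt.
by apply: kmin; rewrite i0 bc Ei subrr eqxx.
Qed.

(** A smaller period of the tail would make [a_(m+k-1)] and [a_(m+n-1)] equal. *)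
Lemma misiurewicz_period : a (m + n) = a m /\
  forall k, (0 < k < n)%N -> a (m + k) <> a m.
Proof.
have [En Ex] := misiurewicz_exact.
have per i : a (i + (m + n)) = a (i + m).
  have -> : (i + (m + n) = i.+1 + (m + n - 1))%N by rewrite addSnnS subn1 prednK // addn_gt0 n1 orbT.
  have -> : (i + m = i.+1 + (m - 1))%N by rewrite addSnnS subn1 prednK // ltnW.
  by rewrite /a !(orbD _ _ i.+1) -/a En iter_unic_root.
split; first exact: (per 0%N).
move=> k kn E; have [k0 _] := andP kn; have := Ex k kn; rewrite -En => /eqP; apply.
have per_k q i : a (i + m + q * k) = a (i + m).
  elim: q => [|q IH]; first by rewrite mul0n addn0.
  rewrite -[RHS]IH mulSnr.
  have -> : (i + m + (q * k + k) = (i + q * k) + (m + k))%N by lia.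
  have -> : (i + m + q * k = (i + q * k) + m)%N by lia.
  by rewrite /a !(orbD _ _ (i + q * k)) -/a E.
have per_n q i : a (i + m + q * n) = a (i + m).
  elim: q => [|q IH]; first by rewrite mul0n addn0.
  rewrite -[RHS]IH mulSnr.
  have -> : (i + m + (q * n + n) = (i + q * n) + (m + n))%N by lia.
  have -> : (i + m + q * n = (i + q * n) + m)%N by lia.
  by rewrite per.
have -> : (m + k - 1 = k.-1 + m)%N by lia.
have -> : (m + n - 1 = n.-1 + m)%N by lia.
rewrite -(per_k n.-1 k.-1) -(per_n k.-1 n.-1); congr (a _).
by rewrite -(prednK k0) -(prednK n1) /=; lia.
Qed.

End Misiurewicz.

(** * Extension of homomorphisms to all algebraic numbers *)

Section MinimalPolynomial.
Variables (D : comNzRingType) (F : fieldType) (phi : {rmorphism D -> F}).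
Hypothesis D_field : forall a : D, a != 0 -> exists b, b * a = 1.

(** [D] has inverses, so a nonzero polynomial of least degree can be made monic, and
it divides the others by Euclidean division. *)
Lemma minimal_poly (x : F) (p0 : {poly D}) : p0 != 0 -> root (map_poly phi p0) x ->
  exists p : {poly D}, [/\ p \is monic, root (map_poly phi p) x &
    forall q, root (map_poly phi q) x -> exists s, q = s * p].
Proof.
move=> nz rt.
have mon (q : {poly D}) : q != 0 -> root (map_poly phi q) x ->
    exists q', [/\ q' \is monic, root (map_poly phi q') x & size q' = size q].
  move=> q0 rq; have lq : lead_coef q != 0 by rewrite lead_coef_eq0.
  have [b bq] := D_field lq.
  exists (b *: q).
  have sz : size (b *: q) = size q.
    apply/eqP; rewrite eqn_leq size_scale_leq /= leqNgt; apply/negP => h.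
    have : (b *: q)`_(size q).-1 = 1 by rewrite coefZ -lead_coefE.
    rewrite nth_default; first by move/eqP; rewrite eq_sym oner_eq0.
    by rewrite -ltnS prednK // size_poly_gt0.
  by rewrite monicE lead_coefE sz coefZ -lead_coefE bq eqxx rootE map_polyZ hornerZ (eqP rq) mulr0.
have ex : exists k, `[< exists q, [/\ q \is monic, root (map_poly phi q) x & size q = k] >].
  by have [q h] := mon p0 nz rt; exists (size q); apply/asboolP; exists q; case: h.
case: (ex_minnP ex) => k /asboolP [p [mp rp sp]] kmin.
exists p; split => // q rq; exists (Pdiv.Ring.rdivp q p).
have E := Pdiv.RingMonic.rdivp_eq mp q.
have rr : root (map_poly phi (Pdiv.Ring.rmodp q p)) x.
  move: rq; rewrite {1}E rmorphD rmorphM rootE hornerD hornerM (eqP rp) mulr0 add0r.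
  by rewrite rootE.
have [r0|r0] := eqVneq (Pdiv.Ring.rmodp q p) 0; first by rewrite {1}E r0 addr0.
have [q' [m' r' s']] := mon _ r0 rr.
have : (k <= size (Pdiv.Ring.rmodp q p))%N by apply: kmin; apply/asboolP; exists q'.
by rewrite -sp leqNgt Pdiv.Ring.ltn_rmodpN0 // monic_neq0.
Qed.

End MinimalPolynomial.

Section Extension.
Variable C : numClosedFieldType.

Definition algebraic : {pred C} := [pred x | `[< algebraicOver (ratr : rat -> C) x >]].
Lemma algebraicP x : reflect (algebraicOver (ratr : rat -> C) x) (x \in algebraic).
Proof. exact: asboolP. Qed.

Lemma algebraic_divring : divring_closed algebraic.
Proof.
split; first by apply/algebraicP; apply: algebraic1.
- by move=> x y /algebraicP hx /algebraicP hy; apply/algebraicP/algebraic_sub.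
- by move=> x y /algebraicP hx /algebraicP hy; apply/algebraicP/algebraic_div.
Qed.
HB.instance Definition _ := GRing.isDivringClosed.Build C algebraic algebraic_divring.

Lemma algebraic_root k x : (0 < k)%N -> x ^+ k \in algebraic -> x \in algebraic.
Proof.
move=> k0 /algebraicP [p p0 rp]; apply/algebraicP; exists (p \Po 'X^k).
  by rewrite comp_poly_eq0 // size_polyXn.
by move: rp; rewrite !rootE map_comp_poly map_polyXn horner_comp hornerXn.
Qed.

Definition rational : {pred C} := [pred x | `[< exists r : rat, x = ratr r >]].
Lemma rational_subring : subring_closed rational.
Proof.
split; first by apply/asboolP; exists 1; rewrite rmorph1.
- by move=> _ _ /asboolP [x ->] /asboolP [y ->]; apply/asboolP; exists (x - y); rewrite rmorphB.
- by move=> _ _ /asboolP [x ->] /asboolP [y ->]; apply/asboolP; exists (x * y); rewrite rmorphM.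
Qed.
HB.instance Definition _ := GRing.isSubringClosed.Build C rational rational_subring.

(** The graph of a ring homomorphism to [C] whose domain is a ring of algebraic
numbers containing the rational numbers; such a domain is a field. *)
Definition hom_graph (G : {pred C * C}) := [/\ forall r : rat, (ratr r, ratr r) \in G,
  forall y, (0, y) \in G -> y = 0 & forall z, z \in G -> z.1 \in algebraic].

Section Graph.
Variable G : subringClosed (C * C)%type.
Hypothesis hG : hom_graph G.

Lemma hom_graph_fun x y z : (x, y) \in G -> (x, z) \in G -> y = z.
Proof.
case: hG => _ fun0 _ hy hz; apply/eqP; rewrite -subr_eq0; apply/eqP/fun0.
by rewrite -(subrr x) -[(_, _)]/((x, y) - (x, z)) rpredB.
Qed.

(** The inverse of an algebraic number is a polynomial in it with rational
coefficients, and evaluating this polynomial at the pair [z] gives a pair of the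
graph. *)
Lemma hom_graph_inv z : z \in G -> z.1 != 0 -> z.2 != 0 /\ (z.1^-1, z.2^-1) \in G.
Proof.
case: hG => hr fun0 ha; case: z => x y zG /= x0.
have /algebraicP [p p0 rp] := ha _ zG.
have hp : map_poly ratr p \is a polyOver rational.
  by apply/polyOverP => i; rewrite coef_map; apply/asboolP; exists p`_i.
have [|v /adjoinP [q hq ->] /andP [/asboolP [r Er] xq0]] := root_const hp _ rp x0.
  by rewrite map_poly_eq0.
pose Q : {poly C * C} := map_poly (fun t => (t, t)) q.
pose Z := Q.[(x, y)] * (ratr r^-1, ratr r^-1).
have diag : {in rational, forall t, (t, t) \in G} by move=> _ /asboolP [s ->].
have ZG : Z \in G.
  rewrite rpredM // rpred_horner //; apply/polyOverP => i.
  rewrite coef_map_id0 //; apply: diag; exact: (polyOverP hq).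
have Z1 : Z.1 = x^-1.
  have -> : Z.1 = (map_poly fst Q).[x] * ratr r^-1 by rewrite -[x]/((x, y).1) horner_map.
  have -> : map_poly fst Q = q.
    by apply/polyP => i; rewrite coef_map /= coef_map_id0.
  have q0 : q.[x] != 0.
    by apply: contraNneq xq0 => ->; rewrite mulr0.
  rewrite [X in _ * X](_ : _ = (x * q.[x])^-1); last by rewrite Er fmorphV.
  by rewrite invfM mulrCA mulfV ?mulr1.
have P1 : (x, y) * Z \in G by rewrite rpredM.
have {}P1 : y * Z.2 = 1.
  apply: (@hom_graph_fun 1); last exact: (rpred1 G).
  by move: P1; rewrite -[(x, y) * Z]/(x * Z.1, y * Z.2) Z1 mulfV.
have y0 : y != 0.
  by apply/eqP => y0; move/eqP: P1; rewrite y0 mul0r eq_sym oner_eq0.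
split => //; suff -> : (x^-1, y^-1) = Z by [].
by rewrite [Z]surjective_pairing Z1; congr pair; rewrite -(mulKf y0 Z.2) P1 mulr1.
Qed.

Let D : comNzRingType := subring_type G.
Let phi1 : {rmorphism D -> C} := (fst \o val : D -> C).
Let phi2 : {rmorphism D -> C} := (snd \o val : D -> C).

(** The homomorphism is well defined on [D[x]] when every relation satisfied by [x] is
satisfied by [y] after transport of the coefficients. *)
Lemma hom_graph_adjoin x y : x \in algebraic ->
  (forall q : {poly subring_type G}, root (map_poly (fst \o val) q) x ->
     root (map_poly (snd \o val) q) y) ->
  hom_graph (adjoin G (x, y)).
Proof.
case: (hG) => hr fun0 ha xa h.
have lift (q : {poly C * C}) : q \is a polyOver G -> exists q' : {poly D}, q = map_poly val q'.
  move=> hq; exists (\poly_(i < size q) insubd (0 : D) q`_i).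
  apply/polyP => i; rewrite coef_map coef_poly.
  case: ltnP => hi; last by rewrite nth_default // rmorph0.
  by rewrite /= insubdK // ; exact: (polyOverP hq).
have ev (q : {poly D}) : (map_poly val q).[(x, y)] =
    ((map_poly (fst \o val) q).[x], (map_poly (snd \o val) q).[y]).
  rewrite [LHS]surjective_pairing; congr pair.
    by rewrite -[x in RHS]/((x, y).1) map_poly_comp horner_map.
  by rewrite -[y in RHS]/((x, y).2) map_poly_comp horner_map.
split.
- by move=> r; apply: mem_adjoin.
- move=> y' /adjoinP [q /lift [q' ->]]; rewrite ev => -[/esym E ->].
  by apply/eqP/(h q'); rewrite rootE E.
move=> z /adjoinP [q /lift [q' ->] ->]; rewrite ev.
suff h' : map_poly phi1 q' \is a polyOver algebraic by apply: rpred_horner h' xa.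
apply/polyOverP => i; rewrite coef_map.
by apply: ha; apply: valP.
Qed.

Lemma hom_graph_min_poly x : x \in algebraic ->
  exists p : {poly subring_type G}, [/\ p \is monic, root (map_poly (fst \o val) p) x &
    forall q, root (map_poly (fst \o val) q) x -> exists s, q = s * p].
Proof.
case: (hG) => hr fun0 ha xa.
have Df (a : D) : a != 0 -> exists b, b * a = 1.
  case: a => -[a1 a2] aG a0.
  have a10 : a1 != 0.
    apply: contraNneq a0 => a10; apply/eqP/val_inj => /=.
    by rewrite a10 in aG *; rewrite (fun0 _ aG).
  have [a20 aV] := hom_graph_inv aG a10.
  exists (SubringElt aV); apply: val_inj => /=.
  by rewrite -[LHS]/(a1^-1 * a1, a2^-1 * a2) !mulVf.
case/algebraicP: xa => p p0 rp.
pose p' : {poly D} := \poly_(i < size p) insubd (0 : D) (ratr p`_i, ratr p`_i).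
have E : map_poly phi1 p' = map_poly ratr p.
  apply/polyP => i; rewrite !coef_map coef_poly.
  case: ltnP => hi; last by rewrite [in RHS]nth_default // !raddf0.
  by rewrite /= insubdK.
have p'0 : p' != 0.
  apply: contraNneq p0 => p'0; move: E; rewrite p'0 rmorph0 => /esym/eqP.
  by rewrite map_poly_eq0.
by apply: (minimal_poly (phi := phi1) Df p'0); rewrite E.
Qed.

Lemma hom_graph_extend x : x \in algebraic -> exists y, hom_graph (adjoin G (x, y)).
Proof.
move=> xa; have [p [mp rp min]] := hom_graph_min_poly xa.
have m2 : map_poly phi2 p \is monic by apply: monic_map.
have [y ry] : exists y, root (map_poly phi2 p) y.
  apply/closed_rootP; rewrite size_map_poly_id0 ?(monicP mp) ?rmorph1 ?oner_eq0 //.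
  apply: contraTneq rp => s1.
  move/monicP: mp; rewrite lead_coefE s1 /= => p0.
  have sp : (size p <= 1)%N by rewrite s1.
  have -> : p = 1 by rewrite [LHS](size1_polyC sp) p0.
  by rewrite (rmorph1 (map_poly phi1)) root1.
exists y; apply: hom_graph_adjoin => // q /min [s ->].
by rewrite (rmorphM (map_poly phi2)) rootM ry orbT.
Qed.

End Graph.
End Extension.

Lemma map_poly_XnsubC (R S : comNzRingType) (f : {rmorphism R -> S}) n a :
  map_poly f ('X^n - a%:P) = 'X^n - (f a)%:P.
Proof. by rewrite rmorphB /= map_polyXn map_polyC. Qed.

Section Automorphisms.
Variable C : numClosedFieldType.

(** An element outside the field [M] whose [d]-th power lies in [M] can be moved
by a homomorphism that fixes [M]: its minimal polynomial over [M] has another root,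
since [X^d - x^d] is separable. *)
Lemma hom_graph_move (G : subringClosed (C * C)%type) (x : C) d : hom_graph G ->
  (forall z, z \in G -> z.1 = z.2) -> prime d ->
  x \in @algebraic C -> (x, x) \notin G -> (x ^+ d, x ^+ d) \in G ->
  exists2 y, y != x & hom_graph (adjoin G (x, y)).
Proof.
move=> hG diag pd xa xG xdG; have d0 := prime_gt0 pd.
have x0 : x != 0 by apply: contraNneq xG => ->; rewrite (rpred0 G).
have [p [mp rp min]] := hom_graph_min_poly hG xa.
pose phi1 : {rmorphism subring_type G -> C} := (fst \o val : subring_type G -> C).
pose phi2 : {rmorphism subring_type G -> C} := (snd \o val : subring_type G -> C).
have E12 : map_poly phi2 p = map_poly phi1 p.
  by apply/polyP => i; rewrite !coef_map /= diag //; apply: valP.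
have EX : map_poly phi1 ('X^d - (SubringElt xdG)%:P) = 'X^d - (x ^+ d)%:P.
  exact: (map_poly_XnsubC phi1 d (SubringElt xdG)).
have [s Es] : exists s, 'X^d - (SubringElt xdG)%:P = s * p.
  by apply: min; rewrite -[map_poly _ _]/(map_poly phi1 _) EX rootE !hornerE subrr.
have [r Er] : exists r, map_poly phi1 p = r * ('X - x%:P) by apply/factor_theorem.
have m1 : map_poly phi1 p \is monic by apply: monic_map.
have r0 : r != 0.
  by apply: contraTneq m1 => r0; rewrite Er r0 mul0r monicE lead_coef0 eq_sym oner_eq0.
have szp : size (map_poly phi1 p) = size p.
  by rewrite size_map_poly_id0 // (monicP mp) rmorph1 oner_eq0.
have [y ry] : exists y, root r y.
  apply/closed_rootP; apply: contraNneq xG => r1.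
  have sp : size p = 2%N.
    by rewrite -szp Er size_Mmonic ?monicXsubC // size_XsubC r1.
  have : subring_val p`_0 \in G by apply: valP.
  have -> : subring_val p`_0 = - (x, x).
    have e1 : (subring_val p`_0).1 = - x.
      have := rp; rewrite rootE horner_coef szp sp !big_ord_recl big_ord0 !coef_map /=.
      move: mp; rewrite monicE lead_coefE sp => /eqP /= ->.
      by rewrite expr0 !mulr1 addr0 expr1 mul1r addr_eq0 => /eqP.
    by rewrite [LHS]surjective_pairing -diag ?e1 //; apply: valP.
  by rewrite rpredN.
exists y.
  apply/eqP => yx; have [r' Er'] : exists r', r = r' * ('X - x%:P).
    by apply/factor_theorem; rewrite -{1}yx.
  have : ('X^d - (x ^+ d)%:P : {poly C})^`().[x] = 0.
    have -> : 'X^d - (x ^+ d)%:P = map_poly phi1 s * r' * ('X - x%:P) ^+ 2.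
      rewrite -EX Es; transitivity (map_poly phi1 s * map_poly phi1 p).
        exact: (rmorphM (map_poly phi1)).
      by rewrite Er Er' expr2 !mulrA.
    by rewrite expr2 mulrA derivM hornerD !hornerM !hornerXsubC subrr !(mulr0, mul0r) addr0.
  rewrite derivB derivXn derivC subr0 hornerMn hornerXn => /eqP.
  by rewrite mulrn_eq0 expf_eq0 (negPf x0) andbF orbF eqn0Ngt d0.
apply: hom_graph_adjoin => // q /min [t ->].
have -> : map_poly (snd \o val) (t * p) = map_poly phi2 t * map_poly phi2 p.
  exact: (rmorphM (map_poly phi2)).
by rewrite rootM E12 Er rootM ry orbT.
Qed.

(** By Zorn's lemma, as a maximal graph can be extended to any further algebraic number. *)
Lemma hom_graph_maximal (G0 : subringClosed (C * C)%type) : hom_graph G0 ->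
  exists G : subringClosed (C * C)%type, [/\ hom_graph G, {subset G0 <= G} &
    forall x, x \in @algebraic C -> exists y, (x, y) \in G].
Proof.
move=> hG0.
pose good (U : set (C * C)) := U = set0 \/ exists G : subringClosed (C * C)%type,
  [/\ hom_graph G, {subset G0 <= G} & U = [set` G]].
have [F FP tot|A [PA maxA]] := @Zorn_bigcup _ good.
  have [ne|ne] := EM (exists2 X, F X & X !=set0); last first.
    left; apply/seteqP; split => // z [X FX Xz]; apply: ne; exists X => //; by exists z.
  right; pose U := \bigcup_(X in F) X.
  have gX X : F X -> X !=set0 -> exists G : subringClosed (C * C)%type,
      [/\ hom_graph G, {subset G0 <= G} & X = [set` G]].
    by move=> FX [z Xz]; case: (FP X FX) => // X0; rewrite X0 in Xz.
  (* two elements of the union lie in a common member of the chain *)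
  have both x y : U x -> U y -> exists G : subringClosed (C * C)%type,
      [/\ hom_graph G, F [set` G], x \in G & y \in G].
    move=> [X FX Xx] [Y FY Yy].
    have [GX [h1 h2 EX]] := gX X FX (ex_intro _ x Xx).
    have [GY [k1 k2 EY]] := gX Y FY (ex_intro _ y Yy).
    case: (tot X Y FX FY) => XY.
      exists GY; rewrite -EY; split => //; first by move: (XY x Xx); rewrite EY.
      by move: Yy; rewrite EY.
    exists GX; rewrite -EX; split => //; first by move: Xx; rewrite EX.
    by move: (XY y Yy); rewrite EX.
  have [X0 FX0 nX0] := ne; have [H0 [hH0 sH0 EH0]] := gX X0 FX0 nX0.
  have UH0 z : z \in H0 -> U z by move=> hz; exists X0; rewrite // EH0.
  have hU : subring_closed (mem U).
    split; first by rewrite inE; apply: UH0; rewrite (rpred1 H0).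
    - move=> x y; rewrite !inE => Ux Uy; have [G [_ FG xG yG]] := both x y Ux Uy.
      by exists [set` G] => //; apply: (rpredB xG yG).
    - move=> x y; rewrite !inE => Ux Uy; have [G [_ FG xG yG]] := both x y Ux Uy.
      by exists [set` G] => //; apply: (rpredM xG yG).
  pose G : subringClosed (C * C)%type :=
    HB.pack (mem U : {pred C * C}) (GRing.isSubringClosed.Build _ _ hU).
  have GE z : z \in G = (z \in U) by [].
  exists G; split.
  - split=> [r|y|z]; rewrite GE inE.
    + by apply: UH0; case: hH0.
    + move=> Uy; have [H [[_ h _] _ + _]] := both _ _ Uy Uy; exact: h.
    + move=> Uz; have [H [[_ _ h] _ + _]] := both _ _ Uz Uz; exact: h.
  - by move=> z zG; rewrite GE inE; apply/UH0/sH0.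
  - by apply/seteqP; split => z /=; rewrite GE inE.
case: PA => [A0|[G [hG sG EA]]].
  case: (maxA [set` G0]); last by right; exists G0; split.
  rewrite A0; split; first by move=> z [].
  by move=> /(_ 0) /=; apply; apply: (rpred0 G0).
exists G; split => // x xa; have [y hy] := hom_graph_extend hG xa.
exists y; apply/negPn/negP => xyG; case: (maxA [set` adjoin G (x, y)]).
  rewrite EA; split; first by move=> z zG /=; apply: mem_adjoin.
  by move=> /(_ (x, y)) /= h; case/negP: xyG; apply/h/adjoin_gen.
right; exists (adjoin G (x, y) : subringClosed (C * C)%type); split => // z /sG; exact: mem_adjoin.
Qed.

Lemma hom_extension (G : subringClosed (C * C)%type) : hom_graph G ->
  exists s : C -> C, [/\ {in @algebraic C &, {morph s : x y / x + y}},
    {in @algebraic C &, {morph s : x y / x * y}},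
    {in @algebraic C, forall x, s x = 0 -> x = 0} & forall z, z \in G -> s z.1 = z.2].
Proof.
move=> /hom_graph_maximal [H [hH GH tot]].
pose s x := xget 0 [set y | (x, y) \in H].
have sH x : x \in @algebraic C -> (x, s x) \in H.
  by move=> /tot [y xy]; rewrite /s; case: xgetP => // /(_ y).
have sE x y : x \in @algebraic C -> (x, y) \in H -> s x = y.
  by move=> xa; apply: (hom_graph_fun hH); apply: sH.
exists s; split.
- move=> x y xa ya; apply: sE; first exact: rpredD.
  exact: (rpredD (sH x xa) (sH y ya)).
- move=> x y xa ya; apply: sE; first exact: rpredM.
  exact: (rpredM (sH x xa) (sH y ya)).
- move=> x xa sx; apply/eqP/negPn/negP => x0.
  by have [] := hom_graph_inv hH (sH x xa) x0; rewrite /= sx eqxx.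
- move=> [x y] zG; apply: sE (GH _ zG).
  by case: hH => _ _ /(_ _ (GH _ zG)).
Qed.

End Automorphisms.

(** * Powers of a prime ideal and orders *)

Definition subfield_pred (C : fieldType) (K : set C) (hK : subfield K) : divringClosed C :=
  HB.pack (mem K : {pred C}) (GRing.isDivringClosed.Build C (mem K) hK).

Lemma subfield_predE (C : fieldType) (K : set C) (hK : subfield K) x :
  K x <-> x \in subfield_pred hK.
Proof. by rewrite -[x \in _]/(x \in K) inE. Qed.

Section IdealValuation.
Variables (C : numFieldType) (K P : set C) (d : nat) (A O : subringClosed C) (p : C).
Hypotheses (d_prime : prime d) (hK : subfield K).
Hypotheses (hP : prime_ideal_of K P) (Pd : lies_above P d).
Hypothesis AK : forall x, x \in A -> integers_of K x.
Hypotheses (dvrO : dvr O p) (pA : p \in A) (Pp : P p).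
Hypothesis locO : forall x, x \in O -> exists a s, [/\ a \in A, s \in A, ~ P s & x * s = a].
Hypothesis KO : forall x, integers_of K x -> x \in O.

Let OK := integers_of K.

Lemma integers_ring : [/\ forall z : int, OK z%:~R,
  forall x y, OK x -> OK y -> OK (x + y) & forall x y, OK x -> OK y -> OK (x * y)].
Proof.
have SE := subfield_predE hK.
have KD x y : K x -> K y -> K (x + y) by rewrite !SE; apply: rpredD.
have KM x y : K x -> K y -> K (x * y) by rewrite !SE; apply: rpredM.
split.
- move=> z; split; last exact: integral_id.
  by rewrite SE rpred_int.
- by move=> x y [Kx Ix] [Ky Iy]; split; [apply: KD|apply: integral_add].
- by move=> x y [Kx Ix] [Ky Iy]; split; [apply: KM|apply: integral_mul].
Qed.

Let OKz := let: And3 h _ _ := integers_ring in h.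
Let OKD := let: And3 _ h _ := integers_ring in h.
Let OKM := let: And3 _ _ h := integers_ring in h.

Lemma integers_zeval s (q : {poly int}) : OK s -> OK (zeval s q).
Proof.
move=> sK; elim/poly_ind: q => [|q z IH]; first by rewrite /zeval rmorph0 horner0; apply: (OKz 0).
rewrite zevalD zevalM zeval_int /zeval map_polyX hornerX -/(zeval s q).
by apply: OKD => //; apply: OKM.
Qed.

Lemma ideal_mul_ideal J : ideal_of K J -> ideal_of K (ideal_mul P J).
Proof.
case: hP => -[PK P0 PD PM] _ _ [JK J0 JD JM]; split.
- move=> _ [k [u [v [hu hv ->]]]].
  elim/big_ind: _ => [|x y|i _]; [exact: (OKz 0)|exact: OKD|].
  by apply: OKM; [exact/PK/hu|exact/JK/hv].
- by exists 0%N, (fun _ => 0), (fun _ => 0); split => //; rewrite big_ord0.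
- move=> _ _ [k [u [v [hu hv ->]]]] [l [u' [v' [hu' hv' ->]]]].
  exists (k + l)%N, (fun i : 'I_(k + l) => match fintype.split i with inl j => u j | inr j => u' j end),
    (fun i : 'I_(k + l) => match fintype.split i with inl j => v j | inr j => v' j end); split.
  + by move=> i; case: (fintype.split i).
  + by move=> i; case: (fintype.split i).
  + rewrite big_split_ord; congr (_ + _); apply: eq_bigr => i _.
      by rewrite (unsplitK (inl i)).
    by rewrite (unsplitK (inr i)).
- move=> a _ aK [k [u [v [hu hv ->]]]]; exists k, (fun i => a * u i), v; split => //.
    by move=> i; apply: PM.
  by rewrite mulr_sumr; apply: eq_bigr => i _; rewrite mulrA.
Qed.

Lemma ideal_pow_ideal k : ideal_of K (ideal_pow K P k).
Proof.
elim: k => [|k IH]; last exact: ideal_mul_ideal.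
by split => //; exact: (OKz 0).
Qed.

Lemma ideal_mul_mem (J : set C) x y : P x -> J y -> ideal_mul P J (x * y).
Proof.
by move=> Px Jy; exists 1%N, (fun _ => x), (fun _ => y); split => //; rewrite big_ord1.
Qed.

Lemma ideal_powS k : ideal_pow K P k.+1 `<=` ideal_pow K P k.
Proof.
case: hP => -[PK P0 PD PM] _ _.
move=> _ [l [u [v [hu hv ->]]]]; have [JK J0 JD JM] := ideal_pow_ideal k.
elim/big_ind: _ => // i _; apply: JM; [exact/PK/hu|exact: hv].
Qed.

Lemma ideal_powW j k : (j <= k)%N -> ideal_pow K P k `<=` ideal_pow K P j.
Proof.
move=> /subnK <-; elim: (k - j)%N => [//|i IH] x; rewrite addSn => /ideal_powS.
exact: IH.
Qed.

(** An element of order 0 is a unit of the localization, and units are not in [P]. *)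
Lemma prime_ge_ord x : P x -> ge_ord O p 1 x.
Proof.
case: hP => -[PK P0 PD PM] _ _ Px; have xO : x \in O by apply/KO/PK.
have [->|x0] := eqVneq x 0; first by rewrite /ge_ord mul0r rpred0.
have [[|k] hk] := has_ord_exists dvrO xO x0; last exact: (ge_ordW dvrO _ (has_ord_ge hk)).
move: hk; rewrite has_ord0 => /and3P [_ _ /locO [a [s [aA sA sP E]]]].
case: sP; have -> : s = a * x by rewrite -E mulrAC mulVf // mul1r.
by apply: PM => //; apply: AK.
Qed.

Lemma ideal_pow_ge_ord k x : ideal_pow K P k x -> ge_ord O p k x.
Proof.
elim: k x => [|k IH] x; first by rewrite ge_ord0; apply: KO.
move=> [l [u [v [hu hv ->]]]]; elim/big_ind: _ => [|y z|i _].
- by rewrite /ge_ord mul0r rpred0.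
- exact: ge_ordD.
- by rewrite -add1n; apply: ge_ordM; [exact/prime_ge_ord/hu|exact/IH/hv].
Qed.

(** Nonzero primes are maximal: cancel powers of [s] from an integral equation
until its constant term is invertible modulo [d]. *)
Lemma prime_maximal s : OK s -> ~ P s -> exists2 t, OK t & P (1 - s * t).
Proof.
case: hP => -[PK P0 PD PM] P1 Pprime sK sP.
have PN x : P x -> P (- x).
  by move=> Px; rewrite -mulN1r; apply: PM => //; apply: (OKz (-1)).
have evK (q : {poly int}) : OK (zeval s q) by apply: integers_zeval.
have Pz (z : int) : (d%:Z %| z)%Z -> P z%:~R by move/Pd.
have main (q : {poly int}) i : ~~ (d%:Z %| q`_i)%Z -> P (zeval s q) ->
    exists2 t, OK t & P (1 - s * t).
  elim/poly_ind: q i => [|q z IH] i; first by rewrite coef0 dvdz0.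
  have ev : zeval s (q * 'X + z%:P) = zeval s q * s + z%:~R.
    by rewrite zevalD zevalM zeval_int [zeval s 'X]/zeval map_polyX hornerX.
  rewrite coefD coefMX coefC ev.
  have [dz|dz] := boolP (d%:Z %| z)%Z.
    case: i => [|i] /=; first by rewrite add0r dz.
    rewrite addr0 => hi h.
    have /(Pprime _ _ (evK q) sK) [/(IH i hi)//|//] : P (zeval s q * s).
    by rewrite -[_ * s](addrK z%:~R); apply: PD => //; apply/PN/Pz.
  move=> _ h; have : coprimez d z.
    by rewrite coprimezE prime_coprime //; move: dz; rewrite dvdzE.
  case/coprimezP => -[u v] /= /(congr1 (fun t : int => t%:~R : C)).
  rewrite rmorphD !rmorphM /= => E.
  exists (- (v%:~R * zeval s q)).
    by rewrite -mulN1r; apply: OKM; [exact: (OKz (-1))|apply: OKM].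
  have -> : 1 - s * - (v%:~R * zeval s q) = u%:~R * d%:R + v%:~R * (zeval s q * s + z%:~R).
    have {}E : 1 = u%:~R * d%:R + v%:~R * z%:~R :> C by rewrite -[LHS]E.
    by rewrite {1}E; ring.
  by apply: PD; apply: PM; [exact: OKz|exact: (Pz d%:Z (dvdzz d%:Z))|exact: OKz|exact: h].
case: (sK) => _ [q mq rq]; apply: (main q (size q).-1).
  by rewrite -lead_coefE (monicP mq) dvdz1 /=; apply: contraTneq (prime_gt1 d_prime) => ->.
by rewrite /zeval (eqP rq).
Qed.

(** Some multiple [s * x] with [s] outside [P] lies in the [k]-th power of [P]; as
[s] is invertible modulo [P], the element [x] can be moved into successive powers
of [P]. *)
Lemma ge_ord_ideal_pow k x : OK x -> ge_ord O p k x -> ideal_pow K P k x.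
Proof.
case: hP => -[PK P0 PD PM] P1 Pprime xK /locO [a [s [aA sA sP E]]].
have p0 := dvr_neq0 dvrO.
have Es : s * x = a * p ^+ k by rewrite -E; field; rewrite expf_neq0.
have pk j : ideal_pow K P j (p ^+ j).
  elim: j => [|j IH]; first exact: (OKz 1).
  by rewrite exprS; apply: ideal_mul_mem.
have sx : ideal_pow K P k (s * x).
  by rewrite Es; have [_ _ _ JM] := ideal_pow_ideal k; apply: JM => //; apply: AK.
have [t tK Pt] := prime_maximal (AK sA) sP.
have : forall j, (j <= k)%N -> ideal_pow K P j x.
  elim=> [//|j IH jk].
  have [_ _ JD JM] := ideal_pow_ideal j.+1.
  have -> : x = t * (s * x) + (1 - s * t) * x by ring.
  apply: JD; first by apply: JM => //; apply: ideal_powW sx.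
  by apply: ideal_mul_mem => //; apply: IH; apply: ltnW.
exact.
Qed.

(** The orders defined by powers of [P] and by the uniformizer agree on integers of
[K], whichever fraction represents [x]. A nonzero denominator [b] lies in only finitely
many powers of [P] because its order is finite. *)
Lemma val_at_ge_ord (k : nat) x : (k%:Z%:E <= val_at K P x)%E -> (0 < k)%N -> ge_ord O p k x.
Proof.
rewrite /val_at; case: eqVneq => [->|x0]; first by rewrite /ge_ord mul0r rpred0.
case: xgetP => [z _|_]; last by rewrite lee_fin lez_nat; case: k.
move=> [a [b [aK bK b0 Ex ->]]]; rewrite lee_fin => hk k0.
have ha : ideal_pow K P (ord_at K P a) a.
  by rewrite /ord_at; case: xgetP => [n _ []|].
have bO : b \in O by apply: KO.
have [j hj] := has_ord_exists dvrO bO b0.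
have jb : (j <= ord_at K P b)%N.
  rewrite /ord_at; case: xgetP => [n _ [_ nb]|nb].
    rewrite leqNgt; apply/negP => nj; apply: nb.
    by apply: ge_ord_ideal_pow => //; apply: (ge_ordW dvrO nj); apply: has_ord_ge.
  have allb n : ideal_pow K P n b.
    elim: n => // n IH; apply: contrapT => hn; exact: (nb n (conj IH hn)).
  by have := has_ord_le dvrO hj (ideal_pow_ge_ord (allb j.+1)); rewrite ltnn.
have ak : ge_ord O p (k + j) a.
  by apply: (ge_ordW dvrO _ (ideal_pow_ge_ord ha)); lia.
rewrite Ex /ge_ord; case/and3P: hj => h0 _ hV.
have -> : a / b / p ^+ k = a / p ^+ (k + j) * (b / p ^+ j)^-1.
  by rewrite exprD; field; rewrite b0 !expf_neq0 // (dvr_neq0 dvrO).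
by rewrite rpredM.
Qed.

End IdealValuation.

(** * Galois groups of iterated preimages *)

Section GaloisGroup.
Variable C : numClosedFieldType.
Local Notation alg := (@algebraic C).

Definition diag_graph (S : {pred C}) : {pred C * C} :=
  [pred z | (z.1 \in S) && (z.1 == z.2)].

Lemma diag_graph_subring (S : subringClosed C) : subring_closed (diag_graph S).
Proof.
split; first by rewrite inE /= rpred1 eqxx.
- by move=> [x1 x2] [y1 y2] /andP [/= h1 /eqP <-] /andP [/= h2 /eqP <-]; rewrite inE /= rpredB // eqxx.
- by move=> [x1 x2] [y1 y2] /andP [/= h1 /eqP <-] /andP [/= h2 /eqP <-]; rewrite inE /= rpredM // eqxx.
Qed.
HB.instance Definition _ (S : subringClosed C) :=
  GRing.isSubringClosed.Build (C * C)%type (diag_graph S) (@diag_graph_subring S).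

Lemma diag_graphE (S : {pred C}) x : ((x, x) \in diag_graph S) = (x \in S).
Proof. by rewrite inE /= eqxx andbT. Qed.

Lemma diag_graph_hom (S : divringClosed C) : {subset S <= alg} ->
  hom_graph (diag_graph S).
Proof.
move=> Sa; split.
- by move=> r; rewrite diag_graphE rpred_rat.
- by move=> y /andP [_ /eqP].
- by move=> z /andP [/Sa].
Qed.

(** Homomorphisms are total functions on [C] whose values matter only on the algebraic
numbers; there they are injective. *)
Definition alg_hom (s : C -> C) := [/\ {in alg &, {morph s : x y / x + y}},
  {in alg &, {morph s : x y / x * y}} & {in alg, forall x, s x = 0 -> x = 0}].

Section AlgHom.
Variable s : C -> C.
Hypothesis hs : alg_hom s.

Let sD : {in alg &, {morph s : x y / x + y}}. Proof. by case: hs. Qed.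
Lemma alg_homM : {in alg &, {morph s : x y / x * y}}. Proof. by case: hs. Qed.
Let s_eq0 : {in alg, forall x, s x = 0 -> x = 0}. Proof. by case: hs. Qed.

Let s0 : s 0 = 0.
Proof. by apply: (addrI (s 0)); rewrite -sD ?rpred0 // !addr0. Qed.

Lemma alg_homB : {in alg &, {morph s : x y / x - y}}.
Proof.
move=> x y xa ya; apply: (addIr (s y)).
by rewrite -sD ?rpredB // !subrK.
Qed.

Lemma alg_hom1 : s 1 = 1.
Proof.
have s1 : s 1 != 0 by apply: contra_neq (oner_neq0 C); apply/s_eq0/rpred1.
by apply: (mulfI s1); rewrite -alg_homM ?rpred1 // !mulr1.
Qed.

Lemma alg_hom_div : {in alg &, {morph s : x y / x / y}}.
Proof.
move=> x y xa ya; have [->|y0] := eqVneq y 0; first by rewrite s0 !invr0 !mulr0 s0.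
have sy : s y != 0 by apply: contra_neq y0; apply: s_eq0.
by apply: (mulIf sy); rewrite -alg_homM ?rpred_div // !divfK.
Qed.

Lemma alg_homX k : {in alg, {morph s : x / x ^+ k}}.
Proof.
move=> x xa; elim: k => [|k IH]; first exact: alg_hom1.
by rewrite !exprS alg_homM ?rpredX // IH.
Qed.

Lemma alg_hom_inj : {in alg &, injective s}.
Proof.
move=> x y xa ya E; apply/eqP; rewrite -subr_eq0; apply/eqP/s_eq0; first exact: rpredB.
by rewrite alg_homB // E subrr.
Qed.

Lemma alg_hom_iter d c y j : c \in alg -> y \in alg -> s c = c ->
  s (iter j (unic d c) y) = iter j (unic d c) (s y).
Proof.
move=> ca ya sc; elim: j => //= j IH.
by rewrite {1}/unic sD ?alg_homX ?rpredX ?iter_unic_closed // sc IH.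
Qed.

End AlgHom.

Lemma iter_polyE d (c : C) n :
  iter_poly n (unicritical d c) = iter n (unic d c%:P) 'X.
Proof.
elim: n => //= n IH; rewrite -/(iter_poly n _) IH /unicritical.
by rewrite comp_polyD comp_polyC rmorphXn /= comp_polyX.
Qed.

Lemma horner_iter_unic d (c : C) (q : {poly C}) n x :
  (iter n (unic d c%:P) q).[x] = iter n (unic d c) q.[x].
Proof. by elim: n => //= n IH; rewrite hornerD horner_exp IH hornerC. Qed.

Lemma horner_iter_poly d (c : C) n x :
  (iter_poly n (unicritical d c)).[x] = iter n (unic d c) x.
Proof. by rewrite iter_polyE horner_iter_unic hornerX. Qed.

Lemma size_iter_unicC d (c : C) (q : {poly C}) n : (1 < d)%N -> q \is monic -> size q = 2%N ->
  iter n (unic d c%:P) q \is monic /\ size (iter n (unic d c%:P) q) = (d ^ n).+1.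
Proof.
move=> d2 mq sq; rewrite -[(d ^ n)%N]mul1n; apply: size_iter_unic => //.
exact: leq_trans (size_polyC_leq1 c) _.
Qed.

Lemma preimage_poly_neq0 d (c alpha : C) n : (1 < d)%N ->
  iter_poly n (unicritical d c) - alpha%:P != 0.
Proof.
move=> d2; have [_ s] := size_iter_unicC c n d2 (monicX C) (size_polyX C).
rewrite subr_eq0; apply/eqP => /(congr1 (fun p : {poly C} => size p)).
rewrite iter_polyE s size_polyC => h; have := expn_gt0 d n.
by rewrite (ltnW d2) /=; case: (alpha != 0) h => // -[->].
Qed.

Lemma field_gen_sub (S T : set C) : subfield T -> S `<=` T -> field_gen S `<=` T.
Proof. by move=> hT ST x; apply. Qed.

Lemma sub_field_gen (S : set C) : S `<=` field_gen S.
Proof. by move=> x Sx T [_ ST]; apply: ST. Qed.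

Lemma subfieldP (T : set C) : T 1 -> (forall x y, T x -> T y -> T (x - y)) ->
  (forall x y, T x -> T y -> T (x / y)) -> subfield T.
Proof.
move=> T1 TB Td; split; first by rewrite inE.
  by move=> x y; rewrite !inE; apply: TB.
by move=> x y; rewrite !inE; apply: Td.
Qed.

Lemma field_gen_subfield (S : set C) : subfield (field_gen S).
Proof.
apply: subfieldP.
- by move=> T [hT _]; apply/(subfield_predE hT)/rpred1.
- move=> x y hx hy T hT; have [hT' _] := hT.
  by apply/(subfield_predE hT')/rpredB; apply/(subfield_predE hT'); [apply: hx|apply: hy].
- move=> x y hx hy T hT; have [hT' _] := hT.
  by apply/(subfield_predE hT')/rpred_div; apply/(subfield_predE hT'); [apply: hx|apply: hy].
Qed.

Section Arboreal.
Variables (K : set C) (d : nat) (c alpha : C).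
Hypotheses (hK : subfield K) (d_prime : prime d).
Hypotheses (Kalg : forall x, K x -> x \in alg) (Kc : K c) (Kalpha : K alpha).

Local Notation E n := (preimage_field K (unicritical d c) alpha n).

Let rootE' n x : root (iter_poly n (unicritical d c) - alpha%:P) x =
  (iter n (unic d c) x == alpha).
Proof. by rewrite rootE hornerD hornerN hornerC horner_iter_poly subr_eq0. Qed.

(** Taking preimages only involves subtracting [c] and extracting [d]-th roots. *)
Lemma iter_unic_algebraic n x : iter n (unic d c) x \in alg -> x \in alg.
Proof.
elim: n => // n IH /= h; apply: IH; apply: (algebraic_root (prime_gt0 d_prime)).
by rewrite -[_ ^+ d](addrK c) rpredB // Kalg.
Qed.

Let root_alg n x : iter n (unic d c) x = alpha -> x \in alg.
Proof. by move=> h; apply: (@iter_unic_algebraic n); rewrite h Kalg. Qed.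

Lemma preimage_field_algebraic n x : E n x -> x \in alg.
Proof.
apply: (@field_gen_sub _ [set` alg]).
  apply: subfieldP => /=; first exact: rpred1.
    by move=> *; apply: rpredB.
  by move=> *; apply: rpred_div.
by move=> y [/Kalg//|/=]; rewrite rootE' => /eqP /root_alg.
Qed.

(** An injective map that preserves the finite set of roots permutes it, so the
restriction to each preimage field is onto. The same function therefore
represents an element of the inverse limit at every level. *)
Lemma alg_hom_arboreal s n : alg_hom s -> (forall x, K x -> s x = x) ->
  arboreal_gal K (unicritical d c) alpha n s.
Proof.
move=> hs sK.
have Ea x : E n x -> x \in alg by apply: preimage_field_algebraic.
have KE x : K x -> E n x by move=> Kx; apply: sub_field_gen; left.
have RE x : iter n (unic d c) x = alpha -> E n x.
  by move=> h; apply: sub_field_gen; right; rewrite /= rootE' h eqxx.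
have hE : subfield (E n) by apply: field_gen_subfield.
have EE := subfield_predE hE.
have K1 : K 1 by apply/(subfield_predE hK)/rpred1.
have sR x : iter n (unic d c) x = alpha -> iter n (unic d c) (s x) = alpha.
  move=> h; have ca := Kalg Kc; have xa := root_alg h.
  by rewrite -alg_hom_iter ?h ?sK.
have sE x : E n x -> E n (s x).
  pose T := [set x | x \in alg /\ E n (s x)].
  move=> Ex; suff : T x by case.
  move: x Ex; apply: field_gen_sub.
    apply: subfieldP.
    - by split; [apply: rpred1|rewrite sK //; apply: KE].
    - move=> x y [xa Ex] [ya Ey]; split; first exact: rpredB.
      by rewrite alg_homB // EE rpredB // -EE.
    - move=> x y [xa Ex] [ya Ey]; split; first exact: rpred_div.
      by rewrite alg_hom_div // EE rpred_div // -EE.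
  move=> x [Kx|/=]; first by split; [apply: Kalg|rewrite sK //; apply: KE].
  by rewrite rootE' => /eqP h; split; [apply: root_alg h|apply: RE; apply: sR].
split; last exact: sK.
- split.
  + exact: sE.
  + by move=> x y; rewrite !inE => /Ea xa /Ea ya; apply: alg_hom_inj.
  + pose T := [set y | exists2 x, E n x & s x = y].
    rewrite -/T; apply: field_gen_sub.
      apply: subfieldP.
      * by exists 1; [apply: KE|apply: sK].
      * move=> _ _ [x Ex <-] [y Ey <-]; exists (x - y); last by rewrite alg_homB //; apply: Ea.
        by rewrite EE rpredB // -EE.
      * move=> _ _ [x Ex <-] [y Ey <-]; exists (x / y); last by rewrite alg_hom_div //; apply: Ea.
        by rewrite EE rpred_div // -EE.
    move=> y [Ky|/=]; first by exists y; [apply: KE|apply: sK].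
    set q := _ - _ => ry.
    have [l Eq] := closed_field_poly_normal q.
    have q0 : q != 0 by apply: preimage_poly_neq0 (prime_gt1 d_prime).
    have rq z : (z \in undup l) = root q z.
      by rewrite mem_undup [in RHS]Eq rootZ ?lead_coef_eq0 // root_prod_XsubC.
    have sub : {subset map s (undup l) <= undup l}.
      by move=> _ /mapP [z + ->]; rewrite !rq !rootE' => /eqP h; apply/eqP/sR.
    have un : uniq (map s (undup l)).
      rewrite map_inj_in_uniq ?undup_uniq // => x z; rewrite !rq !rootE' => /eqP hx /eqP hz.
      by apply: alg_hom_inj => //; apply: root_alg; [apply: hx|apply: hz].
    have [_ mm] := uniq_min_size un sub (eq_leq (esym (size_map _ _))).
    move: ry; rewrite -rq -mm => /mapP [x xl ->]; exists x => //.
    by apply: RE; move: xl; rewrite rq rootE' => /eqP.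
- by case: hs => h _ _ x y /Ea xa /Ea ya; apply: h.
- by case: hs => _ h _ x y /Ea xa /Ea ya; apply: h.
Qed.

Hypothesis ab : arboreal_gal_lim_abelian K (unicritical d c) alpha.
Variable zeta : C.
Hypotheses (Kzeta : K zeta) (zeta_d : zeta ^+ d = 1) (zeta1 : zeta != 1).

(** If [tau] sends [u] to [u'], and [beta ^+ d = u - c], then [tau beta / beta]
is fixed by every [sigma] fixing [u]: [sigma] multiplies [beta] by a root of
unity of [K], hence multiplies [tau beta] by the same root of unity because it
commutes with [tau]. *)
Lemma abelian_kummer (M : divringClosed C) r u u' :
  (forall x, K x -> x \in M) -> {subset M <= alg} -> u \in M ->
  iter r (unic d c) u = alpha -> u != c -> u' \in M ->
  hom_graph (adjoin (diag_graph (subfield_pred hK)) (u, u')) ->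
  exists2 rho, rho \in M & rho ^+ d * (u - c) = u' - c.
Proof.
move=> KM Ma uM Eu uc u'M hG; have d0 := prime_gt0 d_prime.
pose G : subringClosed (C * C)%type := adjoin (diag_graph (subfield_pred hK)) (u, u').
have [t [tD tM t0 tG]] := hom_extension (G := G) hG.
have ht : alg_hom t by split.
have tK x : K x -> t x = x.
  move=> Kx; apply: (tG (x, x)); apply: mem_adjoin.
  by rewrite diag_graphE -subfield_predE.
have tu : t u = u' by apply: (tG (u, u')); apply: adjoin_gen.
have ua := Ma _ uM; have ca := Kalg Kc.
pose beta := d.-root (u - c).
have Eb : beta ^+ d = u - c by rewrite rootCK.
have ba : beta \in alg by apply: (algebraic_root d0); rewrite Eb rpredB.
have b0 : beta != 0.
  by apply: contraNneq uc => b0; rewrite -subr_eq0 -Eb b0 expr0n eqn0Ngt d0.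
have Etb : t beta ^+ d = u' - c by rewrite -alg_homX // Eb alg_homB // tu tK.
have Er : E r.+1 beta.
  apply: sub_field_gen; right.
  suff : root (iter_poly r.+1 (unicritical d c) - alpha%:P) beta by [].
  by rewrite rootE' iterSr {2}/unic Eb subrK Eu eqxx.
have tba : t beta \in alg by apply: (algebraic_root d0); rewrite Etb rpredB // Ma.
pose rho := t beta / beta.
have Erho : rho ^+ d * (u - c) = u' - c.
  by rewrite expr_div_n Etb Eb divfK // subr_eq0.
exists rho => //; apply/negPn/negP => rM.
have rda : rho ^+ d \in M.
  by rewrite expr_div_n Etb Eb rpred_div // rpredB // KM.
have hM := diag_graph_hom Ma.
have [y yr hy] : exists2 y, y != rho & hom_graph (adjoin (diag_graph M) (rho, y)).
  apply: (@hom_graph_move _ (diag_graph M) rho d) => //.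
  - by move=> z /andP [_ /eqP].
  - exact: rpred_div.
  - by rewrite diag_graphE.
  - by rewrite diag_graphE.
pose H : subringClosed (C * C)%type := adjoin (diag_graph M) (rho, y).
have [s [sD sM s0 sG]] := hom_extension (G := H) hy.
have hs : alg_hom s by split.
have sM' x : x \in M -> s x = x.
  by move=> xM; apply: (sG (x, x)); apply: mem_adjoin; rewrite diag_graphE.
have sK x : K x -> s x = x by move=> /KM; apply: sM'.
have sr : s rho = y by apply: (sG (rho, y)); apply: adjoin_gen.
have lim f : alg_hom f -> (forall x, K x -> f x = x) ->
    arboreal_gal_lim K (unicritical d c) alpha (fun _ => f).
  by move=> hf fK; split => // n; apply: alg_hom_arboreal.
have comm := ab (lim s hs sK) (lim t ht tK) Er.
have Esb : s beta ^+ d = beta ^+ d by rewrite -alg_homX // Eb sM' // rpredB // KM.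
pose eta := s beta / beta.
have Keta : K eta.
  have /(prim_rootP (prime_unity_prim d_prime zeta_d zeta1)) [i ->] : eta ^+ d = 1.
    by rewrite expr_div_n Esb divff // expf_neq0.
  by rewrite (subfield_predE hK) rpredX // -subfield_predE.
have sb : s beta = eta * beta by rewrite divfK.
have stb : s (t beta) = eta * t beta by have ea := Kalg Keta; rewrite comm sb alg_homM // tK.
have eta0 : eta != 0.
  rewrite mulf_neq0 ?invr_eq0 //; apply: contraNneq b0 => sb0; apply/eqP.
  exact: s0 sb0.
by case/negP: yr; rewrite -sr alg_hom_div // stb sb -mulf_div divff // mul1r.
Qed.

End Arboreal.
End GaloisGroup.

(** A predicate form of [polyOver], to which statements about subrings apply. *)
Definition polys_over (R : comNzRingType) (S : {pred R}) : {pred {poly R}} :=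
  fun q => q \is a polyOver S.

Lemma polys_over_subring (R : comNzRingType) (S : subringClosed R) :
  subring_closed (polys_over S).
Proof. by split=> [|p q|p q]; [apply: rpred1|apply: rpredB|apply: rpredM]. Qed.
HB.instance Definition _ (R : comNzRingType) (S : subringClosed R) :=
  GRing.isSubringClosed.Build {poly R} (polys_over S) (@polys_over_subring R S).

(** * The final contradiction *)
Section Conjugates.
Variables (C : numClosedFieldType) (K : set C) (d r : nat) (c alpha : C).
Variables (O : subringClosed C) (p b : C).
Hypotheses (hK : subfield K) (d_prime : prime d) (r_gt0 : (0 < r)%N).
Hypotheses (Kalg : forall x, K x -> x \in @algebraic C) (Kc : K c) (Kalpha : K alpha).
Hypothesis KO : forall x, K x -> x \in frac O p.
Hypotheses (dvrO : dvr O p).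
Hypothesis free : forall q : {poly C}, (forall i, q`_i \in frac O p) ->
  (size q <= d ^ r)%N -> root q b -> q = 0.
Hypothesis Eb : iter r (unic d c) (b + c) = alpha.

(** By [eisenstein_free] the minimal polynomial of [b + c] over [K] has degree at
least [d ^ r], so it is [f^r - alpha]. As [0 < r] this is a polynomial in
[X^d], and multiplying a root by [z] gives another root. *)
Lemma hom_graph_conj (z : C) : z ^+ d = 1 ->
  hom_graph (adjoin (diag_graph (subfield_pred hK)) (b + c, z * (b + c))).
Proof.
move=> zd; set u := b + c; pose G : subringClosed (C * C)%type := diag_graph (subfield_pred hK).
have Ga : {subset subfield_pred hK <= @algebraic C}.
  by move=> x; rewrite -subfield_predE => /Kalg.
have hG : hom_graph G by apply: diag_graph_hom.
have ua : u \in @algebraic C.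
  by apply: (iter_unic_algebraic d_prime Kalg Kc (n := r)); rewrite Eb Kalg.
have elt x : K x -> (x, x) \in G by rewrite diag_graphE -subfield_predE.
pose phi1 : {rmorphism subring_type G -> C} := (fst \o val : subring_type G -> C).
pose phi2 : {rmorphism subring_type G -> C} := (snd \o val : subring_type G -> C).
have phiE (q : {poly subring_type G}) : map_poly phi2 q = map_poly phi1 q.
  by apply/polyP => i; rewrite !coef_map /=; case/andP: (valP q`_i) => _ /eqP.
have phiK (q : {poly subring_type G}) i : K (map_poly phi1 q)`_i.
  by rewrite (subfield_predE hK) coef_map; case/andP: (valP q`_i).
pose h : {poly C} := iter r (unic d c%:P) 'X - alpha%:P.
have hh x : root h x = (iter r (unic d c) x == alpha).
  by rewrite rootE hornerD hornerN hornerC horner_iter_unic hornerX subr_eq0.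
pose h' : {poly subring_type G} :=
  iter r (unic d (SubringElt (elt c Kc))%:P) 'X - (SubringElt (elt alpha Kalpha))%:P.
have Eh : map_poly phi1 h' = h.
  rewrite (rmorphB (map_poly phi1)); congr (_ - _); last exact: (map_polyC phi1).
  transitivity (iter r (unic d (map_poly phi1 (SubringElt (elt c Kc))%:P)) (map_poly phi1 'X)).
    exact: (rmorph_iter_unic (map_poly phi1)).
  by rewrite (map_polyX phi1) (map_polyC phi1).
have [q [mq rq min]] := hom_graph_min_poly hG ua.
have [s Es] : exists s, h' = s * q.
  by apply: min; rewrite -[map_poly _ _]/(map_poly phi1 h') Eh hh Eb.
have Es1 : h = map_poly phi1 s * map_poly phi1 q.
  by rewrite -Eh Es; apply: (rmorphM (map_poly phi1)).
have [_ sh] := size_iter_unicC c r (prime_gt1 d_prime) (monicX C) (size_polyX C).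
have {}sh : size h = (d ^ r).+1.
  rewrite size_polyDl ?sh // size_polyN (leq_ltn_trans (size_polyC_leq1 _)) //.
  by rewrite ltnS expn_gt0 prime_gt0.
have mq1 : map_poly phi1 q \is monic by apply: monic_map.
pose FO : divringClosed C :=
  HB.pack (frac O p) (GRing.isDivringClosed.Build C (frac O p) (frac_divring dvrO)).
have qD : (d ^ r < size (map_poly phi1 q))%N.
  rewrite ltnNge; apply/negP => sq.
  have : map_poly phi1 q \Po ('X + c%:P) = 0.
    apply: free.
    - move=> i; suff /polyOverP : map_poly phi1 q \Po ('X + c%:P) \is a polyOver FO by exact.
      apply: polyOver_comp; first by apply/polyOverP => j; apply: KO.
      by rewrite rpredD ?polyOverX // polyOverC; apply: KO.
    - by rewrite size_comp_poly2 // -[c%:P]opprK -polyCN size_XsubC.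
    - by rewrite rootE horner_comp hornerD hornerX hornerC.
  move/eqP; rewrite comp_poly_eq0 ?(negPf (monic_neq0 mq1)) //.
  by rewrite -[c%:P]opprK -polyCN size_XsubC.
have hq : map_poly phi1 q %= h.
  have dq : map_poly phi1 q %| h by rewrite Es1 dvdp_mull.
  rewrite -(dvdp_size_eqp dq) eqn_leq dvdp_leq //=; first by rewrite sh.
  by rewrite -size_poly_gt0 sh.
apply: (hom_graph_adjoin hG ua) => t /min [t' ->].
have -> : map_poly (snd \o val) (t' * q) = map_poly phi2 t' * map_poly phi2 q.
  exact: (rmorphM (map_poly phi2)).
by rewrite rootM phiE (phiE q) (eqp_root hq) hh iter_unic_root // Eb eqxx orbT.
Qed.

End Conjugates.

Section NonAbelian.
Variables (C : numClosedFieldType) (d m n : nat) (zeta c alpha : C) (G : {poly C}) (P : set C).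
Hypotheses (d_prime : prime d) (zeta_d : zeta ^+ d = 1) (zeta1 : zeta != 1).
Hypotheses (m2 : (2 <= m)%N) (n1 : (1 <= n)%N).
Hypotheses (hG : is_misiurewicz_poly d m n zeta G) (hc : root G c).
Hypothesis d_n : d = 2%N -> (2 <= n)%N.
Let K := simple_ext c.
Hypotheses (Kalpha : K alpha) (hP : prime_ideal_of K P) (Pd : lies_above P d).
Hypothesis val_alpha : (2%:E <= val_at K P alpha)%E.
Let A : subringClosed C := zadj c.
Let a := orb d c.

Let hK : subfield K := field_gen_subfield _.
Let Kc : K c. Proof. exact: sub_field_gen. Qed.

Let AK_of : (exists2 q : {poly int}, q \is monic & root (map_poly intr q) c) ->
  forall x, x \in A -> integers_of K x.
Proof. by move=> ci x /zadjP [q ->]; apply: integers_zeval. Qed.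

Let Pdd : P d%:R. Proof. by apply/(Pd d%:Z)/dvdzz. Qed.

Let d_nonunit : (exists2 q : {poly int}, q \is monic & root (map_poly intr q) c) ->
  forall s, s \in zadj c -> 1 + d%:R * s != 0.
Proof.
case: hP => -[_ _ _ PM] P1 _ ci s sA; apply/eqP => E; apply: P1.
have -> : 1 = - s * d%:R by apply/eqP; rewrite -subr_eq0 mulNr opprK mulrC E.
by apply: PM => //; apply: AK_of; rewrite // rpredN.
Qed.

Let am0 : a (m - 1) != 0 := misiurewicz_not_periodic d_prime zeta1 m2 n1 hG hc.
Let rel : a (m + n - 1) = zeta * a (m - 1) :=
  (misiurewicz_exact d_prime zeta_d zeta1 m2 n1 d_nonunit hG hc).1.
Let period := misiurewicz_period d_prime zeta_d zeta1 m2 n1 d_nonunit hG hc.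

Let c_int : exists2 q : {poly int}, q \is monic & root (map_poly intr q) c.
Proof.
have [E _] := period; apply: (@zint_orb _ _ d_prime c (m + n).-1 m.-1); first by lia.
by rewrite !prednK ?addn_gt0 ?n1 ?orbT // ltnW.
Qed.
Let AK := AK_of c_int.

Let P0 : P 0. Proof. by case: hP => -[]. Qed.
Let P1 : ~ P 1. Proof. by case: hP. Qed.
Let PD x y : P x -> P y -> P (x + y). Proof. by case: hP => -[_ _ h _] _ _; apply: h. Qed.
Let PM x y : x \in A -> P y -> P (x * y).
Proof. by case: hP => -[_ _ _ h] _ _ /AK; apply: h. Qed.
Let Pprime x y : x \in A -> y \in A -> P (x * y) -> P x \/ P y.
Proof. by case: hP => _ _ h /AK xK /AK yK; apply: h. Qed.

Let Pa j : P (a j) <-> (n %| j)%N.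
Proof. by case: period => per ex; apply: (@orb_mod_prime C d m n c P). Qed.

Let pi := a n.
Let piA : pi \in A. Proof. by apply: orb_closed; apply: zadj_gen. Qed.

Section LocalField.
Variable O : subringClosed C.
Hypothesis locE : forall x, (x \in O) <-> exists a s, [/\ a \in A, s \in A, ~ P s & x * s = a].

Let Q := (d ^ (m - 1) - (n %| m - 1))%N.
Let base := localization_dvr d_prime m2 n1 zeta_d zeta1 c_int P0 P1 PD PM Pprime Pdd Pa am0 rel locE.
Let dvrO : dvr O pi. Proof. by case: base. Qed.
Let zetaO : zeta \in O. Proof. by case: base. Qed.
Let Q0 : (0 < Q)%N. Proof. by case: base. Qed.
Let ord_zeta : has_ord O pi Q (1 - zeta). Proof. by case: base. Qed.
Let ord_d : has_ord O pi (d.-1 * Q) d%:R. Proof. by case: base. Qed.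
Let AO x : x \in A -> x \in O. Proof. exact: (mem_loc P1 locE). Qed.
Let cO : c \in O. Proof. exact/AO/zadj_gen. Qed.

Let K_frac x : K x -> x \in frac O pi.
Proof.
have [F1 FB Fd] := frac_divring dvrO.
apply: (@field_gen_sub _ _ [set` frac O pi]) => [|y /= ->]; last exact: frac_mem.
by apply: subfieldP.
Qed.

Let int_O x : integers_of K x -> x \in O.
Proof.
case=> /K_frac xF [q mq rq]; apply: (frac_integral dvrO (S := @zring C) _ xF (monic_map _ mq)) rq.
- by move=> _ /asboolP [z ->]; apply: rpred_int.
- by apply/polyOverP => i; rewrite coef_map; apply/asboolP; exists q`_i.
Qed.

Let ord_alpha : ge_ord O pi 2 alpha.
Proof.
have Ppi : P pi by apply/Pa.
apply: (val_at_ge_ord d_prime hK hP Pd AK dvrO piA Ppi _ int_O) val_alpha _ => //.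
by move=> x /locE.
Qed.

(** This choice makes [r] positive and [r.+1] a multiple of [n], so that the constant
coefficient [a_(r+1) - alpha] below has order 1. *)
Let r := (n * 2).-1.
Let r0 : (0 < r)%N. Proof. by rewrite ltn_predRL muln2 -addnn (leq_add n1 n1). Qed.
Let D := (d ^ r)%N.
Let D2 : (2 <= D)%N.
Proof. by rewrite (leq_trans (prime_gt1 d_prime)) // -{1}(expn1 d) leq_exp2l // prime_gt1. Qed.

(** The polynomial [f^r - alpha], translated so that its roots are [u - c]. *)
Let h : {poly C} := iter r (unic d c%:P) ('X + c%:P) - alpha%:P.

Let size_h : h \is monic /\ size h = D.+1.
Proof.
have mX : 'X + c%:P \is monic by rewrite -[c%:P]opprK -polyCN monicXsubC.
have sX : size ('X + c%:P) = 2%N by rewrite -[c%:P]opprK -polyCN size_XsubC.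
have [mh sh] := size_iter_unicC c r (prime_gt1 d_prime) mX sX.
have lt : (size (- alpha%:P) < size (iter r (unic d c%:P) ('X + c%:P)%R))%N.
  by rewrite sh size_polyN (leq_ltn_trans (size_polyC_leq1 _)) // ltnS expn_gt0 prime_gt0.
by rewrite size_polyDl // monicE lead_coefDl // -monicE.
Qed.

(** This displays [h] as an Eisenstein polynomial: [d] has positive order. *)
Let h_coef : exists2 z : {poly C}, z \is a polyOver O &
  h = 'X^D + (a r.+1 - alpha)%:P + d%:R *: (z * 'X).
Proof.
have cS : c%:P \in polys_over O by rewrite [_ \in _]polyOverC.
have XS : 'X \in polys_over O := polyOverX O.
have [z zO E] := iter_unicD d_prime r cS XS cS.
have Ec : iter r (unic d c%:P) c%:P = (a r.+1)%:P.
  rewrite /a /orb iterSr -[unic d c 0]/(orb d c 1) orb1 ?prime_gt0 //.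
  by rewrite (rmorph_iter_unic polyC).
by exists z => //; rewrite /h E Ec polyCB -mul_polyC polyC_natr; ring.
Qed.

Let ord_const : has_ord O pi 1 (a r.+1 - alpha).
Proof.
have -> : r.+1 = (n * 2)%N by rewrite prednK // muln_gt0 n1.
apply: has_ordB => //; apply: (localization_orb_ord d_prime n1 P1 locE dvrO 1).
Qed.

Lemma b_exists : exists b, root h b.
Proof. by apply/closed_rootP; case: size_h => _ ->; rewrite eqSS -lt0n ltnW. Qed.

Let h_over : h \is a polyOver O.
Proof.
have [z zO ->] := h_coef; rewrite !rpredD ?polyOverXn ?polyOverC ?polyOverZ ?rpred_nat //.
  by rewrite rpredB ?orb_closed // (ge_ord_mem dvrO ord_alpha).
by rewrite rpredM ?polyOverX.
Qed.

Let h_low i : (i < D)%N -> ge_ord O pi 1 h`_i.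
Proof.
have [z zO ->] := h_coef => iD.
rewrite !coefD coefXn coefC coefZ coefMX ltn_eqF // add0r.
have dO1 : ge_ord O pi 1 d%:R.
  by apply: (ge_ordW dvrO _ (has_ord_ge ord_d)); rewrite muln_gt0 Q0 -ltnS prednK ?prime_gt1 ?prime_gt0.
case: i iD => [|i] _ /=; first by rewrite mulr0 addr0 has_ord_ge.
rewrite add0r -[1%N]addn0; apply: (ge_ordM dO1); rewrite ge_ord0; exact: (polyOverP zO).
Qed.

Let h_const : has_ord O pi 1 h`_0.
Proof.
have [z zO ->] := h_coef.
by rewrite !coefD coefXn coefC coefZ coefMX /= mulr0 addr0 ltn_eqF ?add0r // ltnW.
Qed.

Hypothesis ab : arboreal_gal_lim_abelian K (unicritical d c) alpha.

Section Ramified.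
Variable b : C.
Hypothesis rb : root h b.
Let D_gt0 : (0 < (size h).-1)%N. Proof. by case: size_h => _ ->; apply: ltnW. Qed.
Let mh : h \is monic := size_h.1.
Let sD : (size h).-1 = D. Proof. by case: size_h => _ ->. Qed.
Let B : subringClosed C := adjoin O b.
Let h_low' i : (i < (size h).-1)%N -> ge_ord O pi 1 h`_i.
Proof. by rewrite sD; apply: h_low. Qed.
Let dvrB : dvr B b. Proof. exact: (eisenstein_dvr dvrO mh h_over rb D_gt0 h_low' h_const). Qed.
Let ordB k x : has_ord O pi k x -> has_ord B b (D * k) x.
Proof. by rewrite -sD; apply: (eisenstein_ord dvrO mh h_over rb D_gt0 h_low' h_const). Qed.

Let Eb : iter r (unic d c) (b + c) = alpha.
Proof.
move: rb; rewrite rootE hornerD hornerN hornerC horner_iter_unic hornerD hornerX hornerC.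
by rewrite subr_eq0 => /eqP.
Qed.

Let M : divringClosed C :=
  HB.pack (frac B b) (GRing.isDivringClosed.Build C (frac B b) (frac_divring dvrB)).
Let MP x : (x \in M) = (x \in frac B b). Proof. by []. Qed.

Let Kalg x : K x -> x \in @algebraic C.
Proof.
apply: (@field_gen_sub _ _ [set` @algebraic C]) => [|y /= ->].
  by apply: subfieldP => [|y z|y z] /=; [apply: rpred1|apply: rpredB|apply: rpred_div].
have [q mq rq] := c_int; apply/algebraicP; exists (map_poly intr q).
  by rewrite monic_neq0 // monic_map.
rewrite -map_poly_comp (eq_map_poly (_ : ratr \o intr =1 intr)) // => z /=.
by rewrite ratr_int.
Qed.

Let b_alg : b \in @algebraic C.
Proof.
rewrite -[b](addrK c) rpredB ?(Kalg Kc) //.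
by apply: (iter_unic_algebraic d_prime Kalg Kc (n := r)); rewrite Eb Kalg.
Qed.

Let AK' x : x \in A -> K x. Proof. by move=> /AK []. Qed.

Let OM x : x \in O -> x \in M.
Proof. by move=> xO; rewrite MP; apply: frac_mem; apply: mem_adjoin. Qed.
Let bM : b \in M. Proof. by rewrite MP; apply: frac_mem; apply: adjoin_gen. Qed.
Let cM : c \in M. Proof. exact: OM. Qed.

Let KM x : K x -> x \in M.
Proof.
have [F1 FB Fd] := frac_divring dvrB.
apply: (@field_gen_sub _ _ [set` frac B b]) => [|y /= ->]; last exact: cM.
by apply: subfieldP.
Qed.

Let Malg : {subset M <= @algebraic C}.
Proof.
move=> x; rewrite MP => /fracP [k hk].
rewrite -(mulfK (expf_neq0 k (dvr_neq0 dvrB)) x) rpred_div ?rpredX //.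
move: hk; apply: adjoin_sub => // y /locE [a' [s [aA sA sP E]]].
have s0 : s != 0 by apply: contra_notN sP => /eqP ->.
have sa := Kalg (AK' sA); have aa := Kalg (AK' aA).
by rewrite -(mulfK s0 y) E; apply: rpred_div.
Qed.

Let b0 : b != 0 := dvr_neq0 dvrB.

Let Kzeta : K zeta.
Proof.
have -> : zeta = a (m + n - 1) / a (m - 1) by rewrite rel mulfK.
have Ka j : K (a j) by apply: AK'; apply: orb_closed; apply: zadj_gen.
by rewrite (subfield_predE hK) rpred_div // -(subfield_predE hK).
Qed.

Let free (q : {poly C}) : (forall i, q`_i \in frac O pi) -> (size q <= d ^ r)%N ->
  root q b -> q = 0.
Proof.
by move=> hq sq; apply: (eisenstein_free dvrO mh h_over rb D_gt0 h_low' h_const hq); rewrite sD.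
Qed.

(** The consequence of commutativity for the conjugate [zeta ^+ i * u] of [u = b + c]. *)
Let kummer i : exists2 rho, rho \in M & rho ^+ d * b = zeta ^+ i * (b + c) - c.
Proof.
have zi : (zeta ^+ i) ^+ d = 1 by rewrite exprAC zeta_d expr1n.
have hG' := hom_graph_conj hK d_prime r0 Kalg Kc Kalpha K_frac dvrO free Eb zi.
have uM : b + c \in M by rewrite rpredD.
have u'M : zeta ^+ i * (b + c) \in M by rewrite rpredM // rpredX // OM.
have uc : b + c != c by rewrite -subr_eq0 addrK.
have [rho rM E] := abelian_kummer d_prime Kalg Kc Kalpha ab Kzeta zeta_d zeta1 KM Malg uM Eb uc u'M hG'.
by exists rho => //; rewrite -E addrK.
Qed.

Let E := (D * Q)%N.
Let hE : has_ord B b E (1 - zeta). Proof. exact: ordB. Qed.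
Let hd : has_ord B b (d.-1 * E) d%:R.
Proof. by rewrite /E mulnCA; apply: ordB. Qed.
Let dD : (d %| D)%N. Proof. by rewrite /D dvdn_exp. Qed.
Let dE : (d %| E)%N. Proof. by rewrite /E dvdn_mulr. Qed.
Let DE : (D <= E)%N. Proof. by rewrite /E leq_pmulr. Qed.
Let d2 := prime_gt1 d_prime.
Let hb : has_ord B b 1 b. Proof. by have := has_ordX dvrB 1; rewrite expr1. Qed.

Let not_pow_pred l w y : (d %| l.+1)%N -> (l < d * E)%N -> has_ord B b l w ->
  y \in M -> y ^+ d != 1 + w.
Proof.
move=> dl lE hw yM; apply: (not_pow dvrB d_prime hd lE _ hw yM).
by apply/negP => dl'; move: dl; rewrite -addn1 dvdn_addr // dvdn1 gtn_eqF.
Qed.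

(** When [c] is a unit, the [d]-th power [(zeta * u - c) / (u - c)] is [1 + w] with
[w = (zeta - 1) * u / b] of order [E - 1], where [E] is the order of [1 - zeta],
a multiple of [d]. *)
Lemma contradiction_period_gt1 : (2 <= n)%N -> False.
Proof.
move=> n2; have [rho rM Er] := kummer 1.
have uc : has_ord B b 0 c.
  rewrite -[0%N](muln0 D); apply: ordB; rewrite has_ord0.
  apply: (loc_unit P0 P1 locE); first exact: zadj_gen.
  have := Pa 1; rewrite /a orb1 ?prime_gt0 // => -> ; rewrite dvdn1.
  by apply/negP; rewrite neq_ltn n2 orbT.
pose w := (1 - zeta) * (- (c + b)) / b.
have hw : has_ord B b E.-1 w.
  rewrite -subn1; apply: (has_ord_div dvrB _ _ hb); first by rewrite (leq_trans _ DE) // ltnW.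
  rewrite -[X in has_ord _ _ X]addn0; apply: has_ordM hE _.
  by rewrite has_ordN; apply: has_ordD => //; apply: has_ord_ge.
have E0 : (0 < E)%N by rewrite (leq_trans _ DE) // ltnW.
have /eqP [] : rho ^+ d != 1 + w.
  apply: (not_pow_pred _ _ hw rM); first by rewrite prednK.
  by rewrite (leq_trans _ (leq_pmull E (ltnW d2))) // ltn_predL.
apply: (mulIf b0); rewrite Er expr1 /w; field.
by rewrite b0.
Qed.

(** When [n = 1] the point [c] is itself a uniformizer, [u] has order 1 and the
previous [w] has order [E], which says nothing. The combination
[rho1 ^+ 2 / rho2] of the elements obtained from [zeta] and [zeta ^+ 2] cancels
the leading term: its [d]-th power is [1 + w] with
[w = u * c * (1 - zeta) ^+ 2 / (b * v)] of order [D + 2 * E - 1]. This is less than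
[d * E] because [d] is at least 3. *)
Lemma contradiction_period1 : n = 1%N -> (3 <= d)%N -> False.
Proof.
move=> n_1 d3.
have [rho1 r1M E1] := kummer 1; have [rho2 r2M E2] := kummer 2.
have hc' : has_ord B b D c.
  rewrite -[D in has_ord _ _ D]muln1; apply: ordB.
  have := has_ordX dvrO 1; rewrite expr1 {2}/pi n_1 /a orb1 ?prime_gt0 //.
have hz : has_ord B b 0 zeta.
  rewrite -[0%N](muln0 D); apply: ordB; rewrite has_ord0.
  have z0 : zeta != 0.
    by apply/eqP => z0; move/eqP: zeta_d; rewrite z0 expr0n eqn0Ngt prime_gt0 // eq_sym oner_eq0.
  rewrite /ounit z0 zetaO /= (_ : zeta^-1 = zeta ^+ d.-1) ?rpredX //.
  by apply: (mulfI z0); rewrite divff // -exprS prednK ?prime_gt0 // zeta_d.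
have D2' : (1 < D)%N := D2.
have gc : ge_ord B b 2 c := ge_ordW dvrB D2 (has_ord_ge hc').
have hu : has_ord B b 1 (b + c) by apply: has_ordD.
have hv : has_ord B b 1 (zeta ^+ 2 * (b + c) - c).
  apply: has_ordB => //; rewrite -[1%N]add0n; apply: has_ordM hu.
  by have := has_ordXn 2 hz; rewrite mul0n.
set u := b + c in E1 E2 hu hv *; set v := _ - c in E2 hv *.
have v0 := has_ord_neq0 hv.
pose w := u * c * (1 - zeta) ^+ 2 / (b * v).
have l_gt0 : (0 < D + E * 2)%N by rewrite addn_gt0 (ltnW D2').
have hw : has_ord B b (D + E * 2).-1 w.
  have -> : (D + E * 2).-1 = (1 + D + E * 2 - (1 + 1))%N by rewrite add1n addSn subSS subn1.
  apply: (has_ord_div dvrB).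
  - by rewrite add1n addSn ltnS.
  - by apply: has_ordM (has_ordXn 2 hE); apply: has_ordM.
  - exact: (has_ordM hb hv).
have r20 : rho2 != 0.
  by apply: contraNneq v0 => r20; rewrite -E2 r20 expr0n eqn0Ngt prime_gt0 //= mul0r.
have /eqP [] : (rho1 ^+ 2 / rho2) ^+ d != 1 + w.
  apply: (not_pow_pred _ _ hw); last by rewrite rpred_div // rpredX.
    by rewrite prednK // dvdn_add // dvdn_mulr.
  rewrite prednK //.
  by rewrite (leq_trans (leq_add DE (leqnn (E * 2)))) // -mulnS mulnC leq_mul2r d3 orbT.
have e1 : rho1 ^+ d = (zeta * u - c) / b by rewrite -(expr1 zeta) -E1 mulfK.
have e2 : rho2 ^+ d = v / b by rewrite -E2 mulfK.
rewrite expr_div_n exprAC e1 e2 /w.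
have -> : u = b + c by [].
have Ev : v = zeta ^+ 2 * (b + c) - c by [].
move: v0; rewrite Ev => v0; field.
by rewrite b0 v0.
Qed.

End Ramified.
End LocalField.

Lemma not_abelian : ~ arboreal_gal_lim_abelian K (unicritical d c) alpha.
Proof.
move=> ab.
have [O locE] := localization_exists P1 Pprime.
have [b rb] := b_exists.
have [n2|] := leqP 2 n; first exact: (contradiction_period_gt1 locE ab rb n2).
move=> nlt; have n_1 : n = 1%N by apply/eqP; rewrite eqn_leq n1 andbT.
apply: (contradiction_period1 locE ab rb n_1).
rewrite ltn_neqAle (prime_gt1 d_prime) andbT eq_sym; apply/eqP => /d_n.
by rewrite n_1.
Qed.

End NonAbelian.

Unset Implicit Arguments.
Theorem corollary1p10 (R : realType) (d m n : nat) (zeta c0 alpha : R[i])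
    (G : {poly R[i]})
    (hd : prime d)
    (hzeta : d.-unity_root zeta) (hzeta1 : zeta != 1)
    (hm : (2 <= m)%N) (hn : (1 <= n)%N)
    (hG : is_misiurewicz_poly d m n zeta G)
    (hc0 : root G c0)
    (hd2 : d = 2%N -> (3 <= n)%N)
    (halpha : simple_ext c0 alpha)
    (hval : exists P : set R[i],
       [/\ prime_ideal_of (simple_ext c0) P,
           lies_above P d
         & (2%:E <= val_at (simple_ext c0) P alpha)%E]) :
  ~ arboreal_gal_lim_abelian (simple_ext c0) (unicritical d c0) alpha.
Proof.
have [P [hP Pd hv]] := hval; have zd : zeta ^+ d = 1 by apply/eqP; rewrite -unity_rootE.
exact: (not_abelian hd zd hzeta1 hm hn hG hc0 (fun e => ltnW (hd2 e)) halpha hP Pd hv).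
Qed.
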